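(* There is an algorithm that, given an $n$-vertex hypergraph $H$ of rank at most $4$, enumerates all minimal transversals of $H$ in time $O(1.8863^n)$.
   Context: A hypergraph $H=(V,E)$ consists of a finite vertex set $V$ and a set $E$ of subsets of $V$ called hyperedges; $n=|V|$. The rank of $H$ is the maximum size of a hyperedge. A transversal of $H$ is a set $S\subseteq V$ intersecting every hyperedge; it is minimal if no proper subset of it is a transversal. *)

(* Defs.v *)
From mathcomp Require Import all_boot.
Set Implicit Arguments. Unset Strict Implicit. Unset Printing Implicit Defensive.

Definition transversal (n : nat) (E : {set {set 'I_n}}) : pred {set 'I_n} :=
  fun A => [forall e in E, ~~ [disjoint e & A]].

Definition minimal_transversal (n : nat) (E : {set {set 'I_n}}) (A : {set 'I_n}) : bool :=
  minset (transversal E) A.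

Definition rank_le (n : nat) (E : {set {set 'I_n}}) (r : nat) : bool :=
  [forall e in E, #|e| <= r].

Inductive sym := Blank | Zero | One | Sep.
Inductive dir := DL | DR | DS.

Record TM := {
  tm_Q : finType;
  tm_start : tm_Q;
  tm_halt : tm_Q -> bool;
  tm_delta : tm_Q -> sym -> tm_Q * sym * dir
}.
Arguments tm_start : clear implicits.
Arguments tm_halt : clear implicits.
Arguments tm_delta : clear implicits.

(* configuration: state, cells left of the head (reversed, nearest first),
   cells from the head on (head cell first; missing cells are Blank).
   The tape is one-way infinite: moving left at cell 0 stays at cell 0. *)
Record config (M : TM) := Config {
  cf_state : tm_Q M;
  cf_left : seq sym;
  cf_right : seq sym
}.

Definition step (M : TM) (c : config M) : config M :=
  let: @Config _ q l r := c in
  if tm_halt M q then c else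
  let a := head Blank r in
  let r' := behead r in
  let: (q', b, d) := tm_delta M q a in
  match d with
  | DL => match l with
          | [::] => @Config M q' [::] (b :: r')
          | x :: l' => @Config M q' l' (x :: b :: r')
          end
  | DR => @Config M q' (b :: l) r'
  | DS => @Config M q' l (b :: r')
  end.

Definition init (M : TM) (w : seq sym) : config M := @Config M (tm_start M) [::] w.

Definition tape (M : TM) (c : config M) : seq sym := rev (cf_left c) ++ cf_right c.

Definition enc_set (n : nat) (A : {set 'I_n}) : seq sym :=
  [seq (if i \in A then One else Zero) | i <- enum 'I_n].

Definition enc_sets (n : nat) (L : seq {set 'I_n}) : seq sym :=
  flatten [seq enc_set S0 ++ [:: Sep] | S0 <- L].

Definition enc_hypergraph (n : nat) (E : {set {set 'I_n}}) : seq sym :=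
  nseq n One ++ Sep :: enc_sets (enum E).

Definition halts_with_output (M : TM) (w : seq sym) (T : nat) (out : seq sym) : Prop :=
  exists k, k <= T /\
    let c := iter k (@step M) (init M w) in
    tm_halt M (cf_state c) /\ exists b, tape c = out ++ nseq b Blank.

(* Main.v *)
(** A set T is a minimal transversal of E iff its complement O is a maximal
    independent set.  Visit the vertices in the order described by a string u,
    keeping O independent: a vertex whose addition to O completes a hyperedge is
    forced into T for free; any other vertex reads a bit of an advice string w,
    paying 4 to enter O and 5 to enter T.  Every v in T has a private hyperedge
    (one meeting T in v alone), so v is forced as soon as it comes last in it.
    Give the vertices random labels in {0,...,15}, repeated with some period m
    in [M, 2M), and visit them by increasing label: v is strictly last among the
    at most four vertices of its private hyperedge with probability at least
    225/1024 unless two labels coincide by periodicity, and by averaging over m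
    that happens to at most 3/40 of T as soon as M^2 >= 40n.  As
    225/1024 * 37/40 > 1/5, some order has total cost at most
    4n + |T| - 5|T|/5 = 4n.

    There are at most 2 (467/400)^b advice strings of cost at most b, since
    (400/467)^4 + (400/467)^5 <= 1, and (467/400)^4 < 1.8863.  Taking M linear in
    n/q with q a large constant, the orders needed are coded by strings of length
    n/q + 2 over three letters; enumerating all of them, polynomially many steps
    each, costs a factor 3^(O(n/q)).  A set is output only at the least u that
    encodes it within the budget, which removes duplicates.  Additive constants
    in the budget take care of small n.

    The single-tape machine is assembled from subroutines that simulate a
    bounded number of stacks stored one after the other on the tape. *)
Require Import Defs.
From mathcomp Require Import all_boot.
From mathcomp Require Import zify.
From Stdlib Require Import FunctionalExtensionality.
Set Implicit Arguments. Unset Strict Implicit. Unset Printing Implicit Defensive.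

(** * Composable machines *)

(** The weights 4 and 5 are matched to the fraction 1/5: when a fifth of [T] is forced, a vertex of
    [T] costs 5 * 4/5 = 4 on average, just like a vertex of O, so the bound 4n does not depend on
    the size of [T]. Labels from a continuum would make a vertex last among four with probability
    1/4; with 16 labels the ties take this down to 225/1024, which leaves room above 1/5 for the
    loss of 3/40.

    Randomness is removed by exhaustive search, and independent labels for all vertices would mean
    16^n cases; this is what forces labels to repeat. For any fixed period some private hyperedges
    may contain vertices of equal residue, which always tie; since such a period divides the
    distance of the two vertices, few periods do so for a given pair.

    Advice must be read to its end. It is then determined by the set and [u], so that a set can only
    recur for a different [u], and comparing orders is enough against duplicates. As (467/400)^4 is
    about 1.858, the gap up to 1.8863 pays for the search over [u] and for all polynomial
    factors. *)

(* A subroutine: a machine whose halting states are labelled by a result in L. *)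
Record frag (L : Type) := Frag {
  fQ : finType;
  fini : fQ;
  fexit : fQ -> option L;
  fdelta : fQ -> sym -> fQ * sym * dir
}.
Arguments fini {L} f.
Arguments fexit {L} f _.
Arguments fdelta {L} f _ _.

Definition act (Q : Type) (x : Q * sym * dir) (l r : seq sym) : Q * seq sym * seq sym :=
  let: (q, b, d) := x in
  match d with
  | DL => if l is y :: l' then (q, l', y :: b :: behead r) else (q, [::], b :: behead r)
  | DR => (q, b :: l, behead r)
  | DS => (q, l, b :: behead r)
  end.

Definition fstep L (f : frag L) (c : fQ f * seq sym * seq sym) :=
  let: (q, l, r) := c in
  if fexit f q then c else act (fdelta f q (head Blank r)) l r.

Definition reach L (f : frag L) q l r T x l' r' :=
  exists t q', [/\ t <= T, iter t (@fstep _ f) (q, l, r) = (q', l', r') & fexit f q' = Some x].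

Definition runs L (f : frag L) l r T x l' r' := @reach L f (fini f) l r T x l' r'.

Lemma reach_step L (f : frag L) q l r T x l' r' :
  (let: (q1, l1, r1) := fstep (q, l, r) in reach (f := f) q1 l1 r1 T x l' r') ->
  reach (f := f) q l r T.+1 x l' r'.
Proof.
case E: (fstep _) => [[q1 l1] r1] [t [q' [le e h]]].
by exists t.+1, q'; split => //; rewrite iterSr E.
Qed.

Lemma reach_exit L (f : frag L) q l r T x : fexit f q = Some x -> reach (f := f) q l r T x l r.
Proof. by move=> e; exists 0, q; split. Qed.

Lemma reachW L (f : frag L) q l r T T' x l' r' :
  T <= T' -> reach (f := f) q l r T x l' r' -> reach (f := f) q l r T' x l' r'.
Proof. by move=> le [t [q' [l1 e h]]]; exists t, q'; split => //; exact: leq_trans le. Qed.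

Lemma runsW L (f : frag L) l r T T' x l' r' :
  T <= T' -> runs f l r T x l' r' -> runs f l r T' x l' r'.
Proof. exact: reachW. Qed.

Definition fret L (x : L) : frag L :=
  @Frag L unit tt (fun _ => Some x) (fun q a => (q, a, DS)).

Lemma runs_ret L (x : L) l r : runs (fret x) l r 0 x l r.
Proof. exact: reach_exit. Qed.

Section Bind.
Variables (A : finType) (B : Type) (f : frag A) (g : A -> frag B).

Definition bindQ : finType := (fQ f + {x : A & fQ (g x)})%type.
Definition bind_exit (q : bindQ) : option B :=
  if q is inr (existT x p) then fexit (g x) p else None.
Definition bind_delta (q : bindQ) (a : sym) : bindQ * sym * dir :=
  match q with
  | inl p => if fexit f p is Some x then (inr (existT _ x (fini (g x))), a, DS)
             else let: (p', b, d) := fdelta f p a in (inl p', b, d)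
  | inr (existT x p) => let: (p', b, d) := fdelta (g x) p a in (inr (existT _ x p'), b, d)
  end.
Definition fbind : frag B := @Frag B bindQ (inl (fini f)) bind_exit bind_delta.

Lemma bind_right x q l r T y l' r' :
  reach (f := g x) q l r T y l' r' -> reach (f := fbind) (inr (existT _ x q)) l r T y l' r'.
Proof.
case=> t [q' [le e h]]; apply: reachW le _; move: e.
elim: t q l r => [|t IH] q l r; first by case=> -> -> ->; apply: reach_exit.
rewrite iterSr; case ex: (fexit (g x) q) => [z|].
  have -> : fstep (f := g x) (q, l, r) = (q, l, r) by rewrite /fstep ex.
  by move=> /IH; apply: reachW.
rewrite {2}/fstep ex /= => e; apply: reach_step; rewrite /= ex /=.
move: e; case: (fdelta (g x) q _) => [[p' b] d] /=.
by case: d => //=; first case: l => [|c l]; move/IH.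
Qed.

(** The handover from [f] to [g x] is one extra step that rewrites the scanned cell; this explains
    [T'.+1] and the cell made explicit in [head Blank r' :: behead r']. *)
Lemma bind_left q l r T x l' r' T' y l2 r2 :
  reach (f := f) q l r T x l' r' ->
  runs (g x) l' (head Blank r' :: behead r') T' y l2 r2 ->
  reach (f := fbind) (inl q) l r (T + T'.+1) y l2 r2.
Proof.
case=> t [q' [le e h]] H; apply: (@reachW _ _ _ _ _ (t + T'.+1)); first by rewrite leq_add2r.
move: e; elim: t q l r {le} => [|t IH] q l r.
  case=> -> -> ->; apply: reach_step; rewrite /= h /=; exact: bind_right.
(* The iteration may stand at an exit before its last step; [fstep] is idle from then on, and the
   induction hypothesis applies to the same configuration. *)
rewrite iterSr; case ex: (fexit f q) => [z|].
  have -> : fstep (f := f) (q, l, r) = (q, l, r) by rewrite /fstep ex.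
  by move=> /IH; apply: reachW; rewrite addSn.
rewrite {2}/fstep ex /= => e; rewrite addSn; apply: reach_step; rewrite /= ex /=.
move: e; case: (fdelta f q _) => [[p' b] d] /=.
by case: d => //=; first case: l => [|c l]; move/IH.
Qed.
End Bind.

Lemma runs_bind (A : finType) B (f : frag A) (g : A -> frag B) l r T x l' r' T' y l2 r2 :
  runs f l r T x l' r' ->
  runs (g x) l' (head Blank r' :: behead r') T' y l2 r2 ->
  runs (fbind f g) l r (T + T'.+1) y l2 r2.
Proof. exact: bind_left. Qed.

Section Loop.
Variables (S : finType) (B : Type) (f : S -> frag (S + B)).

Definition loopQ : finType := {x : S & fQ (f x)}.
Definition loop_exit (q : loopQ) : option B :=
  let: existT x p := q in if fexit (f x) p is Some (inr y) then Some y else None.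
Definition loop_delta (q : loopQ) (a : sym) : loopQ * sym * dir :=
  let: existT x p := q in
  if fexit (f x) p is Some (inl y) then (existT _ y (fini (f y)), a, DS)
  else let: (p', b, d) := fdelta (f x) p a in (existT _ x p', b, d).
Definition floop (s : S) : frag B :=
  @Frag B loopQ (existT _ s (fini (f s))) loop_exit loop_delta.

(** The parameter [s0] only fixes the initial state of [floop s0]; transitions and exits are the
    same for all parameters, so a run of [floop s] continues inside [floop s0]. *)
Lemma loop_in s0 x q l r T y l' r' T' z l2 r2 :
  reach (f := f x) q l r T y l' r' ->
  match y with
  | inl s => runs (floop s) l' (head Blank r' :: behead r') T' z l2 r2
  | inr z' => [/\ z' = z, l' = l2 & r' = r2]
  end ->
  reach (f := floop s0) (existT _ x q) l r (T + T'.+1) z l2 r2.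
Proof.
case=> t [q' [le e h]] H; apply: (@reachW _ _ _ _ _ (t + T'.+1)); first by rewrite leq_add2r.
move: e; elim: t q l r {le} => [|t IH] q l r.
  case=> -> -> ->; case: y h H => [s|z'] h H.
    by apply: reach_step; rewrite /= h /=.
  by case: H => <- <- <-; apply: reach_exit; rewrite /= h.
rewrite iterSr; case ex: (fexit (f x) q) => [u|].
  have -> : fstep (f := f x) (q, l, r) = (q, l, r) by rewrite /fstep ex.
  by move=> /IH; apply: reachW; rewrite addSn.
rewrite {2}/fstep ex /= => e; rewrite addSn; apply: reach_step; rewrite /= ex /=.
move: e; case: (fdelta (f x) q _) => [[p' b] d] /=.
by case: d => //=; first case: l => [|c l]; move/IH.
Qed.

Lemma runs_loop_next s l r T s' l' r' T' z l2 r2 :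
  runs (f s) l r T (inl s') l' r' ->
  runs (floop s') l' (head Blank r' :: behead r') T' z l2 r2 ->
  runs (floop s) l r (T + T'.+1) z l2 r2.
Proof. by move=> H1 H2; apply: loop_in H1 H2. Qed.

Lemma runs_loop_exit s l r T z l2 r2 :
  runs (f s) l r T (inr z) l2 r2 -> runs (floop s) l r T.+1 z l2 r2.
Proof. by move=> H1; rewrite -addn1; apply: loop_in H1 _. Qed.
End Loop.

(** * Stacks on the tape *)

(* The three non-blank symbols.  Besides serving as separator, [aS] stands for
   the undecided status of a vertex. *)
Notation a3 := (option bool).
Notation aZ := (Some false : a3).
Notation aO := (Some true : a3).
Notation aS := (None : a3).

Definition sy (a : a3) : sym :=
  match a with None => Sep | Some false => Zero | Some true => One end.
Definition osy (c : option a3) : sym := if c is Some a then sy a else Blank.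
Definition de (x : sym) : option a3 :=
  match x with Blank => None | Zero => Some aZ | One => Some aO | Sep => Some aS end.

Lemma deK x : osy (de x) = x. Proof. by case: x. Qed.
Lemma syK a : de (sy a) = Some a. Proof. by case: a => [[]|]. Qed.

(* The tape to the right of the head is defined up to trailing blanks; a step
   makes its first cell explicit. *)
Definition norm (r : seq sym) := head Blank r :: behead r.
Definition zone (s : seq a3) : seq sym := map sy s ++ [:: Blank].
Definition zones (zl : seq (seq a3)) : seq sym := flatten [seq zone s | s <- zl].

Definition skipR : frag unit :=
  @Frag unit bool false (fun q => if q then Some tt else None)
    (fun q x => (de x == None, x, DR)).
(** Shifts one zone to the right: the carried symbol is exchanged with the scanned one until a blank
    has been written. The result is the symbol still carried, which enters the next zone. *)
Definition ins1 (c : option a3) : frag (option a3) :=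
  @Frag (option a3) (bool * option a3)%type (false, c)
    (fun q => if q.1 then Some q.2 else None)
    (fun q x => ((q.2 == None, de x), osy q.2, DR)).
(** The first move is unconditional, so that a repeated call does not stop at the blank where the
    previous one ended. *)
Definition backL : frag unit :=
  @Frag unit (option bool) None (fun q => if q is Some true then Some tt else None)
    (fun q x => if (q != None) && (de x == None) then (Some true, x, DS) else (Some false, x, DL)).
Definition rd : frag (option a3) :=
  @Frag (option a3) (option (option a3)) None id (fun _ x => (Some (de x), x, DS)).
Definition wr (c : option a3) (d : dir) : frag unit :=
  @Frag unit bool false (fun q => if q then Some tt else None) (fun _ x => (true, osy c, d)).
(** The mirror image of [ins1]: shifts one zone to the left, working from its closing blank, and
    stops on the blank in front of it with its former first symbol in the carry. *)
Definition del1 (c : option a3) : frag (option a3) :=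
  @Frag (option a3) (option bool * option a3)%type (None, c)
    (fun q => if q.1 is Some true then Some q.2 else None)
    (fun q x => if (q.1 != None) && (de x == None) then ((Some true, q.2), x, DS)
                else ((Some false, de x), osy q.2, DL)).
Definition er1 : frag unit :=
  @Frag unit bool false (fun q => if q then Some tt else None)
    (fun q x => (de x == None, Blank, DR)).
(** Shifts the input so that cell 0 becomes blank; this blank is what stops the leftward scans. The
    component [q.1] tells the empty carry at the start from the one behind the last input symbol. *)
Definition ini1 : frag unit :=
  @Frag unit (option bool * option a3)%type (None, None)
    (fun q => if q.1 is Some true then Some tt else None)
    (fun q x => ((if q.2 is None then (if q.1 is None then Some false else Some true) else q.1, de x),
                 osy q.2, DR)).

Fixpoint skips m : frag unit := if m is m'.+1 then fbind skipR (fun _ : unit => skips m') else fret tt.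
Fixpoint backs m : frag unit := if m is m'.+1 then fbind backL (fun _ : unit => backs m') else fret tt.
Fixpoint inss m c : frag unit :=
  if m is m'.+1 then fbind (ins1 c) (fun c' : option a3 => inss m' c') else fret tt.
Fixpoint dels m c : frag (option a3) :=
  if m is m'.+1 then fbind (del1 c) (fun c' : option a3 => dels m' c') else fret c.
Fixpoint ers m : frag unit := if m is m'.+1 then fbind er1 (fun _ : unit => ers m') else fret tt.

Lemma norm_cons x r : norm (x :: r) = x :: r. Proof. by []. Qed.
Lemma zone_cons a s : zone (a :: s) = sy a :: zone s. Proof. by []. Qed.
Lemma size_zone s : size (zone s) = (size s).+1.
Proof. by rewrite size_cat size_map addn1. Qed.
Lemma zones_cons s zl : zones (s :: zl) = zone s ++ zones zl. Proof. by []. Qed.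
Lemma zones_cat z1 z2 : zones (z1 ++ z2) = zones z1 ++ zones z2.
Proof. by rewrite /zones map_cat flatten_cat. Qed.
Lemma zones_rcons zl s : zones (rcons zl s) = zones zl ++ zone s.
Proof. by rewrite -cats1 zones_cat /zones /= cats0. Qed.
Lemma size_zones zl : size zl <= size (zones zl).
Proof. elim: zl => //= s zl IH; rewrite zones_cons size_cat size_zone; lia. Qed.
Lemma norm_zone s r : norm (zone s ++ r) = zone s ++ r.
Proof. by case: s. Qed.
Lemma norm_zones zl r : norm (zones zl ++ norm r) = zones zl ++ norm r.
Proof. by case: zl => // s zl; rewrite zones_cons -catA norm_zone. Qed.
Lemma normE r : 0 < size r -> norm r = r. Proof. by case: r. Qed.
Lemma normK r : norm (norm r) = norm r. Proof. by []. Qed.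

Lemma de_sy a : (de (sy a) == None) = false. Proof. by case: a => [[]|]. Qed.

Lemma runs_skipR s l r : runs skipR l (zone s ++ r) (size s).+1 tt (rev (zone s) ++ l) r.
Proof.
rewrite /runs; elim: s l => [|a s IH] l; first by apply: reach_step; apply: reach_exit.
apply: reach_step; rewrite /= de_sy.
have -> : rev (zone (a :: s)) ++ l = rev (zone s) ++ sy a :: l by rewrite rev_cons cat_rcons.
exact: IH.
Qed.

Lemma runs_skips zl l r :
  runs (skips (size zl)) l (zones zl ++ norm r) (2 * size (zones zl)) tt (rev (zones zl) ++ l) (norm r).
Proof.
elim: zl l => [|s zl IH] l /=; first exact: runs_ret.
rewrite zones_cons -catA; apply: runsW; last first.
  apply: runs_bind; first exact: runs_skipR.
  rewrite -/(norm _) norm_zones rev_cat -catA; exact: IH.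
rewrite size_cat size_zone; lia.
Qed.

Lemma runs_er1 s l r :
  runs er1 l (zone s ++ r) (size s).+1 tt (nseq (size s).+1 Blank ++ l) r.
Proof.
rewrite /runs; elim: s l => [|a s IH] l; first by apply: reach_step; apply: reach_exit.
apply: reach_step; rewrite /= de_sy.
have -> : [:: Blank, Blank & nseq (size s) Blank ++ l] = nseq (size s).+1 Blank ++ Blank :: l.
  by rewrite /=; move: (size s) => m; elim: m => //= m ->.
exact: IH.
Qed.

Lemma runs_ers zl l r :
  runs (ers (size zl)) l (zones zl ++ norm r) (2 * size (zones zl)) tt
    (nseq (size (zones zl)) Blank ++ l) (norm r).
Proof.
elim: zl l => [|s zl IH] l /=; first exact: runs_ret.
rewrite zones_cons -catA; apply: runsW; last first.
  apply: runs_bind; first exact: runs_er1.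
  rewrite -/(norm _) norm_zones size_cat addnC nseqD -catA size_zone; exact: IH.
rewrite size_cat size_zone; lia.
Qed.

Lemma runs_ins1 s l r :
  runs (ins1 (de (head Blank (zone s)))) l (behead (zone s ++ r)) (size s).+1
    (de (head Blank r)) (rev (zone s) ++ l) (behead r).
Proof.
rewrite /runs; elim: s l => [|a s IH] l; first by apply: reach_step; apply: reach_exit.
apply: reach_step; rewrite /= syK /=.
have -> : rev (zone (a :: s)) ++ l = rev (zone s) ++ sy a :: l by rewrite rev_cons cat_rcons.
have -> : head Blank ((map sy s ++ [:: Blank]) ++ r) = head Blank (zone s) by case: (s).
exact: IH.
Qed.

(** [zl] lists the zones as they are after the insertion. Their first symbol is the one carried in,
    so the tape starts without it; the last cell comes from the blank padding. *)
Lemma runs_inss zl l r :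
  runs (inss (size zl) (de (head Blank (zones zl ++ Blank :: r)))) l
    (norm (behead (zones zl ++ Blank :: r))) (2 * size (zones zl)) tt (rev (zones zl) ++ l) (norm r).
Proof.
elim: zl l => [|s zl IH] l; first exact: runs_ret.
have -> : head Blank (zones (s :: zl) ++ Blank :: r) = head Blank (zone s) by case: (s).
rewrite normE; last by rewrite size_behead size_cat zones_cons size_cat size_zone /=; lia.
rewrite zones_cons -catA; apply: runsW; last first.
  apply: runs_bind; first exact: runs_ins1.
  rewrite -/(norm _) rev_cat -catA; exact: IH.
rewrite size_cat size_zone; lia.
Qed.

Lemma runs_backL s l r :
  runs backL (rev (map sy s) ++ Blank :: l) r (size s + 2) tt l (Blank :: map sy s ++ norm r).
Proof.
rewrite /runs addn2; apply: reach_step => /=.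
have H x : reach (f := backL) (Some false) (behead (rev (map sy s) ++ Blank :: l))
    (head Blank (rev (map sy s) ++ Blank :: l) :: x) (size s).+1 tt l (Blank :: map sy s ++ x).
  elim/last_ind: s x => [|s a IH] x; first by apply: reach_step; apply: reach_exit.
  rewrite map_rcons rev_rcons cat_cons size_rcons; apply: reach_step; rewrite /= de_sy /=.
  case E: (rev (map sy s) ++ Blank :: l) => [|y t]; first by case: (rev _) E.
  by move: (IH (sy a :: x)); rewrite E /= cat_rcons.
move: (H (norm r)); case E: (rev (map sy s) ++ Blank :: l) => [|y t] //.
by case: (rev _) E.
Qed.

Lemma runs_backs zl l r :
  runs (backs (size zl).+1) (rev (zones zl) ++ Blank :: l) r (3 * (size (zones zl)).+1) tt l
    (Blank :: zones zl ++ norm r).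
Proof.
(* [s] stands for the cells between the head and the nearest blank to its left; one call of [backL]
   turns the zone closed by that blank into the next [s]. *)
suff H s : runs (backs (size zl).+1) (rev (map sy s) ++ rev (zones zl) ++ Blank :: l) r
   (3 * (size (zones zl) + (size s).+1)) tt l (Blank :: zones zl ++ map sy s ++ norm r).
  by move: (H [::]); rewrite addn1.
elim/last_ind: zl s r => [|zl t IH] s r.
  apply: runsW; last by apply: runs_bind; [exact: runs_backL | exact: runs_ret].
  by rewrite /zones /=; lia.
rewrite size_rcons zones_rcons rev_cat /zone rev_cat /= -!catA /=.
apply: runsW; last first.
  apply: runs_bind; first exact: runs_backL.
  move: (IH t (Blank :: map sy s ++ norm r)); rewrite norm_cons; exact.
by rewrite !size_cat size_map /=; lia.
Qed.

Lemma runs_del1 c s l r :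
  runs (del1 c) (rev (map sy s) ++ Blank :: l) (Blank :: r) (size s + 2) (de (head Blank (zone s)))
    l (Blank :: behead (zone s) ++ osy c :: r).
Proof.
rewrite /runs addn2; apply: reach_step => /=.
have H c' x : reach (f := del1 c) (Some false, c') (behead (rev (map sy s) ++ Blank :: l))
    (head Blank (rev (map sy s) ++ Blank :: l) :: x) (size s).+1
    (if s is a :: s' then Some a else c') l
    (Blank :: (if s is a :: s' then map sy s' ++ osy c' :: x else x)).
  elim/last_ind: s c' x => [|s a IH] c' x; first by apply: reach_step; apply: reach_exit.
  rewrite map_rcons rev_rcons cat_cons size_rcons; apply: reach_step; rewrite /= de_sy /= syK.
  case E: (rev (map sy s) ++ Blank :: l) => [|y t]; first by case: (rev _) E.
  move: (IH (Some a) (osy c' :: x)); rewrite E /=.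
  by case: s {IH E} => // b s /=; rewrite map_rcons cat_rcons.
move: (H None (osy c :: r)); case E: (rev (map sy s) ++ Blank :: l) => [|y t].
  by case: (rev _) E.
by case: s {H} E => [|a s] //= _; rewrite ?syK -?catA.
Qed.

Lemma runs_dels c zl l r : 
  zl <> [::] ->
  runs (dels (size zl) c) (behead (rev (zones zl)) ++ Blank :: l) (Blank :: r)
    (4 * size (zones zl)) (de (head Blank (zones zl))) l
    (Blank :: behead (zones zl) ++ osy c :: r).
Proof.
elim/last_ind: zl c r => // zl s IH c r _.
rewrite size_rcons zones_rcons rev_cat /zone rev_cat /= -catA -/(zone s).
have H l' : runs (del1 c) (rev (map sy s) ++ Blank :: l') (Blank :: r) (size s + 2) (de (head Blank (zone s)))
    l' (Blank :: behead (zone s) ++ osy c :: r) by exact: runs_del1.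
case/lastP: zl IH => [|zl t] IH.
  apply: runsW; last by apply: runs_bind; [exact: H | exact: runs_ret].
  by rewrite /zones /= size_zone; lia.
have -> : rev (zones (rcons zl t)) ++ Blank :: l =
   Blank :: (behead (rev (zones (rcons zl t))) ++ Blank :: l).
  by rewrite zones_rcons rev_cat /zone rev_cat.
apply: runsW; last first.
  apply: runs_bind; first exact: H.
  have E : zones (rcons zl t) = head Blank (zones (rcons zl t)) :: behead (zones (rcons zl t)).
    by case: (zl) t {IH} => [|[|? ?] ?] [].
  have -> : head Blank (zones (rcons zl t) ++ zone s) = head Blank (zones (rcons zl t)) by rewrite E.
  have -> : behead (zones (rcons zl t) ++ zone s) ++ osy c :: r =
    behead (zones (rcons zl t)) ++ osy (de (head Blank (zone s))) :: behead (zone s) ++ osy c :: r.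
    by rewrite E /= -catA; congr (_ ++ _); rewrite deK; case: (s).
  by apply: IH; case: (zl).
by rewrite size_cat size_zone; lia.
Qed.

Lemma runs_rd l r : runs rd l r 1 (de (head Blank r)) l (norm r).
Proof. by apply: reach_step; apply: reach_exit. Qed.
Lemma runs_wrR c l r : runs (wr c DR) l r 1 tt (osy c :: l) (behead r).
Proof. by apply: reach_step; apply: reach_exit. Qed.
Lemma runs_wrS c l r : runs (wr c DS) l r 1 tt l (osy c :: behead r).
Proof. by apply: reach_step; apply: reach_exit. Qed.

Lemma runs_ini1 s : runs ini1 [::] (map sy s) (size s + 2) tt (rev (Blank :: zone s)) [::].
Proof.
rewrite /runs addn2; apply: reach_step => /=.
have H l : reach (f := ini1) (Some false, de (head Blank (map sy s))) l (behead (map sy s)) (size s).+1 tt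
   (rev (zone s) ++ l) [::].
  elim: s l => [|a s IH] l; first by apply: reach_step; apply: reach_exit.
  apply: reach_step; rewrite /= syK /=.
  by rewrite /zone /= rev_cons cat_rcons; apply: IH.
by move: (H [:: Blank]); rewrite rev_cons -cats1.
Qed.

(** * Push, pop and output on a tape holding k stacks *)

Notation regs := (nat -> seq a3).
Definition upd (s : regs) i v : regs := fun j => if j == i then v else s j.

Section Ops.
Variable k : nat.

Definition zl (s : regs) := [seq s i | i <- iota 0 k].
(* Tape contents: the output o already produced (left of the head), a blank, then
   the k stacks, each closed by a blank.  The head rests on the first blank. *)
Definition cfgR (s : regs) b := Blank :: zones (zl s) ++ nseq b.+1 Blank.
Definition szst (s : regs) := size (zones (zl s)).

Lemma zl_split s i : i < k -> exists zA zB,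
  [/\ zl s = zA ++ s i :: zB, size zA = i, size zB = k - i.+1 &
      forall v, zl (upd s i v) = zA ++ v :: zB].
Proof.
move=> lt; exists [seq s j | j <- iota 0 i], [seq s j | j <- iota i.+1 (k - i.+1)].
have E : iota 0 k = iota 0 i ++ i :: iota i.+1 (k - i.+1).
  by rewrite -[i :: _]/(iota i (k - i.+1).+1) -iotaD; congr iota; lia.
rewrite /zl E; split; rewrite ?size_map ?size_iota ?map_cat //.
move=> v; rewrite map_cat /= /upd eqxx; congr (_ ++ _ :: _);
  apply/eq_in_map => j; rewrite mem_iota => h; case: eqP => // ?; lia.
Qed.

Definition push i a : frag unit :=
  fbind (skips i.+1) (fun _ : unit => fbind (inss (k - i) (Some a)) (fun _ : unit => backs k.+1)).
(** The leading blank itself becomes the output symbol, and a new blank is inserted behind it; the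
    output thus grows to the left of the head. *)
Definition emit a : frag unit :=
  fbind (wr (Some a) DR) (fun _ : unit => fbind (inss k.+1 None) (fun _ : unit => backs k.+1)).
(** The popped cell is overwritten by a blank, which marks where the deletion coming back from the
    right end has to stop; the carry it ends with is then written over the mark. *)
Definition pop i : frag (option a3) :=
  fbind (skips i.+1) (fun _ : unit =>
  fbind rd (fun x : option a3 =>
  if x is Some a then
    fbind (wr None DR) (fun _ : unit =>
    fbind (skips (k - i)) (fun _ : unit =>
    fbind backL (fun _ : unit =>
    fbind (dels (k - i) None) (fun c : option a3 =>
    fbind (wr c DS) (fun _ : unit =>
    fbind (backs i.+1) (fun _ : unit => fret (Some a)))))))
  else fbind (backs i.+1) (fun _ : unit => fret None))).

Lemma szst_k s : k <= szst s.
Proof. by rewrite /szst; apply: leq_trans (size_zones _); rewrite size_map size_iota. Qed.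

Lemma norm_nseq b : norm (nseq b Blank) = nseq b.-1.+1 Blank. Proof. by case: b. Qed.

Lemma zones0 zA : zones ([::] :: zA) = Blank :: zones zA. Proof. by []. Qed.

Lemma runs_push i a l s b : i < k ->
  exists b', runs (push i a) l (cfgR s b) (20 * (szst s).+1) tt l (cfgR (upd s i (a :: s i)) b').
Proof.
move=> lt; have := szst_k s.
have [zA [zB [E sA sB EU]]] := zl_split s lt.
rewrite /szst /cfgR E EU => szk.
exists (b.-1); have skipsA r := @runs_skips ([::] :: zA) l r.
rewrite [size (_ :: zA)]/= sA in skipsA.
apply: runsW; last first.
  have -> : Blank :: zones (zA ++ s i :: zB) ++ nseq b.+1 Blank =
    zones ([::] :: zA) ++ norm (zones (s i :: zB) ++ Blank :: nseq b Blank).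
    by rewrite zones_cat zones0 -catA normE // size_cat /= addnS.
  apply: runs_bind; first exact: skipsA.
  rewrite -/(norm _) normK; apply: runs_bind.
    have -> : k - i = size ((a :: s i) :: zB) by rewrite /=; lia.
    have := @runs_inss ((a :: s i) :: zB) (rev (zones ([::] :: zA)) ++ l) (nseq b Blank).
    rewrite -[de _]/(de (sy a)) syK. exact.
  have -> : k.+1 = (size (zA ++ (a :: s i) :: zB)).+1 by rewrite size_cat /=; lia.
  have -> : rev (zones ((a :: s i) :: zB)) ++ rev (zones ([::] :: zA)) ++ l =
    rev (zones (zA ++ (a :: s i) :: zB)) ++ Blank :: l.
    by rewrite zones0 (rev_cons Blank) cat_rcons zones_cat rev_cat -catA.
  rewrite -/(norm _) normK -norm_nseq -[norm (nseq b Blank)]normK; apply: runs_backs.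
rewrite zones0 !zones_cat !zones_cons !zone_cons /= !size_cat /= !size_cat.
rewrite zones_cat size_cat zones_cons size_cat in szk; rewrite /=; lia.
Qed.

Lemma runs_emit a o s b :
  exists b', runs (emit a) o (cfgR s b) (20 * (szst s).+1) tt (sy a :: o) (cfgR s b').
Proof.
have := szst_k s; rewrite /szst => szk.
exists (b.-1); apply: runsW; last first.
  apply: runs_bind; first exact: runs_wrR.
  rewrite -/(norm _) [behead _]/= [osy _]/=.
  have -> : norm (zones (zl s) ++ nseq b.+1 Blank) = norm (behead (zones ([::] :: zl s) ++ Blank :: nseq b Blank)).
    by rewrite zones0.
  have -> : k.+1 = size ([::] :: zl s) by rewrite /= size_map size_iota.
  apply: runs_bind; first exact: (@runs_inss ([::] :: zl s) (sy a :: o) (nseq b Blank)).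
  rewrite -/(norm _) normK zones0 rev_cons cat_rcons /cfgR -norm_nseq.
  by rewrite -[norm (nseq b Blank)]normK; apply: runs_backs.
rewrite zones0 /= -/(zl s); lia.
Qed.

Lemma runs_pop_nil i l s b : i < k -> s i = [::] ->
  exists b', runs (pop i) l (cfgR s b) (20 * (szst s).+1) None l (cfgR s b').
Proof.
move=> lt e; have := szst_k s.
have [zA [zB [E sA sB EU]]] := zl_split s lt.
rewrite /szst /cfgR E e => szk.
exists b; have skipsA r := @runs_skips ([::] :: zA) l r.
rewrite [size (_ :: zA)]/= sA in skipsA.
apply: runsW; last first.
  have -> : Blank :: zones (zA ++ [::] :: zB) ++ nseq b.+1 Blank =
    zones ([::] :: zA) ++ norm (zones ([::] :: zB) ++ Blank :: nseq b Blank).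
    by rewrite zones_cat zones0 -catA normE // size_cat /= addnS.
  apply: runs_bind; first exact: skipsA.
  rewrite -/(norm _) normK; apply: runs_bind; first exact: runs_rd.
  have HB := @runs_backs zA l (norm (norm (zones ([::] :: zB) ++ Blank :: nseq b Blank))).
  apply: runs_bind.
    by rewrite (zones0 zA) (rev_cons Blank) cat_rcons; rewrite sA in HB; exact: HB.
  by rewrite -/(norm _) norm_cons !normK zones0; apply: runs_ret.
rewrite zones0 !zones_cat zones0 /= !size_cat /=.
rewrite zones_cat size_cat zones0 /= in szk; lia.
Qed.

Lemma runs_pop_cons i a v l s b : i < k -> s i = a :: v ->
  exists b', runs (pop i) l (cfgR s b) (20 * (szst s).+1) (Some a) l (cfgR (upd s i v) b').
Proof.
move=> lt e; have := szst_k s.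
have [zA [zB [E sA sB EU]]] := zl_split s lt.
rewrite /szst /cfgR EU E e => szk.
have szB : k - i = size (v :: zB) by rewrite /=; lia.
have nz : rev (zones (v :: zB)) = Blank :: behead (rev (zones (v :: zB))).
  case: (lastP (v :: zB)) szB => [|z t] h; first by move: h => /=; lia.
  by rewrite zones_rcons /zone rev_cat rev_cat.
have nz' : zones (v :: zB) = head Blank (zones (v :: zB)) :: behead (zones (v :: zB)) by case: (v).
exists b.+1; have skipsA r := @runs_skips ([::] :: zA) l r.
rewrite [size (_ :: zA)]/= sA in skipsA.
apply: runsW; last first.
  have -> : Blank :: zones (zA ++ (a :: v) :: zB) ++ nseq b.+1 Blank =
    zones ([::] :: zA) ++ norm (zones ((a :: v) :: zB) ++ Blank :: nseq b Blank).
    by rewrite zones_cat zones0 -catA normE // size_cat /= addnS.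
  apply: runs_bind; first exact: skipsA.
  rewrite -/(norm _) normK; apply: runs_bind; first exact: runs_rd.
  have -> : de (head Blank (norm (zones ((a :: v) :: zB) ++ Blank :: nseq b Blank))) = Some a by rewrite /= syK.
  apply: runs_bind; first exact: runs_wrR.
  rewrite -/(norm _).
  have -> : norm (behead (head Blank (norm (norm (zones ((a :: v) :: zB) ++ Blank :: nseq b Blank)))
     :: behead (norm (norm (zones ((a :: v) :: zB) ++ Blank :: nseq b Blank))))) =
     zones (v :: zB) ++ norm (Blank :: nseq b Blank).
     by rewrite /= -/(norm _) normE // size_cat /= addnS.
  apply: runs_bind; first by rewrite szB; apply: runs_skips.
  rewrite -/(norm _); apply: runs_bind.
    by rewrite nz; apply: (@runs_backL [::]).
  rewrite -/(norm _) !normK norm_cons; apply: runs_bind.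
    by rewrite szB; apply: runs_dels.
  rewrite -/(norm _) norm_cons; apply: runs_bind; first exact: runs_wrS.
  rewrite -/(norm _) deK [osy None]/=.
  rewrite [behead (Blank :: _)]/= -cat_cons -nz'.
  have HB := @runs_backs zA l (norm (zones (v :: zB) ++ [:: Blank, Blank & nseq b Blank])).
  apply: runs_bind.
    by rewrite (zones0 zA) (rev_cons Blank) cat_rcons; rewrite sA in HB; exact: HB.
  rewrite -/(norm _) norm_cons !normK zones_cat -catA normE; last by rewrite size_cat /=; lia.
  exact: runs_ret.
rewrite zones0 in szk *; rewrite !(zones_cat, zones_cons, size_cat, size_zone) /= in szk *; rewrite ?(zones_cat, zones_cons, size_cat, size_zone) /=. lia.
Qed.

(** Every round inserts a blank, that is, an empty stack, in front of the existing ones; the input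
    therefore ends up in the last register. *)
Fixpoint addzs j m : frag unit :=
  if j is j'.+1 then
    fbind skipR (fun _ : unit => fbind (inss m.+1 None) (fun _ : unit =>
    fbind (backs m.+2) (fun _ : unit => addzs j' m.+1)))
  else fret tt.

Lemma runs_addzs j m z l b : size z = m ->
  exists b', runs (addzs j m) l (Blank :: zones z ++ nseq b.+1 Blank)
    (j * (20 * (size (zones z) + j).+1)) tt l (Blank :: zones (nseq j [::] ++ z) ++ nseq b'.+1 Blank).
Proof.
elim: j m z b => [|j IH] m z b sz; first by exists b; apply: runs_ret.
have [|b' H] := IH m.+1 ([::] :: z) b.-1; first by rewrite /= sz.
have E : nseq j [::] ++ [::] :: z = nseq j.+1 [::] ++ z by elim: (j) => //= i ->.
rewrite E in H.
exists b'; apply: runsW; last first.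
  apply: runs_bind; first exact: (@runs_skipR [::]).
  rewrite -/(norm _).
  have -> : norm (zones z ++ nseq b.+1 Blank) = norm (behead (zones ([::] :: z) ++ Blank :: nseq b Blank)).
    by rewrite zones0.
  have -> : m.+1 = size ([::] :: z) by rewrite /= sz.
  apply: runs_bind; first exact: (@runs_inss ([::] :: z) _ (nseq b Blank)).
  apply: runs_bind; first exact: (@runs_backs ([::] :: z)).
  rewrite -/(norm _) norm_cons !normK norm_nseq [size (_ :: z)]/= sz; exact: H.
by rewrite zones0 [size (_ :: _)]/= mulSn addSnnS [size [::]]/=; lia.
Qed.

Definition boot : frag unit :=
  fbind ini1 (fun _ : unit => fbind (backs 2) (fun _ : unit => addzs k.-1 1)).

Definition regs0 (w : seq a3) : regs := fun i => if i == k.-1 then w else [::].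

Lemma runs_boot w : 0 < k ->
  exists b, runs boot [::] (map sy w) (20 * k.+1 * (size w + k).+1) tt [::] (cfgR (regs0 w) b).
Proof.
move=> k0; have [|b H] := @runs_addzs k.-1 1 [:: w] [::] 0; first by [].
exists b; apply: runsW; last first.
  apply: runs_bind; first exact: runs_ini1.
  apply: runs_bind.
    have := @runs_backs [:: w] [::] (norm [::]); rewrite /zones /= cats0 rev_cons -cats1; exact.
  rewrite -/(norm _) norm_cons normK /cfgR.
  have -> : zl (regs0 w) = nseq k.-1 [::] ++ [:: w].
    rewrite /zl -{1}(prednK k0) -addn1 iotaD map_cat /= /regs0 eqxx; congr (_ ++ _).
    apply: (@eq_from_nth _ [::]).
      by rewrite !size_map size_iota size_nseq.
    move=> i; rewrite size_map size_iota => lt.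
    rewrite (nth_map 0) ?size_iota // nth_iota // nth_nseq lt; case: eqP => //; lia.
  by rewrite /zones /= cats0 in H *; exact: H.
rewrite size_zone; nia.
Qed.

(** Leaves only blanks behind the output, as [halts_with_output] demands. *)
Lemma runs_erase s o b :
  exists b1 b2, runs (ers k.+1) (rev o) (cfgR s b) (2 * (szst s).+1) tt
    (nseq b1 Blank ++ rev o) (nseq b2 Blank).
Proof.
exists (szst s).+1, b.+1.
have := @runs_ers ([::] :: zl s) (rev o) (nseq b.+1 Blank).
by rewrite zones0 [size (_ :: zl s)]/= size_map size_iota.
Qed.
End Ops.

(** * From subroutines to Turing machines *)

Definition TM_of (f : frag unit) : TM :=
  {| tm_Q := fQ f; tm_start := fini f; tm_halt := fun q => isSome (fexit f q);
     tm_delta := fdelta f |}.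

Lemma TM_of_step f (c : config (TM_of f)) :
  let c' := step c in
  fstep (f := f) (cf_state c, cf_left c, cf_right c) = (cf_state c', cf_left c', cf_right c').
Proof.
case: c => q l r /=; case: (fexit f q) => //=.
by case: (fdelta f q _) => [[q' b] []] //=; case: l.
Qed.

Lemma TM_of_runs f w T l r out b : runs f [::] w T tt l r -> rev l ++ r = out ++ nseq b Blank ->
  halts_with_output (TM_of f) w T out.
Proof.
case=> t [q [le e h]] E; exists t; split => //.
have H (c : config (TM_of f)) : iter t (@fstep _ f) (cf_state c, cf_left c, cf_right c) =
   (cf_state (iter t (@step _) c), cf_left (iter t (@step _) c), cf_right (iter t (@step _) c)).
  by elim: t {le e} => //= t ->; rewrite TM_of_step.
move: (H (init (TM_of f) w)); rewrite e /= => -[<- el er].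
split; first by rewrite h.
by exists b; rewrite /tape -el -er.
Qed.

(** * Execution cost measured in stack operations *)

Section Exec.
Variable k : nat.
Implicit Types (o : seq sym) (s : regs).

(* The cost t counts stack operations; each of them shifts a whole tape of
   size at most [szst k s + t], whence the bound on genuine steps. *)
Definition exec L (f : frag L) o s t x o' s' :=
  szst k s' <= szst k s + t /\
  forall b, exists b',
    runs f (rev o) (cfgR k s b) (20 * t * (szst k s + t)) x (rev o') (cfgR k s' b').

Lemma execW L (f : frag L) o s t t' x o' s' :
  t <= t' -> exec f o s t x o' s' -> exec f o s t' x o' s'.
Proof.
move=> le [sz H]; split; first lia.
move=> b; have [b' R] := H b; exists b'; apply: runsW R; nia.
Qed.

Lemma exec_eq L (f : frag L) o s t t' x x' o' o'' s' s'' :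
  exec f o s t x o' s' -> t <= t' -> x = x' -> o' = o'' -> s' =1 s'' -> exec f o s t' x' o'' s''.
Proof.
move=> H le <- <- /functional_extensionality <-; exact: execW le H.
Qed.

Lemma exec_from L (f : frag L) o o0 s s0 t x o' s' :
  o = o0 -> s =1 s0 -> exec f o s t x o' s' -> exec f o0 s0 t x o' s'.
Proof. by move=> <- /functional_extensionality <-. Qed.

Lemma exec_ret L (x : L) o s : exec (fret x) o s 0 x o s.
Proof. by split; [rewrite addn0 | move=> b; exists b; apply: runs_ret]. Qed.

Lemma exec_bind (A : finType) B (f : frag A) (g : A -> frag B) o s t1 x o1 s1 t2 y o2 s2 :
  exec f o s t1 x o1 s1 -> exec (g x) o1 s1 t2 y o2 s2 ->
  exec (fbind f g) o s (t1 + t2.+1) y o2 s2.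
Proof.
move=> [sz1 H1] [sz2 H2]; split; first lia.
move=> b; have [b1 R1] := H1 b; have [b2 R2] := H2 b1; exists b2.
apply: runsW; last by apply: runs_bind R1 R2.
nia.
Qed.

Lemma exec_loop_next (S : finType) B (f : S -> frag (S + B)%type) x o s t1 x1 o1 s1 t2 y o2 s2 :
  exec (f x) o s t1 (inl x1) o1 s1 -> exec (floop f x1) o1 s1 t2 y o2 s2 ->
  exec (floop f x) o s (t1 + t2.+1) y o2 s2.
Proof.
move=> [sz1 H1] [sz2 H2]; split; first lia.
move=> b; have [b1 R1] := H1 b; have [b2 R2] := H2 b1; exists b2.
apply: runsW; last by apply: runs_loop_next R1 R2.
nia.
Qed.

Lemma exec_loop_exit (S : finType) B (f : S -> frag (S + B)%type) x o s t1 y o2 s2 :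
  exec (f x) o s t1 (inr y) o2 s2 -> exec (floop f x) o s t1.+1 y o2 s2.
Proof.
move=> [sz1 H1]; split; first lia.
move=> b; have [b1 R1] := H1 b; exists b1.
apply: runsW; last by apply: runs_loop_exit R1.
nia.
Qed.

Lemma szst_upd s i v : i < k -> szst k (upd s i v) + size (s i) = szst k s + size v.
Proof.
move=> lt; have [zA [zB [E _ _ EU]]] := zl_split s lt.
have H x : size (zones (zA ++ x :: zB)) = size (zones zA) + (size x).+1 + size (zones zB).
  by rewrite zones_cat zones_cons size_cat (size_cat (zone x)) size_zone addnA.
by rewrite /szst EU E !H; lia.
Qed.

Lemma exec_push i a o s : i < k -> exec (push k i a) o s 1 tt o (upd s i (a :: s i)).
Proof.
move=> lt; split; first by have := szst_upd s (a :: s i) lt; rewrite /=; lia.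
by move=> b; rewrite muln1 addn1; apply: runs_push.
Qed.

Lemma exec_emit a o s : exec (emit k a) o s 1 tt (rcons o (sy a)) s.
Proof.
split; first by rewrite leq_addr.
by move=> b; rewrite muln1 addn1 rev_rcons; apply: runs_emit.
Qed.

Lemma exec_pop i o s : i < k ->
  exec (pop k i) o s 1 (ohead (s i)) o (upd s i (behead (s i))).
Proof.
move=> lt; split; first by have := szst_upd s (behead (s i)) lt; rewrite size_behead; lia.
move=> b; rewrite muln1 addn1; case E: (s i) => [|a v] /=; last exact: runs_pop_cons.
have -> : upd s i [::] = s.
  by apply: functional_extensionality => j; rewrite /upd; case: eqP => // ->.
exact: runs_pop_nil.
Qed.
End Exec.

Arguments upd s i v j /.
Arguments fbind : simpl never.
Arguments floop : simpl never.
Arguments fret : simpl never.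

Notation "f ;; g" := (fbind f (fun _ : unit => g)) (at level 61, right associativity).
Notation "x <~ f ;; g" := (fbind f (fun x => g)) (at level 61, f at next level, right associativity).

(** * Register programs: iteration, copying, payment, decrement *)

Notation nreg := 21.
Definition rpush := push nreg.
Definition rpop := pop nreg.
Definition remit := emit nreg.
Notation execn := (exec nreg).
Arguments rpush : simpl never.
Arguments rpop : simpl never.
Arguments remit : simpl never.

Ltac st_core :=
  rewrite /upd;
  repeat (match goal with |- context [?a == ?b] => case: (@eqP _ a b) => ? end);
  subst; simpl in *; try done; try congruence.
Ltac st_eq := let j := fresh "j" in move=> j; st_core.

Definition eachS (S : finType) i (body : S -> a3 -> frag S) (x : S) : frag S :=
  floop (fun x : S => y <~ rpop i ;;
    if y is Some a then (x' <~ body x a ;; fret (inl x' : S + S)%type)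
    else fret (inr x : S + S)%type) x.
Definition each i (body : a3 -> frag unit) := eachS i (fun _ : unit => body) tt.
Arguments eachS : simpl never.
Arguments each : simpl never.

Section Each.
Variables (S : finType) (i : nat) (body : S -> a3 -> frag S).
Hypothesis lt : i < nreg.

Lemma ex_eachS_nil x o s : s i = [::] -> execn (eachS i body x) o s 3 x o s.
Proof.
move=> e; apply: exec_loop_exit; apply: exec_eq.
- apply: exec_bind; first exact: exec_pop.
  rewrite e; exact: exec_ret.
- by [].
- by [].
- by [].
- by move=> j /=; case: eqP => // ->; rewrite e.
Qed.

Lemma ex_eachS_cons x o s a l t1 x1 o1 s1 t2 y o2 s2 :
  s i = a :: l -> execn (body x a) o (upd s i l) t1 x1 o1 s1 ->
  execn (eachS i body x1) o1 s1 t2 y o2 s2 ->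
  execn (eachS i body x) o s (t1 + t2 + 4) y o2 s2.
Proof.
move=> e H1 H2; apply: execW; last first.
  apply: exec_loop_next H2; apply: exec_bind; first exact: exec_pop.
  rewrite e; apply: exec_bind H1 _; exact: exec_ret.
lia.
Qed.
End Each.

Definition move i j := each i (fun a => rpush j a).
Definition move2 i j h := each i (fun a => rpush j a ;; rpush h a).
Definition clear i := each i (fun _ => fret tt).
(** The passage through [t] reverses twice, so both stacks receive the original order. *)
Definition copy i j t := move i t ;; move2 t i j.

Lemma ex_push i a o s : i < nreg -> execn (rpush i a) o s 1 tt o (upd s i (a :: s i)).
Proof. exact: exec_push. Qed.
Lemma ex_pop i o s : i < nreg -> execn (rpop i) o s 1 (ohead (s i)) o (upd s i (behead (s i))).
Proof. exact: exec_pop. Qed.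
Lemma ex_emit a o s : execn (remit a) o s 1 tt (rcons o (sy a)) s.
Proof. exact: exec_emit. Qed.

Lemma ex_move i j o s : i < nreg -> j < nreg -> i <> j ->
  execn (move i j) o s (5 * size (s i) + 3) tt o (upd (upd s j (catrev (s i) (s j))) i [::]).
Proof.
move=> li lj ne; move E: (s i) => l; elim: l s E => [|a l IH] s E.
  by apply: exec_eq; [exact: ex_eachS_nil | | | | st_eq].
apply: exec_eq.
- apply: ex_eachS_cons E _ _ => //; first exact: ex_push.
  apply: IH; st_core.
- rewrite /=; lia.
- by [].
- by [].
- st_eq.
Qed.

Lemma ex_move2 i j h o s : i < nreg -> j < nreg -> h < nreg -> i <> j -> i <> h -> j <> h ->
  execn (move2 i j h) o s (7 * size (s i) + 3) tt o
    (upd (upd (upd s j (catrev (s i) (s j))) h (catrev (s i) (s h))) i [::]).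
Proof.
move=> li lj lh ij ih jh; move E: (s i) => l; elim: l s E => [|a l IH] s E.
  by apply: exec_eq; [exact: ex_eachS_nil | | | | st_eq].
apply: exec_eq.
- apply: ex_eachS_cons E _ _ => //.
    by apply: exec_bind; exact: ex_push.
  apply: IH; st_core.
- rewrite /=; lia.
- by [].
- by [].
- st_eq.
Qed.

Lemma ex_clear i o s : i < nreg ->
  execn (clear i) o s (4 * size (s i) + 3) tt o (upd s i [::]).
Proof.
move=> li; move E: (s i) => l; elim: l s E => [|a l IH] s E.
  by apply: exec_eq; [exact: ex_eachS_nil | | | | st_eq].
apply: exec_eq.
- apply: ex_eachS_cons E _ _ => //; first exact: exec_ret.
  apply: IH; st_core.
- rewrite /=; lia.
- by [].
- by [].
- st_eq.
Qed.

Lemma catrevK (T : Type) (l x : seq T) : catrev (catrev l [::]) x = l ++ x.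
Proof. by rewrite !catrevE cats0 revK. Qed.

Lemma ex_copy i j t o s : i < nreg -> j < nreg -> t < nreg -> i <> j -> i <> t -> j <> t ->
  s t = [::] ->
  execn (copy i j t) o s (12 * size (s i) + 7) tt o (upd s j (s i ++ s j)).
Proof.
move=> li lj lt ij it jt et; apply: exec_eq.
- apply: exec_bind; first exact: ex_move.
  by apply: ex_move2 => //; congruence.
- by st_core; rewrite et catrevE cats0 size_rev; lia.
- by [].
- by [].
- move=> x; rewrite /=; st_core; rewrite ?et ?catrevK ?cats0 //; congruence.
Qed.

(** A failed payment pushes the popped symbols back while the recursion returns, so the stack is
    left as it was. *)
Fixpoint trypay c i : frag bool :=
  if c is c'.+1 then
    x <~ rpop i ;;
    if x is Some a then
      (b <~ trypay c' i ;; if b then fret true else rpush i a ;; fret false)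
    else fret false
  else fret true.
Arguments trypay : simpl never.

Lemma ex_trypay c i o s : i < nreg ->
  execn (trypay c i) o s (5 * c + 1) (c <= size (s i)) o
    (if c <= size (s i) then upd s i (drop c (s i)) else s).
Proof.
move=> li; elim: c s => [|c IH] s.
  by apply: exec_eq; [exact: exec_ret | | | | move=> x /=; rewrite drop0; st_core].
case E: (s i) => [|a l].
  apply: exec_eq.
  - apply: exec_bind; first exact: ex_pop.
    rewrite E; exact: exec_ret.
  - lia.
  - by [].
  - by [].
  - st_eq.
have H := IH (upd s i l).
rewrite /= eqxx in H.
have H2 : execn (if c <= size l then fret true else rpush i a ;; fret false) o
    (if c <= size l then upd (upd s i l) i (drop c l) else upd s i l) 2 (c <= size l) o
    (if c <= size l then upd (upd s i l) i (drop c l) else upd s i (a :: l)).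
  case: (c <= size l); first by apply: execW (exec_ret _ _ _ _).
  apply: exec_eq.
  - apply: exec_bind; [exact: ex_push | exact: exec_ret].
  - by [].
  - by [].
  - by [].
  - st_eq.
apply: exec_eq.
- apply: exec_bind; first exact: ex_pop.
  rewrite E; apply: exec_bind; [exact: H | exact: H2].
- lia.
- by [].
- by [].
- move=> x; rewrite [size (a :: l)]/= ltnS; case: leqP => _; st_core.
Qed.

Fixpoint pushn c i a : frag unit := if c is c'.+1 then rpush i a ;; pushn c' i a else fret tt.
Arguments pushn : simpl never.

Lemma ex_pushn c i a o s : i < nreg ->
  execn (pushn c i a) o s (2 * c) tt o (upd s i (nseq c a ++ s i)).
Proof.
move=> li; elim: c s => [|c IH] s.
  by apply: exec_eq; [exact: exec_ret | | | | st_eq].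
apply: exec_eq.
- apply: exec_bind; [exact: ex_push | exact: IH].
- lia.
- by [].
- by [].
- move=> x /=; rewrite eqxx; case: eqP => // _.
  by rewrite -cat_rcons -[nseq c a]cats0; elim: (c) => //= m; rewrite cats0 => ->.
Qed.

(* Predecessor in bijective base 3, least significant digit first; see [bnum]. *)
Fixpoint decl (u : seq a3) : seq a3 :=
  match u with
  | [::] => [::]
  | None :: v => Some true :: v
  | Some true :: v => Some false :: v
  | Some false :: v => if v is [::] then [::] else None :: decl v
  end.

(** Leading digits 1 become 3 by borrowing and are parked on [t] as [aS]. If the string ends while a
    borrow is pending, one parked digit is dropped and the number gets shorter. The answer is false
    only for the empty string, which is zero. *)
Definition dec i t : frag bool :=
  floop (fun _ : unit =>
    x <~ rpop i ;;
    match x with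
    | None => y <~ rpop t ;;
        match y with
        | None => fret (inr false : unit + bool)%type
        | Some _ => move t i ;; fret (inr true : unit + bool)%type
        end
    | Some None => rpush i aO ;; move t i ;; fret (inr true : unit + bool)%type
    | Some (Some true) => rpush i aZ ;; move t i ;; fret (inr true : unit + bool)%type
    | Some (Some false) => rpush t aS ;; fret (inl tt : unit + bool)%type
    end) tt.
Arguments dec : simpl never.

Lemma catrev_nseq (T : Type) (a : T) n l : catrev (nseq n a) l = nseq n a ++ l.
Proof. by elim: n l => //= n IH l; rewrite IH -cat1s catA -[_ ++ [:: a]](nseqD n 1) addn1. Qed.

Lemma ex_dec_aux i t o n s : i < nreg -> t < nreg -> i <> t ->
  s t = nseq n aS ->
  execn (dec i t) o s (20 * size (s i) + 10 * n + 12)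
    (((s i) != [::]) || (0 < n)) o
    (upd (upd s i (if s i is [::] then nseq n.-1 aS else nseq n aS ++ decl (s i))) t [::]).
Proof.
move=> li lt ne; move E: (s i) => u; elim: u n s E => [|a u IH] n s E et.
  case: n et => [|n] et.
    apply: exec_eq.
    - apply: exec_loop_exit; apply: exec_bind; first exact: ex_pop.
      rewrite E; apply: exec_bind; first exact: ex_pop.
      rewrite /=; case: eqP => [?|_]; first by congruence.
      rewrite et; exact: exec_ret.
    - lia.
    - by [].
    - by [].
    - st_eq; by rewrite ?E ?et.
  apply: exec_eq.
  - apply: exec_loop_exit; apply: exec_bind; first exact: ex_pop.
    rewrite E; apply: exec_bind; first exact: ex_pop.
    rewrite /=; case: eqP => [?|_]; first by congruence.
    rewrite et; apply: exec_bind; [apply: ex_move => //; congruence | exact: exec_ret].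
  - rewrite /= !eqxx size_nseq; lia.
  - by [].
  - by [].
  - by move=> x /=; rewrite !eqxx; st_core; rewrite catrev_nseq cats0.
have cl b : b = aZ \/ exists c, b = c /\ c <> aZ by case: b => [[]|]; eauto; right; eexists; split => //.
have fin b : decl (a :: u) = b :: u -> a <> aZ ->
  execn (rpush i b ;; move t i ;; fret (inr true : unit + bool)%type) o (upd s i u)
     (5 * n + 10) (inr true) o (upd (upd s i (nseq n aS ++ decl (a :: u))) t [::]).
  move=> e _; apply: exec_eq.
  - apply: exec_bind; first exact: ex_push.
    apply: exec_bind; [apply: ex_move => //; congruence | exact: exec_ret].
  - by st_core; rewrite et size_nseq; lia.
  - by [].
  - by [].
  - move=> x; rewrite e /= !eqxx et; st_core; rewrite catrev_nseq; congruence.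
case: a E cl fin => [[]|] E cl fin.
- apply: exec_eq.
  + apply: exec_loop_exit; apply: exec_bind; first exact: ex_pop.
    rewrite E; exact: fin.
  + rewrite /=; lia.
  + by [].
  + by [].
  + by [].
- apply: exec_eq.
  + apply: exec_loop_next.
      apply: exec_bind; first exact: ex_pop.
      rewrite E; apply: exec_bind; [exact: ex_push | exact: exec_ret].
    apply: (IH n.+1); first by st_core.
    by st_core; rewrite et.
  + rewrite /=; lia.
  + by rewrite orbT.
  + by [].
  + move=> x /=; case: (u) => [|c v]; st_core.
    by rewrite cats0.
    by elim: (n) => //= m ->.
- apply: exec_eq.
  + apply: exec_loop_exit; apply: exec_bind; first exact: ex_pop.
    rewrite E; exact: fin.
  + rewrite /=; lia.
  + by [].
  + by [].
  + by [].
Qed.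

Lemma ex_dec i t o s : i < nreg -> t < nreg -> i <> t -> s t = [::] ->
  execn (dec i t) o s (20 * size (s i) + 12) (s i != [::]) o (upd s i (decl (s i))).
Proof.
move=> li lt ne et; apply: exec_eq.
- by apply: (@ex_dec_aux i t o 0).
- lia.
- by rewrite orbF.
- by [].
- by move=> x; case: (s i) => [|a l]; st_core.
Qed.

(* rN: n in unary; rE: the hyperedges; rW, rU: the strings w and u; rBW, rBF: the
   budget left and the full budget, in unary; rSB: the first u to be tried;
   rQ: what is left of the advice; rL, rD: statuses of the vertices before and
   after the current one; rG: the set to be encoded. *)
Notation rN := 0 (only parsing).
Notation rW := 1 (only parsing).
Notation rBW := 2 (only parsing).
Notation rBF := 3 (only parsing).
Notation rSB := 4 (only parsing).
Notation rU := 5 (only parsing).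
Notation rV := 6 (only parsing).
Notation rUC := 7 (only parsing).
Notation rC := 8 (only parsing).
Notation rCT := 9 (only parsing).
Notation rP := 10 (only parsing).
Notation rD := 11 (only parsing).
Notation rL := 12 (only parsing).
Notation rG := 13 (only parsing).
Notation rGL := 14 (only parsing).
Notation rX := 15 (only parsing).
Notation rXT := 16 (only parsing).
Notation rET := 17 (only parsing).
Notation rT := 18 (only parsing).
Notation rQ := 19 (only parsing).
Notation rE := 20 (only parsing).

Ltac st_num tac := let j := fresh "j" in
  intro j; do 21 (destruct j as [|j]; [simpl; tac; try done | ]); simpl; tac; try done.

(** * The decoding procedure *)

(* A vertex has status [aO] in O, [aZ] in T, and [aS] while undecided. *)
Definition subl (e : seq bool) (X : seq a3) := all (fun p : bool * a3 => p.1 ==> (p.2 == aO)) (zip e X).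
Definition cont (Es : seq (seq bool)) X := has (fun e => subl e X) Es.
Definition encE (Es : seq (seq bool)) : seq a3 := flatten [seq map Some e ++ [:: None] | e <- Es].

(** The state pairs a flag for the current hyperedge with the verdict on the earlier ones; at a
    separator, the statuses already compared are put back on [rX]. *)
Definition conB (p : bool * bool) (a : a3) : frag (bool * bool)%type :=
  rpush rET a ;;
  match a with
  | None => move rXT rX ;; fret (true, p.2 || p.1)
  | Some b => x <~ rpop rX ;; rpush rXT (odflt aZ x) ;; fret (p.1 && (b ==> (odflt aZ x == aO)), p.2)
  end.
Definition contains : frag bool :=
  p <~ eachS rE conB (true, false) ;; move rET rE ;; fret (p : bool * bool).2.

(** The rest of the run is a hypothesis because the induction only goes over the bits of one
    hyperedge, whereas the loop continues with the others. *)
Lemma conB_edge e rest o s ok found t y o2 s2 :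
  s rE = map Some e ++ None :: rest -> size e = size (s rX) ->
  execn (eachS rE conB (true, found || (ok && subl e (s rX)))) o
    (upd (upd (upd (upd s rE rest) rET (None :: catrev (map Some e) (s rET)))
       rX (catrev (s rXT) (s rX))) rXT [::]) t y o2 s2 ->
  execn (eachS rE conB (ok, found)) o s
    (t + 10 * size e + 5 * (size (s rXT) + size (s rX)) + 20) y o2 s2.
Proof.
elim: e ok s t => [|b e IH] ok s t E sz H.
  apply: execW; last first.
    apply: ex_eachS_cons E _ _ => //.
    - apply: exec_bind; first exact: ex_push.
      by apply: exec_bind; [exact: ex_move | exact: exec_ret].
    - move: H; have -> : subl [::] (s rX) = true by case: (s rX) sz.
      by rewrite andbT => H; apply: exec_from H => //; st_eq.
  by rewrite /=; lia.
case X : (s rX) sz => [|x X'] //= [sz].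
apply: execW; last first.
  apply: ex_eachS_cons E _ _ => //.
  - apply: exec_bind; first exact: ex_push.
    apply: exec_bind; first exact: ex_pop.
    by apply: exec_bind; [exact: ex_push | exact: exec_ret].
  - rewrite /= X /=; apply: IH => //=.
    by move: H; rewrite X -andbA => H; apply: exec_from H => //; st_eq.
by rewrite /= ?X /=; lia.
Qed.

Lemma conB_all Es o s found :
  s rE = encE Es -> all (fun e => size e == size (s rX)) Es -> s rXT = [::] ->
  execn (eachS rE conB (true, found)) o s (20 * size (encE Es) + 3)
    (true, found || cont Es (s rX)) o (upd (upd s rE [::]) rET (catrev (encE Es) (s rET))).
Proof.
elim: Es s found => [|e Es IH] s found E /=.
  move=> _ _; apply: exec_eq; [exact: ex_eachS_nil | by [] | by rewrite orbF | by [] | by st_eq].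
case/andP=> /eqP se sEs eX; apply: exec_eq.
- apply: (@conB_edge e (encE Es)) => //; first by rewrite E /encE /= -catA.
  by apply: IH => //=; rewrite eX.
- rewrite eX -se /encE /= !size_cat size_map /=; lia.
- by rewrite /= eX orbA.
- by [].
- have Q z : catrev (encE (e :: Es)) z = catrev (encE Es) (None :: catrev (map Some e) z).
    by rewrite /encE /= 2!catrev_catl.
  by move=> j; rewrite Q; st_core; rewrite eX.
Qed.

(** The reversal comes from [expand], which pushes the entries on a stack: vertex v receives the
    entry of [c] at index n - v - 1 modulo the period. *)
Definition pat n (c : seq a3) : seq a3 := rev [seq nth aZ c (j %% size c) | j <- iota 0 n].

Fixpoint visf j (P : seq a3) : seq nat :=
  if P is p :: P' then if p == aO then j :: visf j.+1 P' else visf j.+1 P' else [::].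

(** [C] is a stack, so every chunk is the reverse of the bits read; bits behind the last [None] form
    no chunk. *)
Fixpoint chunks (C u : seq a3) : seq (seq a3) :=
  match u with
  | [::] => [::]
  | None :: u' => C :: chunks [::] u'
  | b :: u' => chunks (b :: C) u'
  end.

(* Each chunk of u, repeated periodically over the vertices, marks those visited
   in one round. *)
Definition visits n u := flatten [seq visf 0 (pat n C) | C <- chunks [::] u].

(* With [mode = false] the bits are read from q; with [mode = true] they are
   copied from the set G and q is the remaining budget in unary. *)
Definition oracleM (mode : bool) (g : a3) (q : seq a3) : bool * bool * seq a3 :=
  if mode then
    let b := g == aZ in
    let c := if b then 5 else 4 in
    (b, c <= size q, if c <= size q then drop c q else q)
  else if q is x :: q' then (x == aO, true, q') else (true, false, [::]).

Definition visit (Es : seq (seq bool)) mode (G : seq a3) (x : seq a3 * seq a3 * bool) v :=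
  let: (D, q, ok) := x in
  if nth None D v != None then x else
  if cont Es (set_nth None D v aO) then (set_nth None D v aZ, q, ok) else
  let: (b, ok', q') := oracleM mode (nth aO G v) q in
  (set_nth None D v (if b then aZ else aO), q', ok && ok').

Arguments visit : simpl never.

Definition runM Es n mode G u q := foldl (visit Es mode G) (nseq n None, q, true) (visits n u).

Lemma set_nth_mid (T : Type) (z : T) l d r x : set_nth z (l ++ d :: r) (size l) x = l ++ x :: r.
Proof. by elim: l => //= a l ->. Qed.

Lemma size_visits Es mode G vs D q ok : (forall v, v \in vs -> v < size D) ->
  size (foldl (visit Es mode G) (D, q, ok) vs).1.1 = size D.
Proof.
elim: vs D q ok => //= v vs IH D q ok H.
have lt := H v (mem_head _ _).
have sn x : size (set_nth None D v x) = size D by rewrite size_set_nth; lia.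
have {}H w : w \in vs -> w < size D by move=> h; apply: H; rewrite inE h orbT.
rewrite /visit; case: ifP => _; first exact: IH.
case: ifP => _; first by rewrite IH ?sn.
by case: (oracleM _ _ _) => [[b ok'] q']; rewrite IH ?sn.
Qed.

Lemma mem_visf j P v : (v \in visf j P) = [&& j <= v, v < j + size P & nth aZ P (v - j) == aO].
Proof.
elim: P j => [|p P IH] j /=; first by rewrite in_nil; lia.
have [e|ne] := eqVneq v j.
  subst v; rewrite subnn /= leqnn addnS ltnS leq_addr /=.
  by case: ifP; rewrite ?inE ?eqxx // IH ltnn.
have [lt|ge] := ltnP j v; last first.
  have /negbTE -> : v \notin (if p == aO then j :: visf j.+1 P else visf j.+1 P).
    by case: ifP; rewrite ?inE ?(negbTE ne) IH; lia.
  by rewrite leqNgt; case: ltnP => //; lia.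
have -> : v - j = (v - j.+1).+1 by lia.
by case: ifP; rewrite ?inE ?(negbTE ne) IH lt addSnnS (ltnW lt).
Qed.

Definition nextp : frag a3 :=
  x <~ rpop rC ;;
  if x is Some a then rpush rCT a ;; fret (a : a3)
  else (move rCT rC ;; y <~ rpop rC ;;
        if y is Some a then rpush rCT a ;; fret (a : a3) else fret (aZ : a3)).

Definition expand : frag unit :=
  each rN (fun _ => rpush rT aO ;; p <~ nextp ;; rpush rP p) ;;
  move rT rN ;; clear rC ;; clear rCT.

Definition oracle (mode : bool) (g : option a3) : frag (bool * bool)%type :=
  if mode then
    ok <~ trypay (if g == Some aZ then 5 else 4) rQ ;; fret (g == Some aZ, ok : bool)
  else
    x <~ rpop rQ ;; fret (if x is Some a then (a == aO, true) else (true, false)).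

Lemma ex_oracle mode g o s :
  let r := oracleM mode (odflt aO g) (s rQ) in
  execn (oracle mode g) o s 30 r.1 o (upd s rQ r.2).
Proof.
case: mode => /=; last first.
  apply: exec_eq.
  - by apply: exec_bind; [exact: ex_pop | exact: exec_ret].
  - by [].
  - by case: (s rQ).
  - by [].
  - by st_eq; case: (s rQ).
apply: exec_eq.
- by apply: exec_bind; [exact: ex_trypay | exact: exec_ret].
- by case: ifP.
- by case: g => // a.
- by [].
- by case: g => [a|] j /=; case: ifP => // _; st_core.
Qed.

(** Wrapping around is postponed to the next call, so the position [r] may equal [size c]; it is
    therefore only congruent to the number [j] of entries read. *)
Lemma ex_nextp o s c r j : s rC = drop r c -> s rCT = rev (take r c) -> r <= size c ->
  (0 < size c -> r = j %[mod size c]) ->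
  exists r', [/\ r' <= size c, 0 < size c -> r' = j.+1 %[mod size c] &
   execn nextp o s (5 * size c + 20) (nth aZ c (j %% size c)) o
    (upd (upd s rC (drop r' c)) rCT (rev (take r' c)))].
Proof.
move=> eC eCT le er.
have [lt|ge] := ltnP r (size c).
  have rj : j %% size c = r by rewrite -er ?modn_small //; lia.
  have e := drop_nth aZ lt; have e' := take_nth aZ lt.
  exists r.+1; split; rewrite ?lt //; first by move=> _; rewrite -rj -[(j %% _).+1]addn1 -[j.+1]addn1 modnDml.
  rewrite rj; apply: exec_eq.
  - apply: exec_bind; first exact: ex_pop.
    rewrite eC e; apply: exec_bind; [exact: ex_push | exact: exec_ret].
  - lia.
  - by [].
  - by [].
  - by st_eq; rewrite ?eC ?eCT ?e' ?rev_rcons ?e.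
have re : r = size c by lia.
rewrite re drop_size in eC; rewrite re take_size in eCT.
case: c eC eCT {le ge} er re => [|a c] eC eCT er re.
  exists 0; split => //; apply: exec_eq.
  - apply: exec_bind; first exact: ex_pop.
    rewrite eC; apply: exec_bind; first exact: ex_move.
    apply: exec_bind; first exact: ex_pop.
    rewrite /= ?eCT ?eC; exact: exec_ret.
  - rewrite /= ?eCT /=; lia.
  - by rewrite nth_nil.
  - by [].
  - by st_eq; rewrite ?eC ?eCT.
have j0 : j %% (size c).+1 = 0 by rewrite -er // re modnn.
exists 1; split => //; first by move=> _; rewrite -[j.+1]addn1 -[RHS]modnDml j0.
rewrite j0; apply: exec_eq.
- apply: exec_bind; first exact: ex_pop.
  rewrite eC; apply: exec_bind; first exact: ex_move.
  apply: exec_bind; first exact: ex_pop.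
  rewrite /= ?eCT ?eC catrevE revK /=; apply: exec_bind; [exact: ex_push | exact: exec_ret].
- rewrite /= ?eCT ?size_rev /=; lia.
- by [].
- by [].
- by st_eq; rewrite ?cats0 ?drop0 ?take0.
Qed.

Lemma ex_expand_loop c o s r j m : s rN = nseq m aO ->
  s rC = drop r c -> s rCT = rev (take r c) -> r <= size c ->
  (0 < size c -> r = j %[mod size c]) ->
  exists r', execn (each rN (fun _ => rpush rT aO ;; p <~ nextp ;; rpush rP p)) o s
     (m * (5 * size c + 40) + 3) tt o
     (upd (upd (upd (upd (upd s rC (drop r' c)) rCT (rev (take r' c))) rN [::]) rT (nseq m aO ++ s rT))
      rP (catrev [seq nth aZ c (i %% size c) | i <- iota j m] (s rP))).
Proof.
elim: m s r j => [|m IH] s r j eN eC eCT le er.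
  exists r; apply: exec_eq; [exact: ex_eachS_nil | by [] | by [] | by [] | by st_eq].
have [r1 [le1 er1 H1]] := @ex_nextp o (upd (upd s rN (nseq m aO)) rT (aO :: s rT)) c r j eC eCT le er.
have [|||r2 H2] := IH (upd (upd (upd (upd (upd s rN (nseq m aO)) rT (aO :: s rT)) rC (drop r1 c))
   rCT (rev (take r1 c))) rP (nth aZ c (j %% size c) :: s rP)) r1 j.+1 _ _ _ le1 er1 => //.
exists r2; apply: exec_eq.
- apply: ex_eachS_cons eN _ H2 => //.
  apply: exec_bind; first exact: ex_push.
  apply: exec_bind; first exact: H1.
  exact: ex_push.
- lia.
- by [].
- by [].
- by st_eq; elim: (m) => //= ? ->.
Qed.

Lemma visits_ok Es mode G vs D q ok :
  foldl (visit Es mode G) (D, q, ok) vs =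
  let r := foldl (visit Es mode G) (D, q, true) vs in (r.1, ok && r.2).
Proof.
elim: vs D q ok => [|v vs IH] D q ok /=; first by rewrite andbT.
rewrite /visit; case: ifP => _; first exact: IH.
case: ifP => _; first by rewrite IH.
by case: (oracleM _ _ _) => [[b ok'] q']; rewrite IH (IH _ _ ok') /= andbA.
Qed.

Lemma size_pat n c : size (pat n c) = n.
Proof. by rewrite size_rev size_map size_iota. Qed.

Lemma catrev_rev (T : Type) (l x : seq T) : catrev (rev l) x = l ++ x.
Proof. by rewrite catrevE revK. Qed.

(** * Strings as numbers in bijective base 3 *)

Definition dig (a : a3) := match a with Some false => 1 | Some true => 2 | None => 3 end.
Fixpoint bnum (u : seq a3) := if u is a :: v then dig a + 3 * bnum v else 0.

Lemma bnum_gt0 u : (0 < bnum u) = (u != [::]).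
Proof. by case: u => [|[[]|] u]. Qed.

Lemma bnum_decl u : bnum (decl u) = (bnum u).-1.
Proof.
elim: u => [|[[]|] u IH] //=.
case: u IH => [|a u] // IH.
have : 0 < bnum (a :: u) by rewrite bnum_gt0.
by rewrite -/(decl (a :: u)) -/(bnum (a :: u)) [bnum (None :: _)]/= IH; lia.
Qed.

Lemma size_decl u : size (decl u) <= size u.
Proof. by elim: u => [|[[]|] [|b u] IH]. Qed.

Lemma bnum_le u : 2 * bnum u + 3 <= 3 ^ (size u).+1.
Proof.
elim: u => [|a u IH] //=; rewrite expnS.
have : dig a <= 3 by case: a => [[]|].
lia.
Qed.

(** The digits 1, 2, 3 represent the residues modulo 3 and none of them is zero, so neither a digit
    nor the length is ambiguous. Hence [bnum] orders the strings linearly and a least one makes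
    sense. *)
Lemma bnum_inj : injective bnum.
Proof.
elim=> [|a u IH] [|b v] //= E; try by move: a b E => [[]|] [[]|] /=; lia.
- by case: b E => [[]|].
- by case: a E => [[]|].
have [-> /IH -> //] : a = b /\ bnum u = bnum v.
by case: a b E => [[]|] [[]|] /= E; split=> //; lia.
Qed.

Fixpoint desc m u := if m is m'.+1 then decl u :: desc m' (decl u) else [::].

(** Counting down meets every string of smaller value, whatever its length; started at the largest
    string of a given length, it reaches all strings that are not longer. *)
Lemma mem_desc m u v : m = bnum u -> (v \in desc m u) = (bnum v < m).
Proof.
elim: m u => [|m IH] u E //=.
rewrite inE IH ?bnum_decl -?E // [in RHS]ltnS [in RHS]leq_eqVlt.
congr (_ || _); apply/eqP/eqP => [->|e]; first by rewrite bnum_decl -E.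
by apply: bnum_inj; rewrite bnum_decl -E.
Qed.

Lemma desc_uniq m u : m = bnum u -> uniq (desc m u).
Proof.
elim: m u => [|m IH] u E //=.
by rewrite IH ?mem_desc ?bnum_decl -?E // ltnn.
Qed.

Lemma size_runM Es n mode G u q : size (runM Es n mode G u q).1.1 = n.
Proof.
rewrite size_visits ?size_nseq // => v /flattenP[vs /mapP[c _ ->]].
by rewrite mem_visf size_pat; lia.
Qed.

Lemma size_oracleM mode g q : size (oracleM mode g q).2 <= size q.
Proof.
case: mode => /=; last by case: q => //= a q; lia.
by case: ifP => _ //=; rewrite size_drop; lia.
Qed.

Lemma size_runMq Es n mode G u q : size (runM Es n mode G u q).1.2 <= size q.
Proof.
rewrite /runM; elim: (visits n u) (nseq n None) q true => //= v vs IH D q ok.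
rewrite /visit; case: ifP => _ //; case: ifP => _ //.
have := size_oracleM mode (nth aO G v) q.
case: (oracleM _ _ _) => [[b ok'] q'] /= le; exact: leq_trans (IH _ _ _) le.
Qed.

(** The bound attached to [exec] is quadratic and would square the number of advice strings. The
    outermost loop therefore adds plain step counts of its rounds. *)
Definition runsT L (f : frag L) o s T x o' s' :=
  forall b, exists b', runs f (rev o) (cfgR nreg s b) T x (rev o') (cfgR nreg s' b').

Lemma ex_runsT L (f : frag L) o s t x o' s' :
  execn f o s t x o' s' -> runsT f o s (20 * t * (szst nreg s + t)) x o' s'.
Proof. by case. Qed.

Lemma runsTW L (f : frag L) o s T T' x o' s' :
  T <= T' -> runsT f o s T x o' s' -> runsT f o s T' x o' s'.
Proof. by move=> le H b; have [b' R] := H b; exists b'; apply: runsW R. Qed.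

Lemma runsT_from L (f : frag L) o o0 s s0 t x o' s' :
  o = o0 -> s =1 s0 -> runsT f o s t x o' s' -> runsT f o0 s0 t x o' s'.
Proof. by move=> <- /functional_extensionality <-. Qed.

Lemma runsT_loop_next (S : finType) B (f : S -> frag (S + B)%type) x o s T1 x1 o1 s1 T2 y o2 s2 :
  runsT (f x) o s T1 (inl x1) o1 s1 -> runsT (floop f x1) o1 s1 T2 y o2 s2 ->
  runsT (floop f x) o s (T1 + T2.+1) y o2 s2.
Proof.
move=> H1 H2 b; have [b1 R1] := H1 b; have [b2 R2] := H2 b1.
by exists b2; apply: runs_loop_next R1 _.
Qed.

Lemma runsT_loop_exit (S : finType) B (f : S -> frag (S + B)%type) x o s T1 y o2 s2 :
  runsT (f x) o s T1 (inr y) o2 s2 -> runsT (floop f x) o s T1.+1 y o2 s2.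
Proof.
by move=> H1 b; have [b1 R1] := H1 b; exists b1; apply: runs_loop_exit R1.
Qed.

(** * Enumeration of the advice strings *)

(* f is fuel for the recursion, b the remaining budget. *)
Fixpoint enumW f b (w : seq a3) : seq (seq a3) :=
  if f is f'.+1 then
    w :: (if 4 <= b then enumW f' (b - 4) (aZ :: w) ++
                        (if 5 <= b then enumW f' (b - 5) (aO :: w) else [::])
          else [::])
  else [::].

(** * Correctness of the decoding, checking and duplicate-removal programs *)

Section Specs.
Variables (Es : seq (seq bool)) (n A : nat).
Hypotheses (nA : n <= A) (EA : size (encE Es) <= A) (A0 : 0 < A).
Hypothesis sEs : all (fun e => size e == n) Es.

Definition wf (s : regs) :=
  [/\ s rE = encE Es, s rN = nseq n aO & [/\ s rXT = [::], s rET = [::], s rT = [::] & s rX = [::]]].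

Lemma ex_contains o s : s rE = encE Es -> s rXT = [::] -> s rET = [::] -> size (s rX) = n ->
  execn contains o s (40 * A) (cont Es (s rX)) o s.
Proof.
move=> E eXT eET sX; apply: exec_eq.
- apply: exec_bind; first by apply: (@conB_all Es) => //; rewrite ?sX.
  by apply: exec_bind; [exact: ex_move | exact: exec_ret].
- rewrite /= catrevE size_cat size_rev eET /=; lia.
- by [].
- by [].
- by move=> j; rewrite /= eET; st_core; rewrite catrevK cats0 E.
Qed.

Definition test : frag bool :=
  copy rD rX rT ;; rpush rX aO ;; each rL (fun a => rpush rT a ;; rpush rX a) ;;
  move rT rL ;; c <~ contains ;; clear rX ;; fret (c : bool).

Lemma ex_test o s : wf s -> size (s rL) + (size (s rD)).+1 = n ->
  execn test o s (100 * A) (cont Es (catrev (s rL) (aO :: s rD))) o s.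
Proof.
case=> E N [eXT eET eT eX] sz; apply: exec_eq.
- apply: exec_bind; first by apply: ex_copy.
  apply: exec_bind; first exact: ex_push.
  apply: exec_bind; first by apply: (@ex_move2 rL rT rX).
  apply: exec_bind; first exact: ex_move.
  apply: exec_bind.
    by apply: ex_contains => //=; rewrite catrevE size_cat size_rev /= eX cats0.
  by apply: exec_bind; [exact: ex_clear | exact: exec_ret].
- rewrite /= eT eX ?cats0 !catrevE ?cats0 !size_cat !size_rev /= ?size_cat ?size_rev /=; lia.
- by rewrite /= eX cats0.
- by [].
- by move=> j; rewrite /= eX eT; st_core; rewrite !catrevE !cats0 revK.
Qed.

Lemma ex_expand o s c : wf s -> s rC = c -> s rCT = [::] -> s rP = [::] -> size c <= A ->
  execn expand o s (100 * A * A) tt o (upd (upd s rC [::]) rP (pat n c)).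
Proof.
case=> E N [eXT eET eT eX] eC eCT eP szc.
have [||||r H] := @ex_expand_loop c o s 0 0 n N => //.
- by rewrite drop0.
- by rewrite take0.
apply: exec_eq.
- apply: exec_bind; first exact: H.
  apply: exec_bind; first exact: ex_move.
  by apply: exec_bind; exact: ex_clear.
- rewrite /= eT cats0 size_nseq size_rev !size_take size_drop.
  set t := if _ then _ else _; have : t <= size c by rewrite /t; case: ltnP; lia.
  nia.
- by [].
- by [].
- by st_eq; rewrite ?eT ?eP ?N ?cats0 /pat ?catrevE ?cats0 ?rev_nseq ?eCT.
Qed.

Definition round mode : frag bool :=
  ok <~ eachS rD (fun (ok : bool) d =>
    p <~ rpop rP ;; g <~ rpop rG ;;
    (if g is Some a then rpush rGL a else fret tt) ;;
    if (d == aS) && (p == Some aO) then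
      (c <~ test ;;
       if c then rpush rL aZ ;; fret ok else
       (b <~ oracle mode g ;;
        rpush rL (if (b : bool * bool).1 then aZ else aO) ;; fret (ok && b.2)))
    else rpush rL d ;; fret ok) true ;;
  move rL rD ;; move rGL rG ;; fret (ok : bool).

(** The sweep over the vertices holds the statuses as a zipper: [L] in reverse, the current [d],
    then [R]. The current vertex has number [size L]. *)
Lemma visit_mid mode G L d R q ok :
  visit Es mode G (catrev L (d :: R), q, ok) (size L) =
  if d != None then (catrev L (d :: R), q, ok) else
  if cont Es (catrev L (aO :: R)) then (catrev L (aZ :: R), q, ok) else
  let: (b, ok', q') := oracleM mode (nth aO G (size L)) q in
  (catrev L ((if b then aZ else aO) :: R), q', ok && ok').
Proof.
have H x : set_nth None (catrev L (d :: R)) (size L) x = catrev L (x :: R).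
  by rewrite !catrevE -(size_rev L) set_nth_mid.
rewrite /visit !H; have -> : nth None (catrev L (d :: R)) (size L) = d.
  by rewrite catrevE nth_cat size_rev ltnn subnn.
by case: (oracleM _ _ _) => [[b ok'] q']; rewrite H.
Qed.

Lemma ohead_drop (T : Type) (x : T) j G : ohead (drop j G) = if j < size G then Some (nth x G j) else None.
Proof.
case: ltnP => [lt|ge]; first by rewrite (drop_nth x lt).
by rewrite drop_oversize.
Qed.

Lemma ex_round_loop mode G : forall R L P o s ok,
  wf s -> s rD = R -> s rL = L -> s rP = P -> size P = size R ->
  size L + size R = n -> s rG = drop (size L) G -> s rGL = rev (take (size L) G) ->
  let r := foldl (visit Es mode G) (catrev L R, s rQ, ok) (visf (size L) P) in
  execn (eachS rD (fun (ok : bool) d =>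
    p <~ rpop rP ;; g <~ rpop rG ;;
    (if g is Some a then rpush rGL a else fret tt) ;;
    if (d == aS) && (p == Some aO) then
      (c <~ test ;;
       if c then rpush rL aZ ;; fret ok else
       (b <~ oracle mode g ;;
        rpush rL (if (b : bool * bool).1 then aZ else aO) ;; fret (ok && b.2)))
    else rpush rL d ;; fret ok) ok) o s (size R * (200 * A) + 3) r.2 o
   (upd (upd (upd (upd (upd (upd s rD [::]) rL (rev r.1.1)) rP [::]) rG (drop n G)) rGL (rev (take n G)))
     rQ r.1.2).
Proof.
elim=> [|d R IH] L P o s ok w eD eL eP sP sz eG eGL.
  case: P eP sP => // eP _.
  apply: exec_eq; [exact: ex_eachS_nil | by [] | by [] | by [] | ].
  by rewrite /= addn0 in sz; st_eq; rewrite /= ?catrevE ?cats0 ?revK ?sz; rewrite -?sz.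
case: P eP sP => // p P eP [sP].
have wE := w; case: wE => [E N [eXT eET eT eX]].
pose s1 := upd (upd (upd (upd s rD R) rP P) rG (drop (size L).+1 G)) rGL (rev (take (size L).+1 G)).
pose g := ohead (drop (size L) G).
(* The common prelude of all cases: one entry of the pattern and one of [G] are consumed. *)
have head t x o2 s2 f :
  execn (f (Some p) g) o s1 t x o2 s2 ->
  execn (p <~ rpop rP ;; g <~ rpop rG ;; (if g is Some a then rpush rGL a else fret tt) ;; f p g : frag bool) o
     (upd s rD R) (t + 10) x o2 s2.
  move=> H; apply: execW; last first.
    apply: exec_bind; first exact: ex_pop.
    apply: exec_bind; first exact: ex_pop.
    rewrite /= eP eG /=.
    have HG : execn (if ohead (drop (size L) G) is Some a then rpush rGL a else fret tt) o
       (upd (upd (upd s rD R) rP P) rG (behead (drop (size L) G))) 1 tt o s1.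
      (* [G] is empty when bits come from the advice, so [rG] may run out before the vertices do. *)
      rewrite (ohead_drop aO); case: ltnP => lt.
        have e1 := drop_nth aO lt; have e2 := take_nth aO lt.
        apply: exec_eq; [exact: ex_push | by [] | by [] | by [] |].
        by rewrite /s1; st_eq; rewrite ?eGL ?e1 ?e2 ?rev_rcons.
      have e1 : drop (size L) G = [::] by rewrite drop_oversize.
      have e2 : drop (size L).+1 G = [::] by rewrite drop_oversize //; lia.
      have e3 : take (size L).+1 G = take (size L) G by rewrite !take_oversize //; lia.
      apply: exec_eq; [exact: exec_ret | by [] | by [] | by [] |].
      by rewrite /s1; st_eq; rewrite ?eGL ?e1 ?e2 ?e3.
    by apply: exec_bind; [exact: HG | exact: H].
  lia.
pose bd p g := if (d == aS) && (p == Some aO) then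
      (c <~ test ;;
       if c then rpush rL aZ ;; fret ok else
       (b <~ oracle mode g ;;
        rpush rL (if (b : bool * bool).1 then aZ else aO) ;; fret (ok && b.2)))
    else rpush rL d ;; fret ok.
(* One vertex at a time: [x] is its new status, [q'] what remains of the advice or budget, [ok'] the
   updated flag. *)
suff [x [q' [ok' [Ef H]]]] : exists x q' ok',
  foldl (visit Es mode G) (catrev L (d :: R), s rQ, ok) (visf (size L) (p :: P)) =
  foldl (visit Es mode G) (catrev L (x :: R), q', ok') (visf (size L).+1 P) /\
  execn (bd (Some p) g) o s1 (150 * A) ok' o (upd (upd s1 rL (x :: L)) rQ q').
  rewrite Ef; apply: exec_eq.
  - apply: ex_eachS_cons eD _ _ => //; first by apply: head; exact: H.
    by apply: (IH (x :: L) P) => //=; rewrite ?addSnnS.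
  - rewrite [size (_ :: R)]/=; lia.
  - by [].
  - by [].
  - by rewrite /s1; st_eq.
have w1 : wf s1 by [].
rewrite /bd; case dp : (_ && _); last first.
  exists d, (s rQ), ok; split.
    rewrite [visf _ _]/=; case: (p =P aO) => [pe|_] //.
    by move: dp; rewrite pe eqxx andbT => /negbT dS; rewrite /= visit_mid dS.
  apply: exec_eq; [| | by [] | by [] |].
  - by apply: exec_bind; [exact: ex_push | exact: exec_ret].
  - lia.
  - by rewrite /s1; st_eq.
case/andP: dp => /eqP dS /eqP [pO]; rewrite dS pO.
have T : execn test o s1 (100 * A) (cont Es (catrev L (aO :: R))) o s1.
  have := @ex_test o s1 w1; rewrite /s1 /= eL; apply.
  by rewrite /= in sz; lia.
have -> : visf (size L) (aO :: P) = size L :: visf (size L).+1 P by [].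
rewrite [foldl _ _ (_ :: _)]/= visit_mid /=.
case cE : (cont Es _) in T *.
  exists aZ, (s rQ), ok; split => //.
  apply: exec_eq; [| | by [] | by [] |].
  - apply: exec_bind; first exact: T.
    by apply: exec_bind; [exact: ex_push | exact: exec_ret].
  - lia.
  - by rewrite /s1; st_eq.
have := ex_oracle mode g o s1.
have -> : odflt aO g = nth aO G (size L).
  by rewrite /g (ohead_drop aO); case: ltnP => // ge; rewrite nth_default.
have -> : s1 rQ = s rQ by [].
case: (oracleM _ _ _) => [[b ok'] q'] /= HO.
exists (if b then aZ else aO), q', (ok && ok'); split => //.
apply: exec_eq; [| | by [] | by [] |].
- apply: exec_bind; first exact: T.
  apply: exec_bind; first exact: HO.
  by apply: exec_bind; [exact: ex_push | exact: exec_ret].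
- lia.
- by rewrite /s1; st_eq.
Qed.

Lemma ex_round mode G P o s : wf s -> s rL = [::] -> s rGL = [::] -> s rP = P -> size P = n ->
  size (s rD) = n -> size G <= n -> s rG = G ->
  let r := foldl (visit Es mode G) (s rD, s rQ, true) (visf 0 P) in
  execn (round mode) o s (300 * A * A) r.2 o (upd (upd (upd s rD r.1.1) rP [::]) rQ r.1.2).
Proof.
move=> w eL eGL eP sP sD sG eG r.
have := @ex_round_loop mode G (s rD) [::] P o s true w erefl eL eP.
rewrite sP sD add0n drop0 take0 => /(_ erefl erefl eG eGL) H.
have sr : size r.1.1 = n.
  rewrite size_visits // => v; rewrite mem_visf sP sD; lia.
apply: exec_eq.
- apply: exec_bind; first exact: H.
  apply: exec_bind; first exact: ex_move.
  by apply: exec_bind; [exact: ex_move | exact: exec_ret].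
- rewrite /= size_rev size_rev size_take sr.
  set t := if _ then _ else _; have : t <= n by rewrite /t; case: ltnP; lia.
  nia.
- by [].
- by [].
- rewrite drop_oversize // take_oversize //.
  by st_num ltac:(rewrite ?catrevE ?revK ?cats0).
Qed.

Definition hasS : frag bool :=
  f <~ eachS rD (fun (f : bool) a => rpush rL a ;; fret (f || (a == aS))) false ;;
  move rL rD ;; fret (f : bool).

Definition run_loop mode :=
  eachS rUC (fun (ok : bool) a =>
    match a with
    | None => expand ;; r <~ round mode ;; fret (ok && r)
    | Some b => rpush rC (Some b) ;; fret ok
    end).

Definition run mode ru : frag bool :=
  copy ru rUC rT ;; each rN (fun _ => rpush rT aO ;; rpush rD aS) ;; move rT rN ;;
  ok <~ run_loop mode true ;;
  clear rC ;; u <~ hasS ;; fret (ok && ~~ u).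

Lemma ex_hasS_loop o s f : s rL = [::] ->
  execn (eachS rD (fun (f : bool) a => rpush rL a ;; fret (f || (a == aS))) f) o s
   (6 * size (s rD) + 3) (f || (aS \in s rD)) o (upd (upd s rL (rev (s rD))) rD [::]).
Proof.
move=> eL; have -> : rev (s rD) = catrev (s rD) (s rL) by rewrite eL catrevE cats0.
move E : (s rD) => D {eL}; elim: D s f E => [|a D IH] s f E.
  by apply: exec_eq; [exact: ex_eachS_nil | by [] | by rewrite orbF | by [] | st_num ltac:(rewrite ?E)].
apply: exec_eq.
- apply: ex_eachS_cons E _ _ => //.
    by apply: exec_bind; [exact: ex_push | exact: exec_ret].
  exact: IH.
- rewrite /=; lia.
- by rewrite inE eq_sym orbA.
- by [].
- by st_num idtac.
Qed.

Lemma ex_hasS o s : s rL = [::] -> size (s rD) = n -> execn hasS o s (20 * A) (aS \in s rD) o s.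
Proof.
move=> eL sD; apply: exec_eq.
- apply: exec_bind; first exact: ex_hasS_loop.
  by apply: exec_bind; [exact: ex_move | exact: exec_ret].
- rewrite /= size_rev sD; lia.
- by [].
- by [].
- by st_num ltac:(rewrite ?catrev_rev ?cats0 ?eL).
Qed.

(** [C'] is the unfinished chunk behind the last separator; it causes no round, and [run] clears it
    afterwards. *)
Lemma ex_run_loop mode G : forall u C o s ok,
  wf s -> s rUC = u -> s rC = C -> size C + size u <= A ->
  s rL = [::] -> s rGL = [::] -> s rP = [::] -> s rCT = [::] ->
  size (s rD) = n -> size G <= n -> s rG = G ->
  let r := foldl (visit Es mode G) (s rD, s rQ, ok) (flatten [seq visf 0 (pat n c) | c <- chunks C u]) in
  exists2 C', size C' <= A &
  execn (run_loop mode ok) o s (size u * (500 * A * A) + 3) r.2 o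
    (upd (upd (upd (upd s rUC [::]) rC C') rD r.1.1) rQ r.1.2).
Proof.
elim=> [|a u IH] C o s ok w eU eC sz eL eGL eP eCT sD sG eG.
  exists C; first by move: sz; rewrite addn0.
  by apply: exec_eq; [exact: ex_eachS_nil | by [] | by [] | by [] | st_num ltac:(rewrite ?eC)].
case: a eU sz => [b|] eU sz.
  have [|||||||||||C' sC' H] := IH (Some b :: C) o (upd (upd s rUC u) rC (Some b :: C)) ok => //.
    by move: sz; rewrite /=; lia.
  exists C' => //; apply: exec_eq.
  - apply: ex_eachS_cons eU _ _ => //.
      by apply: exec_bind; [exact: ex_push | exact: exec_ret].
    by rewrite /= eC; exact: H.
  - rewrite [size (_ :: u)]/=; nia.
  - by [].
  - by [].
  - by st_num idtac.
pose r := foldl (visit Es mode G) (s rD, s rQ, true) (visf 0 (pat n C)).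
have sr : size r.1.1 = n.
  by rewrite size_visits // => v; rewrite mem_visf size_pat sD; lia.
have [|||||||||||C' sC' H] := IH [::] o (upd (upd (upd (upd s rUC u) rC [::]) rD r.1.1) rQ r.1.2) (ok && r.2) => //.
  by move: sz; rewrite /=; lia.
have E : foldl (visit Es mode G) (s rD, s rQ, ok) (flatten [seq visf 0 (pat n c) | c <- chunks C (None :: u)]) =
  foldl (visit Es mode G) (r.1.1, r.1.2, ok && r.2) (flatten [seq visf 0 (pat n c) | c <- chunks [::] u]).
  rewrite -[flatten [seq _ | c <- chunks C _]]/(visf 0 (pat n C) ++ flatten [seq visf 0 (pat n c) | c <- chunks [::] u]).
  by rewrite foldl_cat [in LHS](visits_ok _ _ _ (visf 0 _)) -/r /= -surjective_pairing.
exists C' => //; apply: exec_eq.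
- apply: ex_eachS_cons eU _ _ => //.
    apply: exec_bind.
      by apply: (@ex_expand o (upd s rUC u) C) => //; move: sz; rewrite /=; lia.
    apply: exec_bind; last exact: exec_ret.
    by apply: (@ex_round mode G (pat n C)) => //; rewrite size_pat.
  apply: exec_from H => //; st_num idtac.
- rewrite [size (_ :: u)]/=; nia.
- by rewrite E.
- by [].
- by rewrite E; st_num idtac.
Qed.

Lemma ex_initD m o s : s rN = nseq m aO ->
  execn (each rN (fun _ => rpush rT aO ;; rpush rD aS)) o s (7 * m + 3) tt o
    (upd (upd (upd s rN [::]) rT (nseq m aO ++ s rT)) rD (nseq m aS ++ s rD)).
Proof.
elim: m s => [|m IH] s eN.
  by apply: exec_eq; [exact: ex_eachS_nil | by [] | by [] | by [] | st_num ltac:(rewrite ?eN)].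
apply: exec_eq.
- apply: ex_eachS_cons eN _ _ => //; first by apply: exec_bind; exact: ex_push.
  exact: IH.
- lia.
- by [].
- by [].
- by st_num ltac:(try by elim: (m) => //= ? ->).
Qed.

Definition cl (s : regs) :=
  [/\ s rUC = [::], s rC = [::], s rCT = [::] & s rP = [::]] /\ s rL = [::] /\ s rGL = [::].

Lemma ex_run mode ru G u o s : wf s -> cl s -> s rD = [::] -> ru \in [:: rU; rV] ->
  s ru = u -> size u <= A -> s rG = G -> size G <= n ->
  let r := runM Es n mode G u (s rQ) in
  execn (run mode ru) o s (1000 * A * A * A) (r.2 && (None \notin r.1.1)) o
    (upd (upd s rD r.1.1) rQ r.1.2).
Proof.
move=> w [[eUC eC eCT eP] [eL eGL]] eD hru eu sz eG sG r.
have [E N [eXT eET eT eX]] := w.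
have [|||||||||||C sC] := @ex_run_loop mode G u [::] o (upd (upd s rUC u) rD (nseq n aS)) true => //.
  by rewrite /= size_nseq.
rewrite -/(runM Es n mode G u (s rQ)) -/r => H.
have sr : size r.1.1 = n.
  rewrite size_visits ?size_nseq // => v /flattenP[vs /mapP[c _ ->]].
  by rewrite mem_visf size_pat; lia.
apply: exec_eq.
- apply: exec_bind; first by apply: ex_copy => //; case/or3P: hru => // /eqP ->.
  apply: exec_bind; first exact: (@ex_initD n).
  apply: exec_bind; first exact: ex_move.
  apply: exec_bind.
    apply: exec_from H => //; st_num ltac:(rewrite ?eT ?eUC ?eD ?cats0 ?eu ?catrevE ?rev_nseq ?N ?cats0).
  apply: exec_bind; first exact: ex_clear.
  by apply: exec_bind; [exact: ex_hasS | exact: exec_ret].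
- rewrite /= eu eT cats0 size_nseq; nia.
- by [].
- by [].
- by st_num ltac:(rewrite ?eC ?eUC).
Qed.

Definition check_loop : bool -> frag bool :=
  eachS rD (fun (f : bool) d => if d == aO then rpush rL d ;; fret f
    else c <~ test ;; rpush rL d ;; fret (f && c)).
Definition check : frag bool :=
  copy rD rX rT ;; c0 <~ contains ;; clear rX ;; f <~ check_loop true ;;
  move rL rD ;; fret (f && ~~ c0).

(** Maximality of O at [v]; [acc] combines it over all vertices with the independence of O. *)
Definition accD (D : seq a3) v := (nth aO D v == aO) || cont Es (set_nth None D v aO).
Definition acc (D : seq a3) := all (accD D) (iota 0 (size D)) && ~~ cont Es D.

Lemma ex_check_loop : forall R L o s f, wf s -> s rD = R -> s rL = L -> size L + size R = n ->
  execn (check_loop f) o s (size R * (200 * A) + 3)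
    (f && all (accD (catrev L R)) (iota (size L) (size R))) o (upd (upd s rL (catrev R L)) rD [::]).
Proof.
elim=> [|d R IH] L o s f w eD eL sz.
  by apply: exec_eq; [exact: ex_eachS_nil | by [] | by rewrite andbT | by [] | st_num ltac:(rewrite ?eL ?eD)].
have H x : set_nth None (catrev L (d :: R)) (size L) x = catrev L (x :: R).
  by rewrite !catrevE -(size_rev L) set_nth_mid.
have Hn : nth aO (catrev L (d :: R)) (size L) = d.
  by rewrite catrevE nth_cat size_rev ltnn subnn.
pose f' := f && accD (catrev L (d :: R)) (size L).
apply: exec_eq.
- apply: (@ex_eachS_cons _ _ _ _ _ _ _ _ _ (150 * A) f' _ (upd (upd s rD R) rL (d :: L))) eD _ _ => //.
    rewrite /f' /accD Hn H; case: (d =P aO) => _.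
      apply: exec_eq.
      - by apply: exec_bind; [exact: ex_push | exact: exec_ret].
      - lia.
      - by rewrite andbT.
      - by [].
      - by st_num ltac:(rewrite ?eL).
    apply: exec_eq.
    - apply: exec_bind; first by apply: ex_test => //=; rewrite eL; move: sz => /=; lia.
      by apply: exec_bind; [exact: ex_push | exact: exec_ret].
    - lia.
    - by rewrite /= eL.
    - by [].
    - by st_num ltac:(rewrite ?eL).
  by apply: (IH (d :: L)) => //; move: sz => /=; lia.
- rewrite [size (_ :: _)]/=; lia.
- by rewrite /= /f' andbA.
- by [].
- by st_num idtac.
Qed.

Lemma ex_check o s : wf s -> s rL = [::] -> size (s rD) = n ->
  execn check o s (500 * A * A) (acc (s rD)) o s.
Proof.
move=> w eL sD; have [E N [eXT eET eT eX]] := w.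
apply: exec_eq.
- apply: exec_bind; first exact: ex_copy.
  apply: exec_bind; first by apply: ex_contains => //=; rewrite eX cats0.
  apply: exec_bind; first exact: ex_clear.
  apply: exec_bind; first by apply: (@ex_check_loop (s rD) [::]).
  by apply: exec_bind; [exact: ex_move | exact: exec_ret].
- rewrite /= eX cats0 catrevE cats0 size_rev sD; nia.
- by rewrite /acc /= eX cats0.
- by [].
- by st_num ltac:(rewrite ?eX ?eL ?catrevE ?cats0 ?revK).
Qed.

Definition emission : frag unit := each rG (fun a => remit (if a == aO then aZ else aO)) ;; remit aS.
(** Statuses and output bits are opposite: [aO] means membership in O, that is, absence from the
    transversal. *)
Definition eo (G : seq a3) : seq sym := [seq if a == aO then Zero else One | a <- G] ++ [:: Sep].

Lemma ex_emission o s : execn emission o s (5 * size (s rG) + 10) tt (o ++ eo (s rG)) (upd s rG [::]).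
Proof.
have H o1 G s1 : s1 rG = G -> execn (each rG (fun a => remit (if a == aO then aZ else aO))) o1 s1
    (5 * size G + 3) tt (o1 ++ [seq if a == aO then Zero else One | a <- G]) (upd s1 rG [::]).
  elim: G o1 s1 => [|a G IH] o1 s1 E.
    by apply: exec_eq; [exact: ex_eachS_nil | by [] | by [] | by rewrite cats0 | st_num ltac:(rewrite ?E)].
  apply: exec_eq.
  - by apply: ex_eachS_cons E _ _ => //; [exact: ex_emit | exact: IH].
  - rewrite /=; lia.
  - by [].
  - by rewrite -cat_rcons; case: ifP.
  - by st_num idtac.
apply: exec_eq.
- by apply: exec_bind; [exact: H | exact: ex_emit].
- lia.
- by [].
- by rewrite /eo catA cats1.
- by [].
Qed.

(** The final statuses are not compared with [G]: when [G] comes from a transversal and all vertices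
    are decided, they coincide with it by [agree_ebits] and [agree_nset]. *)
Definition good (G u Q : seq a3) : bool :=
  let r := runM Es n true G u Q in r.2 && (None \notin r.1.1).

(** The decrement precedes each test, so only orders strictly below the current one are tried; a
    single success is enough to reject. *)
Definition dedupe : frag bool :=
  floop (fun _ : unit => d <~ dec rV rT ;;
    if d then
      (copy rBF rQ rT ;; g <~ run true rV ;; clear rQ ;; clear rD ;;
       if g then clear rV ;; fret (inr false : unit + bool)%type else fret (inl tt : unit + bool)%type)
    else fret (inr true : unit + bool)%type) tt.

Lemma ex_dedupe m : forall u G o s, m = bnum u -> wf s -> cl s -> s rV = u -> s rG = G ->
  s rQ = [::] -> s rD = [::] -> size G <= n -> size u <= A -> size (s rBF) <= A ->
  execn dedupe o s (m.+1 * (1200 * A * A * A)) (~~ has (fun v => good G v (s rBF)) (desc m u)) o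
   (upd s rV [::]).
Proof.
elim: m => [|m IH] u G o s mu w c eV eG eQ eD sG su sB.
  have u0 : u = [::] by case: (u) mu => [|[[]|]].
  have [_ _ [_ _ eT _]] := w.
  apply: exec_eq.
  - apply: exec_loop_exit; apply: exec_bind; first exact: ex_dec.
    by rewrite eV u0; exact: exec_ret.
  - rewrite ?eV ?u0 /=; nia.
  - by [].
  - by [].
  - by st_num ltac:(rewrite ?eV ?u0).
have un : u != [::] by rewrite -bnum_gt0 -mu.
have [_ _ [_ _ eT _]] := w.
have [eC1 [eL eGL]] := c.
have sd := size_decl u.
pose r := runM Es n true G (decl u) (s rBF).
pose s1 := upd (upd s rV (decl u)) rQ (s rBF).
have H : execn (run true rV) o s1 (1000 * A * A * A) (r.2 && (None \notin r.1.1)) o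
    (upd (upd s1 rD r.1.1) rQ r.1.2).
  by apply: (@ex_run true rV G (decl u) o s1) => //; exact: leq_trans sd su.
have AZ : A <= A * A * A by nia.
have sr : size r.1.1 = n := size_runM _ _ _ _ _ _.
have sq : size r.1.2 <= size (s rBF) := size_runMq _ _ _ _ _ _.
have body g t x o2 s2 : g = good G (decl u) (s rBF) ->
  execn (if g then clear rV ;; fret (inr false : unit + bool)%type else fret (inl tt : unit + bool)%type)
     o (upd s rV (decl u)) t x o2 s2 ->
  execn (d <~ dec rV rT ;;
    if d then
      (copy rBF rQ rT ;; g <~ run true rV ;; clear rQ ;; clear rD ;;
       if g then clear rV ;; fret (inr false : unit + bool)%type else fret (inl tt : unit + bool)%type)
    else fret (inr true : unit + bool)%type) o s (1100 * A * A * A + t) x o2 s2.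
  move=> eg Hg; apply: execW; last first.
    apply: exec_bind; first exact: ex_dec.
    rewrite eV un; apply: exec_bind; first exact: ex_copy.
    apply: exec_bind.
      apply: exec_from H => //; st_num ltac:(rewrite ?eQ ?cats0 ?eT).
    apply: exec_bind; first exact: ex_clear.
    apply: exec_bind; first exact: ex_clear.
    rewrite -[r.2 && _]eg.
    apply: exec_from Hg => //; st_num ltac:(rewrite ?eQ ?eD).
  rewrite /= sr eV; lia.
case gE : (good G (decl u) (s rBF)) body => body.
  apply: exec_eq.
  - apply: exec_loop_exit; apply: body erefl _.
    by apply: exec_bind; [exact: ex_clear | exact: exec_ret].
  - rewrite /= (mulSn m.+1) -!mulnA; rewrite -mulnA in AZ; move: (m.+1 * _) AZ; set Z := A * (A * A); lia.
  - by rewrite /= gE.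
  - by [].
  - by st_num idtac.
apply: exec_eq.
- apply: exec_loop_next.
    by apply: body erefl _; exact: exec_ret.
  apply: (IH (decl u) G) => //; rewrite ?bnum_decl -?mu //.
  exact: leq_trans sd su.
- rewrite (mulSn m.+1) -!mulnA; rewrite -mulnA in AZ; move: (m.+1 * _) AZ; set Z := A * (A * A); lia.
- by rewrite /= gE.
- by [].
- by st_num idtac.
Qed.

(** The test [x == None] requires the advice to be used up; otherwise every extension of a
    successful advice string would produce the same set again. *)
Definition body_u : frag unit :=
  copy rW rQ rT ;; ok <~ run false rU ;; x <~ rpop rQ ;; clear rQ ;;
  if ok && (x == None) then
    (a <~ check ;;
     if a then
       (copy rD rG rT ;; clear rD ;; copy rU rV rT ;; r <~ dedupe ;;
        if r then emission else clear rG)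
     else clear rD)
  else clear rD.

Definition em (Q w u : seq a3) : seq sym :=
  let r := runM Es n false [::] u w in
  if [&& r.2, None \notin r.1.1, r.1.2 == [::], acc r.1.1 &
         ~~ has (fun v => good r.1.1 v Q) (desc (bnum u) u)] then eo r.1.1 else [::].

Definition clean (s : regs) :=
  [/\ wf s, cl s, s rV = [::] & [/\ s rD = [::], s rG = [::] & s rQ = [::]]].

Lemma ex_body_u o s : clean s -> size (s rW) <= A -> size (s rU) <= A -> size (s rBF) <= A ->
  execn body_u o s ((bnum (s rU)).+3 * (3000 * A * A * A)) tt (o ++ em (s rBF) (s rW) (s rU)) s.
Proof.
move=> [w c eV [eD eG eQ]] sW sU sB.
have [_ _ [eXT eET eT eX]] := w; have [_ [eL eGL]] := c.
pose r := runM Es n false [::] (s rU) (s rW).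
have AZ : A <= A * A * A by nia.
have AZ2 : A * A <= A * A * A by nia.
have sr : size r.1.1 = n := size_runM _ _ _ _ _ _.
have sq : size r.1.2 <= size (s rW) := size_runMq _ _ _ _ _ _.
pose s1 := upd s rQ (s rW).
have H : execn (run false rU) o s1 (1000 * A * A * A) (r.2 && (None \notin r.1.1)) o
    (upd (upd s1 rD r.1.1) rQ r.1.2).
  by apply: (@ex_run false rU [::] (s rU) o s1).
pose s2 := upd s rD r.1.1.
pose ok := [&& r.2, None \notin r.1.1 & r.1.2 == [::]].
suff [t le T] : exists2 t, t <= (bnum (s rU)).+2 * (2500 * A * A * A) &
   execn (if ok then
    (a <~ check ;;
     if a then
       (copy rD rG rT ;; clear rD ;; copy rU rV rT ;; r <~ dedupe ;;
        if r then emission else clear rG)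
     else clear rD)
  else clear rD) o s2 t tt (o ++ em (s rBF) (s rW) (s rU)) s.
  apply: execW; last first.
    apply: exec_bind; first exact: ex_copy.
    apply: exec_bind.
      apply: exec_from H => //; st_num ltac:(rewrite ?eQ ?cats0 ?eT).
    apply: exec_bind; first exact: ex_pop.
    apply: exec_bind; first exact: ex_clear.
    have -> : r.2 && (None \notin r.1.1) && (ohead (upd (upd s1 rD r.1.1) rQ r.1.2 rQ) == None) = ok.
      by rewrite /ok -andbA /=; case: (r.1.2).
    by apply: exec_from T => //; rewrite /s2 /s1; st_num ltac:(rewrite ?eQ).
  rewrite /= size_behead.
  have : (bnum (s 5)).+3 * (3000 * A * A * A) =
    (bnum (s 5)).+2 * (2500 * A * A * A) + (bnum (s 5)).+2 * (500 * A * A * A) + 3000 * A * A * A by lia.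
  by move: (_.+2 * (500 * _ * _ * _)) => ?; lia.
rewrite /em -/r.
have cD x : execn (clear rD) x s2 (4 * A + 3) tt (x ++ [::]) s.
  apply: exec_eq; [exact: ex_clear | | by [] | by rewrite cats0 | by rewrite /s2; st_num ltac:(rewrite ?eD)].
  by rewrite /= sr; lia.
have Zp : (bnum (s 5)).+2 * (2500 * A * A * A) = (bnum (s 5)).+1 * (2500 * A * A * A) + 2500 * A * A * A by lia.
have -> : [&& r.2, None \notin r.1.1, r.1.2 == [::], acc r.1.1 &
         ~~ has (fun v => good r.1.1 v (s rBF)) (desc (bnum (s rU)) (s rU))] =
  ok && (acc r.1.1 && ~~ has (fun v => good r.1.1 v (s rBF)) (desc (bnum (s rU)) (s rU))).
  by rewrite /ok -!andbA.
case okE : ok; last first.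
  by exists (4 * A + 3); [rewrite Zp; lia | exact: cD].
rewrite andTb.
have HC : execn check o s2 (500 * A * A) (acc r.1.1) o s2 by apply: ex_check.
case aE : (acc r.1.1) HC => HC; last first.
  exists (500 * A * A + (4 * A + 3).+1); first by rewrite Zp; lia.
  by apply: exec_bind HC _; exact: cD.
rewrite andTb.
pose s3 := upd (upd s rG r.1.1) rV (s rU).
have HD : execn dedupe o s3 ((bnum (s rU)).+1 * (1200 * A * A * A))
    (~~ has (fun v => good r.1.1 v (s rBF)) (desc (bnum (s rU)) (s rU))) o (upd s rG r.1.1).
  apply: exec_eq; first apply: (@ex_dedupe (bnum (s rU)) (s rU) r.1.1 o s3) => //; first by rewrite sr.
  - by [].
  - by [].
  - by [].
  - by rewrite /s3; st_num ltac:(rewrite ?eV).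
eexists; last first.
  apply: exec_bind HC _.
  apply: exec_bind; first by apply: ex_copy => //; exact: eT.
  apply: exec_bind; first exact: ex_clear.
  apply: exec_bind; first by apply: ex_copy => //; exact: eT.
  apply: (@exec_bind _ _ _ _ _ _ _ _ _ _ _ (5 * A + 10)).
    by apply: exec_from HD => //; rewrite /s3 /s2; st_num ltac:(rewrite ?eG ?eV ?eD ?cats0).
  case: (~~ has _ _).
    apply: exec_eq; [exact: ex_emission | | by [] | by [] | by st_num ltac:(rewrite ?eG)].
    by rewrite /= sr; lia.
  rewrite cats0; apply: exec_eq; [exact: ex_clear | | by [] | by [] | by st_num ltac:(rewrite ?eG)].
  by rewrite /= sr; lia.
rewrite /= sr Zp.
have : (bnum (s 5)).+1 * (2500 * A * A * A) =
    (bnum (s 5)).+1 * (1200 * A * A * A) + (bnum (s 5)).+1 * (1300 * A * A * A) by lia.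
by move: (_.+1 * (1300 * _ * _ * _)) => ?; rewrite /s2 /=; lia.
Qed.

Definition loop_u : frag unit :=
  floop (fun _ : unit => body_u ;; d <~ dec rU rT ;;
    fret (if d then inl tt else inr tt : unit + unit)%type) tt.
Definition body_w : frag unit := copy rSB rU rT ;; loop_u.

(** A depth-first walk with [rW] as the current node and [rBW] as the budget left there. Going back
    pops the last letter and refunds its price; after [aZ] the sibling [aO] is tried, after [aO] the
    walk continues upwards. *)
Definition enumB (fwd : bool) : frag (bool + unit)%type :=
  if fwd then
    (body_w ;; b <~ trypay 4 rBW ;;
     if b then rpush rW aZ ;; fret (inl true : bool + unit)%type
     else fret (inl false : bool + unit)%type)
  else
    x <~ rpop rW ;;
    if x is Some a then
      (pushn (if a == aO then 5 else 4) rBW aO ;;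
       if a == aO then fret (inl false : bool + unit)%type else
       (b <~ trypay 5 rBW ;;
        if b then rpush rW aO ;; fret (inl true : bool + unit)%type
        else fret (inl false : bool + unit)%type))
    else fret (inr tt : bool + unit)%type.
Definition enum_prog : frag unit := floop enumB true.

Lemma ex_loop_u m V : forall u o s, m = bnum u -> m <= V -> clean s -> s rU = u ->
  size (s rW) <= A -> size u <= A -> size (s rBF) <= A ->
  execn loop_u o s (m.+1 * (V.+3 * (4000 * A * A * A))) tt
    (o ++ flatten [seq em (s rBF) (s rW) v | v <- u :: desc m u]) (upd s rU [::]).
Proof.
elim: m => [|m IH] u o s mu mV c eU sW sU sB.
  have u0 : u = [::] by case: (u) mu => [|[[]|]].
  have [[_ _ [_ _ eT _]] _ _ _] := c.
  apply: exec_eq.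
  - apply: exec_loop_exit; apply: exec_bind; first by apply: ex_body_u => //; rewrite eU.
    apply: exec_bind; first exact: ex_dec.
    by rewrite eU u0; exact: exec_ret.
  - rewrite eU u0 [bnum _]/= [size _]/= mul1n.
    set Z := A * A * A; have Z0 : 0 < Z by rewrite /Z; nia.
    rewrite -!mulnA !(mulnA A) -/Z; nia.
  - by [].
  - by rewrite /= cats0 ?eU ?u0.
  - by st_num ltac:(rewrite ?eU ?u0).
have un : u != [::] by rewrite -bnum_gt0 -mu.
have [[_ _ [_ _ eT _]] _ _ _] := c.
have sd := size_decl u.
apply: exec_eq.
- apply: exec_loop_next.
    apply: exec_bind; first by apply: ex_body_u => //; rewrite eU.
    apply: exec_bind; first exact: ex_dec.
    by rewrite eU un; exact: exec_ret.
  apply: (IH (decl u)) => //; rewrite ?bnum_decl -?mu //; first exact: ltnW.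
  exact: leq_trans sd sU.
- rewrite eU -mu (mulSn m.+1) [X in _ <= X]addnC.
  set Q := m.+1 * _.
  suff : m.+4 * (3000 * A * A * A) + 20 * size u + 20 <= V.+3 * (4000 * A * A * A) by lia.
  have AZ : A <= A * A * A by nia.
  move: AZ; rewrite -!mulnA !(mulnA A); set Z := A * A * A => AZ; nia.
- by [].
- by rewrite -catA ?eU /= ?eU.
- by st_num idtac.
Qed.

Lemma ex_body_w V o s : clean s -> s rU = [::] -> bnum (s rSB) <= V ->
  size (s rW) <= A -> size (s rSB) <= A -> size (s rBF) <= A ->
  execn body_w o s (V.+1 * (V.+3 * (5000 * A * A * A))) tt
    (o ++ flatten [seq em (s rBF) (s rW) v | v <- s rSB :: desc (bnum (s rSB)) (s rSB)]) s.
Proof.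
move=> c eU mV sW sS sB.
have [w c1 eV [eD eG eQ]] := c.
have [_ _ [_ _ eT _]] := w.
apply: exec_eq.
- apply: exec_bind; first exact: ex_copy.
  by apply: (@ex_loop_u (bnum (s rSB)) V (s rSB)) => //=; rewrite eU cats0.
- have AZ : A <= A * A * A by nia.
  have le : (bnum (s rSB)).+1 * (V.+3 * (4000 * A * A * A)) <= V.+1 * (V.+3 * (4000 * A * A * A)).
    by rewrite leq_mul2r ltnS mV orbT.
  have -> : V.+1 * (V.+3 * (5000 * A * A * A)) =
     V.+1 * (V.+3 * (4000 * A * A * A)) + V.+1 * (V.+3 * (1000 * A * A * A)) by lia.
  have : 1000 * A * A * A <= V.+1 * (V.+3 * (1000 * A * A * A)) by nia.
  move: (V.+1 * (V.+3 * (1000 * A * A * A))) (V.+1 * (V.+3 * (4000 * A * A * A))) le => X Y; lia.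
- by [].
- by [].
- by st_num ltac:(rewrite ?eU ?cats0).
Qed.
End Specs.

(** * Depth-first traversal of the advice strings *)

Section Enum.
Variables (Es : seq (seq bool)) (n A V : nat) (s : regs).
Hypotheses (nA : n <= A) (EA : size (encE Es) <= A) (A0 : 0 < A).
Hypothesis sEs : all (fun e => size e == n) Es.
Hypotheses (cs : clean Es n s) (eU : s rU = [::]) (leV : bnum (s rSB) <= V)
  (sSB : size (s rSB) <= A) (sBF : size (s rBF) <= A).

Definition outW Q SB w := flatten [seq em Es n Q w v | v <- SB :: desc (bnum SB) SB].
Let out := outW (s rBF) (s rSB).
Definition stW w b : regs := upd (upd s rW w) rBW (nseq b aO).
(** Bounds the stack operations in one round of [enumB]; [iW] converts this into machine steps by
    the estimate in [exec], including the handover to the next round. *)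
Definition tW := V.+1 * (V.+3 * (5000 * A * A * A)) + 100.
Definition iW := (20 * tW * (szst nreg s + A + tW)).+1.

Lemma sz_stW w b : size w + b <= A -> szst nreg (stW w b) <= szst nreg s + A.
Proof.
move=> le; have := szst_upd s w (isT : rW < nreg).
have := szst_upd (upd s rW w) (nseq b aO) (isT : rBW < nreg).
rewrite size_nseq /stW; lia.
Qed.

Lemma iterW f o w b x o' s' t :
  size w + b <= A -> t <= tW -> execn (enumB f) o (stW w b) t x o' s' ->
  runsT (enumB f) o (stW w b) iW.-1 x o' s'.
Proof.
move=> le tl H; apply: runsTW (ex_runsT H); rewrite /iW /=.
have := sz_stW le; nia.
Qed.

Lemma body_stW o w b : size w + b <= A ->
  execn body_w o (stW w b) (tW - 100) tt (o ++ out w) (stW w b).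
Proof.
move=> le; have [w0 c1 eV [eD eG eQ]] := cs.
apply: execW; last by apply: (@ex_body_w Es n A nA EA A0 sEs V) => //; rewrite /stW /=; lia.
by rewrite /tW addnK.
Qed.

Lemma fwd_yes o w b : 4 <= b -> size w + b <= A ->
  runsT (enumB true) o (stW w b) iW.-1 (inl true) (o ++ out w) (stW (aZ :: w) (b - 4)).
Proof.
move=> b4 le; apply: (iterW le (leqnn _)); apply: exec_eq.
- apply: exec_bind; first exact: body_stW.
  apply: exec_bind; first exact: ex_trypay.
  rewrite /= size_nseq b4; apply: exec_bind; [exact: ex_push | exact: exec_ret].
- have : 100 <= tW by rewrite /tW; lia.
  lia.
- by [].
- by [].
- by rewrite /stW; st_num ltac:(rewrite ?drop_nseq).
Qed.

Lemma fwd_no o w b : b < 4 -> size w + b <= A ->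
  runsT (enumB true) o (stW w b) iW.-1 (inl false) (o ++ out w) (stW w b).
Proof.
move=> b4 le; apply: (iterW le (leqnn _)); apply: exec_eq.
- apply: exec_bind; first exact: body_stW.
  apply: exec_bind; first exact: ex_trypay.
  rewrite /= size_nseq leqNgt b4; exact: exec_ret.
- have : 100 <= tW by rewrite /tW; lia.
  lia.
- by [].
- by [].
- by [].
Qed.

Lemma back_Z o w b : 4 <= b -> (size w).+1 + (b - 4) <= A ->
  runsT (enumB false) o (stW (aZ :: w) (b - 4)) iW.-1 (inl (4 < b)) o
    (if 4 < b then stW (aO :: w) (b - 5) else stW w b).
Proof.
move=> b4 le; apply: (@iterW false o (aZ :: w) (b - 4) _ _ _ 100) => //; first by rewrite /tW; lia.
have E : nseq 4 aO ++ nseq (b - 4) aO = nseq b aO by rewrite -nseqD; congr nseq; lia.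
have H : execn (b <~ trypay 5 rBW ;;
        if b then rpush rW aO ;; fret (inl true : bool + unit)%type
        else fret (inl false : bool + unit)%type) o (stW w b) 40 (inl (4 < b)) o
    (if 4 < b then stW (aO :: w) (b - 5) else stW w b).
  case: (ltnP 4 b) => b5; apply: exec_eq.
  - apply: exec_bind; first exact: ex_trypay.
    rewrite /= size_nseq b5; apply: exec_bind; [exact: ex_push | exact: exec_ret].
  - by [].
  - by [].
  - by [].
  - by rewrite /stW; st_num ltac:(rewrite ?drop_nseq).
  - apply: exec_bind; first exact: ex_trypay.
    rewrite /= size_nseq leqNgt ltnS b5; exact: exec_ret.
  - by [].
  - by [].
  - by [].
  - by [].
apply: execW; last first.
  apply: exec_bind; first exact: ex_pop.
  apply: exec_bind; first exact: ex_pushn.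
  by apply: exec_from H => //; rewrite /stW; st_num ltac:(rewrite ?E).
by [].
Qed.

Lemma back_O o w b : 5 <= b -> (size w).+1 + (b - 5) <= A ->
  runsT (enumB false) o (stW (aO :: w) (b - 5)) iW.-1 (inl false) o (stW w b).
Proof.
move=> b5 le; apply: (@iterW false o (aO :: w) (b - 5) _ _ _ 100) => //; first by rewrite /tW; lia.
have E : nseq 5 aO ++ nseq (b - 5) aO = nseq b aO by rewrite -nseqD; congr nseq; lia.
apply: exec_eq.
- apply: exec_bind; first exact: ex_pop.
  apply: exec_bind; [exact: ex_pushn | exact: exec_ret].
- by [].
- by [].
- by [].
- by rewrite /stW; st_num ltac:(rewrite ?E).
Qed.

Lemma back_nil o b : b <= A -> runsT (enumB false) o (stW [::] b) iW.-1 (inr tt) o (stW [::] b).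
Proof.
move=> le; apply: (@iterW false o [::] b _ _ _ 100) => //; first by rewrite /tW; lia.
apply: exec_eq.
- by apply: exec_bind; [exact: ex_pop | exact: exec_ret].
- by [].
- by [].
- by [].
- by rewrite /stW; st_num idtac.
Qed.

(** Every node of the subtree is entered once forwards and left once backwards, except that leaving
    the root belongs to the continuation; hence [(2 * size _).-1] rounds. *)
Lemma enum_run f : forall b w o T y o2 s2, b < f -> size w + b <= A ->
  runsT (floop enumB false) (o ++ flatten [seq out x | x <- enumW f b w]) (stW w b) T y o2 s2 ->
  runsT (floop enumB true) o (stW w b) (T + (2 * size (enumW f b w)).-1 * iW) y o2 s2.
Proof.
elim: f => // f IH b w o T y o2 s2 bf le.
have -> : enumW f.+1 b w = w :: (if 4 <= b then enumW f (b - 4) (aZ :: w) ++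
  (if 5 <= b then enumW f (b - 5) (aO :: w) else [::]) else [::]) by [].
case: (leqP 4 b) => b4 H; last first.
  apply: runsTW; last first.
    apply: runsT_loop_next; first exact: fwd_no.
    by apply: runsT_from H => //=; rewrite ?cats0.
  by rewrite /= /iW; lia.
have leZ : (size w).+1 + (b - 4) <= A by lia.
have HZ := back_Z _ b4 leZ.
case: (ltnP 4 b) HZ H => b5 HZ H; last first.
  apply: runsTW; last first.
    apply: runsT_loop_next; first exact: fwd_yes.
    apply: (IH (b - 4) (aZ :: w)) => //; first lia.
    apply: runsT_loop_next; first exact: HZ.
    by apply: runsT_from H => //=; rewrite cats0 -catA.
  rewrite cats0 [size (_ :: _)]/=; have : 0 < size (enumW f (b - 4) (aZ :: w)) by case: (f) bf => //; lia.
  move: (size _) => m m0; have -> : (2 * m.+1).-1 = (2 * m).-1 + 2 by lia.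
  rewrite mulnDl; move: (_ * iW) => X; rewrite /iW; lia.
have leO : (size w).+1 + (b - 5) <= A by lia.
apply: runsTW; last first.
  apply: runsT_loop_next; first exact: fwd_yes.
  apply: (IH (b - 4) (aZ :: w)) => //; first lia.
  apply: runsT_loop_next; first exact: HZ.
  apply: (IH (b - 5) (aO :: w)) => //; first lia.
  apply: runsT_loop_next; first exact: back_O.
  by apply: runsT_from H => //=; rewrite map_cat flatten_cat -!catA.
rewrite [size (_ :: _)]/= size_cat.
have : 0 < size (enumW f (b - 4) (aZ :: w)) by case: (f) bf => //; lia.
have : 0 < size (enumW f (b - 5) (aO :: w)) by case: (f) bf => //; lia.
move: (size _) (size _) => m1 m2 h1 h2.
have -> : (2 * (m1 + m2).+1).-1 = (2 * m2).-1 + (2 * m1).-1 + 3 by lia.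
rewrite !mulnDl; move: ((2 * m2).-1 * iW) ((2 * m1).-1 * iW) => X Y; rewrite /iW; lia.
Qed.

Lemma runs_enum o b : b <= A ->
  runsT enum_prog o (stW [::] b) (2 * size (enumW b.+1 b [::]) * iW) tt
    (o ++ flatten [seq out x | x <- enumW b.+1 b [::]]) (stW [::] b).
Proof.
move=> le; apply: runsTW; last first.
  apply: (@enum_run b.+1 b [::]) => //.
  by apply: runsT_loop_exit; apply: back_nil.
by rewrite -[2 * _]prednK ?mulSn // muln_gt0.
Qed.
End Enum.

(** * Reading the input and the complete program *)

Definition parse : frag unit :=
  floop (fun _ : unit => x <~ rpop rE ;;
    match x with
    | Some (Some true) => rpush rN aO ;; fret (inl tt : unit + unit)%type
    | _ => fret (inr tt : unit + unit)%type
    end) tt.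
Definition divide q : frag unit :=
  floop (fun _ : unit => b <~ trypay q rQ ;;
    if b then rpush rSB aS ;; fret (inl tt : unit + unit)%type
    else fret (inr tt : unit + unit)%type) tt.
Definition init1 c0 : frag unit :=
  parse ;; copy rN rBF rT ;; copy rN rBF rT ;; copy rN rBF rT ;; copy rN rBF rT ;; pushn c0 rBF aO.
Definition init2 q : frag unit :=
  copy rBF rBW rT ;; copy rN rQ rT ;; divide q ;; clear rQ ;; pushn 2 rSB aS.
Definition init c0 q : frag unit := init1 c0 ;; init2 q.

Lemma ex_parse m rest o s : s rE = nseq m aO ++ None :: rest ->
  execn parse o s (5 * m + 3) tt o (upd (upd s rE rest) rN (nseq m aO ++ s rN)).
Proof.
elim: m s => [|m IH] s E.
  apply: exec_eq.
  - apply: exec_loop_exit; apply: exec_bind; first exact: ex_pop.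
    by rewrite E; exact: exec_ret.
  - by [].
  - by [].
  - by [].
  - by st_num ltac:(rewrite ?E).
apply: exec_eq.
- apply: exec_loop_next; last by apply: (IH (upd (upd s rE (nseq m aO ++ None :: rest)) rN (aO :: s rN))).
  apply: exec_bind; first exact: ex_pop.
  by rewrite E; apply: exec_bind; [exact: ex_push | exact: exec_ret].
- lia.
- by [].
- by [].
- by st_num ltac:(try by elim: (m) => //= ? ->).
Qed.

Lemma ex_divide q m : forall o s, 0 < q -> s rQ = nseq m aO ->
  execn (divide q) o s ((m %/ q).+1 * (5 * q + 10)) tt o
    (upd (upd s rQ (nseq (m %% q) aO)) rSB (nseq (m %/ q) aS ++ s rSB)).
Proof.
have [k le] := ubnP m; elim: k m le => // k IH m le o s q0 E.
case: (leqP q m) => qm; last first.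
  rewrite divn_small // modn_small //; apply: exec_eq.
  - apply: exec_loop_exit; apply: exec_bind; first exact: ex_trypay.
    rewrite E size_nseq leqNgt qm; exact: exec_ret.
  - lia.
  - by [].
  - by [].
  - by st_num ltac:(rewrite ?E).
have dE : m %/ q = ((m - q) %/ q).+1.
  by rewrite -{1}(subnK qm) divnDr ?dvdnn // divnn q0 addn1.
have mE : m %% q = (m - q) %% q by rewrite -{1}(subnK qm) modnDr.
rewrite dE mE; apply: exec_eq.
- apply: exec_loop_next.
    apply: exec_bind; first exact: ex_trypay.
    rewrite E size_nseq qm; apply: exec_bind; [exact: ex_push | exact: exec_ret].
  by apply: (IH (m - q)); rewrite ?drop_nseq //; lia.
- lia.
- by [].
- by [].
- by st_num ltac:(try by elim: (_ %/ _) => //= ? ->).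
Qed.

Definition sI n c0 q Es : regs :=
  upd (upd (upd (upd (upd (fun _ => [::]) rN (nseq n aO)) rE (encE Es)) rBF (nseq (4 * n + c0) aO))
    rBW (nseq (4 * n + c0) aO)) rSB (nseq (n %/ q).+2 aS).

Definition inp n Es : seq a3 := nseq n aO ++ None :: encE Es.

Definition sI1 n c0 Es : regs :=
  upd (upd (upd (fun _ => [::]) rN (nseq n aO)) rE (encE Es)) rBF (nseq (4 * n + c0) aO).

Lemma ex_init1 n c0 Es o :
  execn (init1 c0) o (regs0 nreg (inp n Es)) (100 * (n + c0).+1) tt o (sI1 n c0 Es).
Proof.
have E4 : nseq c0 aO ++ nseq n aO ++ nseq n aO ++ nseq n aO ++ nseq n aO ++ [::] = nseq (4 * n + c0) aO.
  by rewrite cats0 -!nseqD; congr nseq; lia.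
apply: exec_eq.
- apply: exec_bind; first exact: (@ex_parse n (encE Es)).
  apply: exec_bind; first exact: ex_copy.
  apply: exec_bind; first exact: ex_copy.
  apply: exec_bind; first exact: ex_copy.
  apply: exec_bind; first exact: ex_copy.
  exact: ex_pushn.
- rewrite /= !cats0 !size_nseq; lia.
- by [].
- by [].
- by rewrite /sI1; st_num ltac:(rewrite ?cats0 -?nseqD; try (congr nseq; lia)).
Qed.

Lemma ex_init2 n c0 q Es o : 0 < q ->
  execn (init2 q) o (sI1 n c0 Es) (100 * (n + c0 + q).+1 * n.+1) tt o (sI n c0 q Es).
Proof.
move=> q0; apply: exec_eq.
- apply: exec_bind; first exact: ex_copy.
  apply: exec_bind; first exact: ex_copy.
  apply: exec_bind; first by apply: (@ex_divide q n) => //=; rewrite !cats0.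
  apply: exec_bind; first exact: ex_clear.
  exact: ex_pushn.
- rewrite /= !size_nseq.
  have := leq_div n q; have : n %% q <= n by rewrite leq_mod.
  move: (n %/ q) (n %% q) => d m h1 h2.
  have : d.+1 * (5 * q + 10) <= n.+1 * (5 * q + 10) by rewrite leq_mul2r ltnS h2 orbT.
  nia.
- by [].
- by [].
- by rewrite /sI /sI1; st_num ltac:(rewrite ?cats0).
Qed.

Lemma ex_init n c0 q Es o : 0 < q ->
  execn (init c0 q) o (regs0 nreg (inp n Es)) (300 * (n + c0 + q).+1 * n.+1) tt o (sI n c0 q Es).
Proof.
move=> q0; apply: execW; last by apply: exec_bind; [exact: ex_init1 | exact: ex_init2].
nia.
Qed.

Definition prog c0 q : frag unit := boot nreg ;; init c0 q ;; enum_prog ;; ers nreg.+1.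

Lemma szst_regs0 w : szst nreg (regs0 nreg w) = size w + nreg.
Proof. by rewrite /szst /zl /regs0 /zones /= cats0 size_zone; lia. Qed.

(** [A] bounds the data and [V] the orders. The factor [V.+3 * V.+3] arises because for each order
    all smaller ones may be replayed against duplicates; the outer square is the price of simulating
    stacks on one tape. *)
Lemma prog_runs c0 q : 0 < q -> exists K, forall Es n A V b,
  n <= A -> size (encE Es) <= A -> 0 < A -> all (fun e => size e == n) Es ->
  4 * n + c0 <= A -> (n %/ q).+2 <= A -> q <= A -> bnum (nseq (n %/ q).+2 aS) <= V -> b = 4 * n + c0 ->
  exists l r b', 
  runs (prog c0 q) [::] (map sy (inp n Es))
    (size (enumW b.+1 b [::]) * (K * (A * A * A * (V.+3 * V.+3)) ^ 2)) tt l r /\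
  rev l ++ r = flatten [seq outW Es n (nseq b aO) (nseq (n %/ q).+2 aS) w | w <- enumW b.+1 b [::]] ++ nseq b' Blank.
Proof.
move=> q0; exists (100 * 100 * 100 * 100 * 100) => Es n A V b nA EA A0 sEs bA dA qA sV bE.
have [b0 R0] := runs_boot (inp n Es) (isT : 0 < nreg).
have [sz1 /(_ b0) [b1 R1]] := ex_init n c0 Es [::] q0.
pose s := sI n c0 q Es.
have cs : clean Es n s by [].
have sSB : size (s rSB) <= A by rewrite /s /= size_nseq.
have sBF : size (s rBF) <= A by rewrite /s /= size_nseq.
have HE := @runs_enum Es n A V s nA EA A0 sEs cs erefl sV sSB sBF [::] b.
rewrite bE in HE; have {}HE := HE bA.
have Es1 : stW s [::] (4 * n + c0) = s.
  by apply: functional_extensionality; rewrite /stW /s /sI; st_num idtac.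
rewrite Es1 in HE; have [b2 R2] := HE b1.
set out := [::] ++ _ in R2.
have [b3 [b4 R3]] := runs_erase nreg s out b2.
exists (nseq b3 Blank ++ rev out), (nseq b4 Blank), (b3 + b4); split; last first.
  rewrite rev_cat revK rev_nseq -catA -nseqD bE; congr (_ ++ _).
apply: runsW; last first.
  apply: runs_bind; first exact: R0.
  apply: runs_bind; first exact: R1.
  apply: runs_bind; first exact: R2.
  exact: R3.
rewrite -bE.
have : 0 < size (enumW b.+1 b [::]) by [].
move: (size (enumW _ _ _)) => N.
move: sz1; rewrite szst_regs0 /iW /tW -/s /inp size_cat /= size_nseq.
move: (szst nreg s) (size (encE Es)) EA => S e EA hS hN.
set t0 := 300 * _ * _ in hS *.
have c0A : n + c0 <= A by lia.
set Z := A * A * A * _.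
have Z1 : A * A <= Z by rewrite /Z; nia.
have Z0 : A <= A * A by nia.
have ht0 : t0 <= 20 * 100 * (A * A).
  apply: leq_trans (_ : 300 * (3 * A) * (2 * A) <= _); last by lia.
  by rewrite /t0; apply: leq_mul; [apply: leq_mul => //; lia | lia].
set tw := V.+1 * _ + 100.
have htw : tw <= 60 * 100 * Z.
  have : V.+1 * (V.+3 * (5000 * A * A * A)) <= V.+3 * (V.+3 * (5000 * A * A * A)).
    by rewrite leq_mul2r; lia.
  have -> : V.+3 * (V.+3 * (5000 * A * A * A)) = 50 * 100 * Z by rewrite /Z; lia.
  rewrite /tw; lia.
have H1 : tw * (S + A + tw) <= (60 * 100 * Z) * (100 * 100 * Z) by apply: leq_mul; lia.
have H2 : t0 * (n + (e).+1 + 21 + t0) <= (20 * 100 * Z) * (30 * 100 * Z) by apply: leq_mul; lia.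
have Zp : 0 < Z by lia.
have ZZ : Z <= Z * Z by rewrite leq_pmull.
have NZ : Z * Z <= N * (Z * Z) by rewrite leq_pmull.
have H3 : 2 * N * (20 * tw * (S + A + tw)).+1 <= 2 * N * (20 * (60 * 100 * Z * (100 * 100 * Z))).+1.
  by rewrite leq_mul2l ltnS -mulnA leq_mul2l H1 !orbT.
apply: leq_trans (_ : 440 * (30 * Z) + (20 * (20 * 100 * Z * (30 * 100 * Z)) + (2 * N * (20 * (60 * 100 * Z * (100 * 100 * Z))).+1 + (100 * 100 * Z))) <= _).
  have : 20 * 22 * (n + e.+1 + 21).+1 <= 440 * (30 * Z) by lia.
  rewrite -(mulnA 20 t0); lia.
have -> : 440 * (30 * Z) + (20 * (20 * 100 * Z * (30 * 100 * Z)) + (2 * N * (20 * (60 * 100 * Z * (100 * 100 * Z))).+1 + (100 * 100 * Z))) =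
  (440 * 30 + 100 * 100) * Z + 20 * 20 * 100 * 30 * 100 * (Z * Z) + (2 * 20 * 60 * 100 * 100 * 100) * (N * (Z * Z)) + 2 * N by lia.
have : N <= N * (Z * Z) by rewrite leq_pmulr // muln_gt0 Zp.
have -> : N * (100 * 100 * 100 * 100 * 100 * Z ^ 2) = 100 * 100 * 100 * 100 * 100 * (N * (Z * Z)) by rewrite expnS expn1; lia.
move: (N * (Z * Z)) (Z * Z) NZ ZZ => X Y; lia.
Qed.

(** * Correctness of the encoding *)

Fixpoint wcost (w : seq a3) := if w is a :: w' then (if a == aO then 5 else 4) + wcost w' else 0.

Lemma wcost_cat w1 w2 : wcost (w1 ++ w2) = wcost w1 + wcost w2.
Proof. by elim: w1 => //= a w ->; rewrite addnA. Qed.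

(** The encoder: statuses reached and advice letters needed when all answers follow [G]. It is the
    common reference for both modes of [visit]. The letter [aO], of cost 5, sends a vertex to T,
    where its status is [aZ]. *)
Fixpoint ebits Es (G D : seq a3) (vs : seq nat) : seq a3 * seq a3 :=
  if vs is v :: vs' then
    if nth None D v != None then ebits Es G D vs' else
    if cont Es (set_nth None D v aO) then ebits Es G (set_nth None D v aZ) vs' else
    let b := nth aO G v == aZ in
    let r := ebits Es G (set_nth None D v (if b then aZ else aO)) vs' in
    (r.1, (if b then aO else aZ) :: r.2)
  else (D, [::]).

Lemma visitE Es mode G D q ok v : visit Es mode G (D, q, ok) v =
  if nth None D v != None then (D, q, ok) else
  if cont Es (set_nth None D v aO) then (set_nth None D v aZ, q, ok) else
  let: (b, ok', q') := oracleM mode (nth aO G v) q in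
  (set_nth None D v (if b then aZ else aO), q', ok && ok').
Proof. by []. Qed.

(** The single payments all succeed exactly when their total fits into the budget; after a failed
    one the flag stays false. *)
Lemma enc_ebits Es G vs D Q ok :
  let r := foldl (visit Es true G) (D, Q, ok) vs in
  let e := ebits Es G D vs in
  r.1.1 = e.1 /\ r.2 = ok && (wcost e.2 <= size Q).
Proof.
elim: vs D Q ok => [|v vs IH] D Q ok /=; first by rewrite leq0n andbT.
rewrite visitE; case: (nth None D v != None); first exact: IH.
case: (cont _ _); first exact: IH.
rewrite /=; set b := _ == aZ; set c := if b then 5 else 4.
have [-> ->] := IH (set_nth None D v (if b then aZ else aO)) (if c <= size Q then drop c Q else Q) (ok && (c <= size Q)).
split=> //; rewrite -andbA; congr (_ && _).
have -> : (if (if b then aO else aZ) == aO then 5 else 4) = c by rewrite /c; case: (b).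
case: leqP => h /=; first by rewrite size_drop; lia.
lia.
Qed.

Lemma dec_ebits Es G vs D q :
  let e := ebits Es G D vs in
  foldl (visit Es false [::]) (D, e.2 ++ q, true) vs = (e.1, q, true).
Proof.
elim: vs D => [|v vs IH] D //=.
rewrite visitE; case: (nth None D v != None); first exact: IH.
case: (cont _ _); first exact: IH.
by rewrite /=; case: (_ == aZ); rewrite /= IH.
Qed.

Lemma visit_keep Es mode G vs D q ok v a :
  nth None D v = Some a -> nth None (foldl (visit Es mode G) (D, q, ok) vs).1.1 v = Some a.
Proof.
elim: vs D q ok => [|x vs IH] D q ok E //=.
rewrite visitE; case: ifP => [_|/negbFE/eqP xn]; first exact: IH.
have ne : v <> x by move=> e; rewrite -e E in xn.
have H b : nth None (set_nth None D x b) v = Some a by rewrite nth_set_nth /=; case: eqP.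
case: ifP => _; first exact: IH.
by case: (oracleM _ _ _) => [[b ok'] q']; apply: IH.
Qed.

(** A status never changes once set, so each letter read fixes the final status of its vertex, which
    is that in [G]. The letter is therefore the one the encoder writes. *)
Lemma dec_sound Es G vs : forall D q D' q', None \notin q ->
  foldl (visit Es false [::]) (D, q, true) vs = (D', q', true) ->
  (forall v a, nth None D' v = Some a -> nth aO G v = Some a) ->
  exists2 bs, ebits Es G D vs = (D', bs) & q = bs ++ q'.
Proof.
elim: vs => [|v vs IH] D q D' q' nq /=; first by case=> -> -> _; exists [::].
rewrite visitE; case: ifP => vn; first exact: IH.
case: ifP => _; first exact: IH.
rewrite /=; case: q nq => [|x q] nq H HG.
  (* Reading from an exhausted advice string spoils the flag for good. *)
  by move: H; rewrite visits_ok /=; case: foldl => [[? ?] ?] [].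
move: nq; rewrite inE negb_or => /andP[xn nq].
have key : nth aO G v = (if x == aO then aZ else aO).
  have := @visit_keep Es false [::] vs (set_nth None D v (if x == aO then aZ else aO)) q true v.
  rewrite H /= nth_set_nth /= eqxx; case: (x == aO) => h; exact: (HG _ _ (h _ erefl)).
have [bs E1 E2] := IH _ _ _ _ nq H HG.
exists (x :: bs); last by rewrite E2.
by rewrite key; case: x xn {nq H key E2} E1 => [[]|] //= _ ->.
Qed.

Lemma mem_enumW f b w x : b < f ->
  reflect (exists y, [/\ x = y ++ w, None \notin y & wcost y <= b]) (x \in enumW f b w).
Proof.
move=> bf; apply: (iffP idP).
- elim: f b w bf => // f IH b w bf /=; rewrite inE => /orP[/eqP ->|]; first by exists [::].
  case: leqP => // b4; rewrite mem_cat => /orP[/IH[|y [-> h1 h2]]|]; first lia.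
    exists (rcons y aZ); rewrite cat_rcons mem_rcons inE negb_or h1; split=> //.
    by rewrite -cats1 wcost_cat /=; lia.
  case: leqP => // b5 /IH[|y [-> h1 h2]]; first lia.
  exists (rcons y aO); rewrite cat_rcons mem_rcons inE negb_or h1; split=> //.
  by rewrite -cats1 wcost_cat /=; lia.
case=> y [-> ]; elim/last_ind: y f b w bf => [|y a IH] [|f] // b w bf; rewrite ?mem_head //.
rewrite mem_rcons inE negb_or cat_rcons -cats1 wcost_cat /= addn0 => /andP[na ny] le.
rewrite inE; apply/orP; right.
have b4 : 3 < b by move: le; case: ifP => _; lia.
rewrite b4 mem_cat; case: a na le => [[]|] // _ /= le.
- have b5 : 4 < b by lia.
  by rewrite b5 IH ?orbT //; lia.
- by rewrite IH //; lia.
Qed.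

(** Words of the two subtrees end in [aZ :: w] and in [aO :: w] respectively, and both are longer
    than [w]. *)
Lemma uniq_enumW f b w : b < f -> uniq (enumW f b w).
Proof.
elim: f b w => // f IH b w bf /=.
have sub a c x : c < f -> x \in enumW f c (a :: w) -> exists y, x = y ++ a :: w.
  by move=> cf /mem_enumW-/(_ cf)[y [-> _ _]]; exists y.
have nw a c : c < f -> w \notin enumW f c (a :: w).
  move=> cf; apply/negP => /sub-/(_ cf)[y /(congr1 size)]; rewrite size_cat /=; lia.
case: leqP => // b4; rewrite mem_cat negb_or nw /=; last lia.
rewrite cat_uniq IH /=; last lia.
case: (leqP 5 b) => b5; last by [].
rewrite nw ?IH; try lia.
rewrite andbT /=; apply/hasPn => x /sub[|y ->]; first lia.
apply/negP => /sub[|z]; first lia.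
elim: y z => [|c y IHy] [|d z] //=.
- by case=> _ /(congr1 size); rewrite size_cat /=; lia.
- by case=> _ /(congr1 size); rewrite size_cat /=; lia.
- by case=> _; apply: IHy.
Qed.

(** Adding one makes the recurrence N(b) = 1 + N(b-4) + N(b-5) homogeneous, and the induction closes
    by (400/467)^4 + (400/467)^5 <= 1. The factor 2 serves budgets below 5, where fewer than two
    letters are affordable. *)
Lemma size_enumW f b w : b < f -> (size (enumW f b w)).+1 * 400 ^ b <= 2 * 467 ^ b.
Proof.
elim: f b w => // f IH b w bf /=.
have p1 c : 400 ^ c <= 467 ^ c by case: c => // c; rewrite leq_exp2r.
case: (leqP 4 b) => b4; last by move: (p1 b) => /=; lia.
have H1 : (size (enumW f (b - 4) (aZ :: w))).+1 * 400 ^ (b - 4) <= 2 * 467 ^ (b - 4) by apply: IH; lia.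
case: (leqP 5 b) => b5; last first.
  have -> : b = 4 by lia.
  rewrite cats0 subnn; case: (f) bf => [|f'] /=; first lia.
  by move=> _; rewrite !expnS expn0; lia.
have H2 : (size (enumW f (b - 5) (aO :: w))).+1 * 400 ^ (b - 5) <= 2 * 467 ^ (b - 5) by apply: IH; lia.
rewrite size_cat; move: (size _) (size _) H1 H2 => m1 m2.
have -> : b - 4 = (b - 5).+1 by lia.
have -> : b = (b - 5).+1.+4 by lia.
have -> : (b - 5).+1.+4 - 5 = b - 5 by lia.
move: (b - 5) => c; rewrite !expnS; move: (400 ^ c) (467 ^ c) => X Y H1 H2.
have -> : (m2 + m1).+2 * (400 * (400 * (400 * (400 * (400 * X))))) =
  400 * 400 * 400 * 400 * (m2.+1 * (400 * X)) + 400 * 400 * 400 * 400 * 400 * (m1.+1 * X) by lia.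
move: (m2.+1 * _) (m1.+1 * _) H1 H2; lia.
Qed.

Lemma visits_lt n u v : v \in visits n u -> v < n.
Proof. by case/flattenP => vs /mapP[c _ ->]; rewrite mem_visf size_pat; lia. Qed.

(** * Vertex sets as status strings *)

Section Sets.
Variables (n : nat) (E : {set {set 'I_n}}).

Definition bl (e : {set 'I_n}) : seq bool := [seq i \in e | i <- enum 'I_n].
Definition Eb := [seq bl e | e <- enum E].
Definition GT (T : {set 'I_n}) : seq a3 := [seq (if i \in T then aZ else aO) | i <- enum 'I_n].
Definition inset (D : seq a3) : {set 'I_n} := [set i : 'I_n | nth aO D i != aO].

Lemma size_Eb : all (fun e => size e == n) Eb.
Proof. by apply/allP => e /mapP[x _ ->]; rewrite size_map size_enum_ord. Qed.

Lemma size_GT T : size (GT T) = n.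
Proof. by rewrite size_map size_enum_ord. Qed.

Lemma nth_GT x T (i : 'I_n) : nth x (GT T) i = if i \in T then aZ else aO.
Proof. by rewrite (nth_map i) ?size_enum_ord // nth_ord_enum. Qed.

Lemma GT_None T : None \notin GT T.
Proof. by apply/mapP => -[i _]; case: ifP. Qed.

Lemma inset_GT T : inset (GT T) = T.
Proof. by apply/setP => i; rewrite inE nth_GT; case: (i \in T). Qed.

Lemma GT_inset D : size D = n -> None \notin D -> GT (inset D) = D.
Proof.
move=> sD nD; apply: (@eq_from_nth _ None); rewrite size_GT // => i lt.
rewrite -[i]/(nat_of_ord (Ordinal lt)) nth_GT inE /=.
rewrite (set_nth_default None) ?sD //.
have : nth None D i \in D by rewrite mem_nth ?sD.
by case: (nth _ _ _) nD => [[]|] // /negP.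
Qed.

Lemma eo_enc D : size D = n -> eo D = enc_set (inset D) ++ [:: Sep].
Proof.
move=> sD; congr (_ ++ _); rewrite /enc_set; apply: (@eq_from_nth _ Blank).
  by rewrite 2!size_map size_enum_ord.
move=> i; rewrite size_map sD => lt; rewrite (nth_map None) ?sD //.
rewrite (nth_map (Ordinal lt)) ?size_enum_ord // -[i]/(nat_of_ord (Ordinal lt)) nth_ord_enum inE /=.
by rewrite (set_nth_default None) ?sD //; case: eqP.
Qed.

Lemma subl_bl e D : size D = n -> subl (bl e) D = [forall i in e, nth None D i == aO].
Proof.
move=> sD; have sb : size (bl e) = n by rewrite size_map size_enum_ord.
apply/(all_nthP (false, None))/forall_inP => H.
  move=> i ie; have := H i; rewrite size_zip sb sD minnn ltn_ord nth_zip ?sb //= => /(_ isT).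
  by rewrite (nth_map i) ?size_enum_ord // nth_ord_enum ie.
move=> i; rewrite size_zip sb sD minnn => lt; rewrite nth_zip ?sb //=.
rewrite (nth_map (Ordinal lt)) ?size_enum_ord // -[i]/(nat_of_ord (Ordinal lt)) nth_ord_enum.
by apply/implyP => /H.
Qed.

Lemma cont_Eb D : size D = n -> cont Eb D = [exists e in E, [forall i in e, nth None D i == aO]].
Proof.
move=> sD; rewrite /cont /Eb has_map; apply/hasP/exists_inP => -[e eE H]; exists e => //.
- by rewrite mem_enum in eE.
- by rewrite -subl_bl.
- by rewrite mem_enum.
- by rewrite /= subl_bl.
Qed.

Lemma cont_GT T : cont Eb (GT T) = ~~ Defs.transversal E T.
Proof.
rewrite cont_Eb ?size_GT // /Defs.transversal negb_forall_in; apply: eq_existsb => e.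
congr (_ && _); rewrite negbK disjoint_subset; apply/forall_inP/subsetP => H i ie.
- by have := H i ie; rewrite nth_GT inE; case: (i \in T).
- by have := H i ie; rewrite nth_GT inE => /negbTE ->.
Qed.

Lemma set_nth_GT T (v : 'I_n) : set_nth None (GT T) v aO = GT (T :\ v).
Proof.
apply: (@eq_from_nth _ None).
  by rewrite size_set_nth !size_GT; have := ltn_ord v; lia.
move=> i; rewrite size_set_nth size_GT => h; have lt : i < n by have := ltn_ord v; lia.
rewrite nth_set_nth /= -[i]/(nat_of_ord (Ordinal lt)) !nth_GT !inE /=.
case: eqP => [e|ne]; first by have -> : Ordinal lt = v by [apply: val_inj]; rewrite eqxx.
by have -> : Ordinal lt != v by apply/eqP => e; apply: ne; rewrite -e.
Qed.

(** Supersets of transversals are transversals, so minimality may be tested by removing single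
    vertices; removing [v] from [T] means giving it the status [aO]. *)
Lemma acc_min T : acc Eb (GT T) = minimal_transversal E T.
Proof.
rewrite /acc cont_GT negbK /minimal_transversal; apply/andP/minsetP.
- case=> /allP H tT; split=> // B tB BT; apply/eqP; rewrite eqEsubset BT /=.
  apply/subsetP => v vT; apply/negPn/negP => vB.
  have := H v; rewrite mem_iota size_GT add0n ltn_ord => /(_ isT).
  rewrite /accD nth_GT vT /= set_nth_GT cont_GT => /negP; apply.
  apply/forall_inP => e eE; move/forall_inP: tB => /(_ e eE).
  apply: contra; rewrite !disjoint_subset => /subsetP S; apply/subsetP => i ie.
  rewrite inE; apply/negP => iB; have := S i ie; rewrite !inE (subsetP BT) //.
  by case: eqP iB vB => [->|_] //= ->.
- case=> tT H; split=> //; apply/allP => v; rewrite mem_iota size_GT add0n /= => lt.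
  rewrite -[v]/(nat_of_ord (Ordinal lt)) /accD nth_GT set_nth_GT cont_GT.
  case: ifP => // vT; apply/orP; right; apply/negP => tB.
  have := H _ tB (subD1set _ _) => /setP/(_ (Ordinal lt)).
  by rewrite !inE eqxx vT.
Qed.

End Sets.

Lemma ebits_None Es G D vs : None \notin (ebits Es G D vs).2.
Proof.
elim: vs D => [|v vs IH] D //=.
case: (_ != None) => //; case: (cont _ _) => //=.
by rewrite inE negb_or IH andbT; case: (_ == aZ).
Qed.

Section Agree.
Variables (n : nat) (E : {set {set 'I_n}}) (T : {set 'I_n}).
Hypothesis tT : Defs.transversal E T.
Let G := GT T.

Definition agree (D : seq a3) :=
  size D = n /\ forall v, v < n -> nth None D v = None \/ nth None D v = nth None G v.

Lemma cont_agree D : agree D -> ~~ cont (Eb E) D.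
Proof.
case=> sD H; apply/negP; rewrite cont_Eb // => /exists_inP[e eE /forall_inP He].
move/forall_inP: tT => /(_ e eE)/negP; apply.
rewrite disjoint_subset; apply/subsetP => i ie; rewrite inE.
by case: (H i (ltn_ord i)); rewrite (eqP (He i ie)) // nth_GT; case: (i \in T).
Qed.

Lemma agree_set D v a : agree D -> v < n -> nth None G v = Some a -> agree (set_nth None D v (Some a)).
Proof.
case=> sD H lt e; split=> [|w wn]; first by rewrite size_set_nth sD; lia.
by rewrite nth_set_nth /=; case: eqP => [->|_]; [right | apply: H].
Qed.

Lemma G_bit v : v < n -> nth None G v = aZ \/ nth None G v = aO.
Proof.
by move=> lt; rewrite -[v]/(nat_of_ord (Ordinal lt)) nth_GT; case: (_ \in T); [left | right].
Qed.

Lemma agree_nset D : agree D -> None \notin D -> D = G.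
Proof.
case=> sD H nD; apply: (@eq_from_nth _ None); rewrite ?size_GT // sD => v lt.
case: (H v lt) => // e; have : nth None D v \in D by rewrite mem_nth ?sD.
by rewrite e (negbTE nD).
Qed.

Lemma agree_init : agree (nseq n None).
Proof. by split=> [|v lt]; rewrite ?size_nseq // nth_nseq lt; left. Qed.

(** If [v] were outside [T], the completed hyperedge would lie in the complement of [T], which
    contains none. *)
Lemma agree_forced D v : agree D -> v < n -> cont (Eb E) (set_nth None D v aO) -> nth None G v = aZ.
Proof.
move=> aD lt c; have [//|e] := G_bit lt.
by have := cont_agree (agree_set aD lt e); rewrite c.
Qed.

Lemma agree_ebits vs D : agree D -> all (fun v => v < n) vs -> agree (ebits (Eb E) G D vs).1.
Proof.
elim: vs D => [|v vs IH] D aD //= /andP[lt lvs].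
case: (_ != None); first exact: IH.
case c: (cont _ _).
  by apply: IH => //; apply: agree_set => //; apply: agree_forced c.
apply: IH => //; rewrite (set_nth_default None) ?size_GT //.
by have [e|e] := G_bit lt; rewrite e; apply: agree_set.
Qed.
End Agree.

(** * The list of output sets *)

Section Out.
Variables (n : nat) (E : {set {set 'I_n}}) (B : nat) (SB : seq a3).
Let ws := enumW B.+1 B [::].
Let us := SB :: desc (bnum SB) SB.
Let Q := nseq B aO.
Let r w u := runM (Eb E) n false [::] u w.
Let cond w u := [&& (r w u).2, None \notin (r w u).1.1, (r w u).1.2 == [::], acc (Eb E) (r w u).1.1 &
         ~~ has (fun v => good (Eb E) n (r w u).1.1 v Q) (desc (bnum u) u)].
Let eb G u := ebits (Eb E) G (nseq n None) (visits n u).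

Definition outL : seq {set 'I_n} :=
  [seq inset n (r p.1 p.2).1.1 | p <- [seq (w, u) | w <- ws, u <- us] & cond p.1 p.2].

Lemma wsP w : reflect (None \notin w /\ wcost w <= B) (w \in ws).
Proof.
apply: (iffP (mem_enumW _ _ (ltnSn B))); first by case=> y []; rewrite cats0 => -> .
by case=> h1 h2; exists w; rewrite cats0.
Qed.

Lemma usP u : (u \in us) = (bnum u <= bnum SB).
Proof.
rewrite inE mem_desc // [in RHS]leq_eqVlt; congr (_ || _).
by apply/eqP/eqP => [->|/bnum_inj].
Qed.

Lemma out_enc : flatten [seq outW (Eb E) n Q SB w | w <- ws] = enc_sets outL.
Proof.
have emE w u : em (Eb E) n Q w u = enc_sets [seq inset n (r p.1 p.2).1.1 | p <- [:: (w, u)] & cond p.1 p.2].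
  rewrite /em /= -/(r w u) -/(cond w u); case: ifP => //= _.
  by rewrite /enc_sets /= cats0 (@eo_enc n) // size_runM.
have catE (L1 L2 : seq {set 'I_n}) : enc_sets (L1 ++ L2) = enc_sets L1 ++ enc_sets L2.
  by rewrite /enc_sets map_cat flatten_cat.
suff H us' ws' : flatten [seq flatten [seq em (Eb E) n Q w v | v <- us'] | w <- ws'] =
  enc_sets [seq inset n (r p.1 p.2).1.1 | p <- [seq (w, u) | w <- ws', u <- us'] & cond p.1 p.2].
  exact: H.
elim: ws' => [|w w' IH] //=.
rewrite filter_cat map_cat catE -IH; congr (_ ++ _).
elim: us' {IH} => [|u u' IHu] //.
rewrite [LHS]/= IHu emE -catE -map_cat -filter_cat.
by [].
Qed.

(** An accepted pair is recovered from its set and [u]: the advice is the one the encoder computes,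
    and its cost shows that [u] is good for the set. *)
Lemma cond_dec w u : w \in ws -> cond w u ->
  [/\ GT (inset n (r w u).1.1) = (r w u).1.1, eb (r w u).1.1 u = ((r w u).1.1, w) &
      good (Eb E) n (r w u).1.1 u Q].
Proof.
move=> /wsP[nw cw] /and5P[ok nD /eqP q0 aD _].
have sD : size (r w u).1.1 = n by rewrite size_runM.
move: ok nD q0 aD sD; case re: (r w u) => [[D q] ok'] /= ok nD q0 aD sD.
rewrite {}ok {}q0 in re.
have [|bs eE wb] := @dec_sound (Eb E) D (visits n u) (nseq n None) w D [::] nw re.
  move=> v a e; rewrite -e; apply: set_nth_default.
  by rewrite ltnNge; apply/negP => h; rewrite nth_default in e.
rewrite cats0 in wb; rewrite -wb in eE.
split; [exact: GT_inset | exact: eE |].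
rewrite /good /runM; have [-> ->] := enc_ebits (Eb E) D (visits n u) (nseq n None) Q true.
by rewrite eE /= size_nseq cw.
Qed.

Lemma memp w u : (w, u) \in [seq (w, u) | w <- ws, u <- us] -> w \in ws.
Proof. by case/allpairsP => -[w' u'] [/= m _ [-> _]]. Qed.

Lemma memp_in w u : w \in ws -> u \in us -> (w, u) \in [seq (w, u) | w <- ws, u <- us].
Proof. by move=> h1 h2; apply/allpairsP; exists (w, u). Qed.

(** If two accepted pairs gave the same set, the one with the larger order would have been rejected
    because of the smaller; for equal orders the encoder yields equal advice. *)
Lemma outL_uniq : uniq outL.
Proof.
rewrite map_inj_in_uniq.
  rewrite filter_uniq // allpairs_uniq //.
  - exact: uniq_enumW.
  - by rewrite /= desc_uniq // mem_desc // ltnn.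
  - by move=> [? ?] [? ?] _ _ [-> ->].
move=> [w u] [w' u']; rewrite !mem_filter => /andP[c1 /memp m1] /andP[c2 /memp m2] e.
rewrite /= in c1 c2 e.
have [g1 e1 G1] := cond_dec m1 c1; have [g2 e2 G2] := cond_dec m2 c2.
have eD : (r w u).1.1 = (r w' u').1.1 by rewrite -g1 -g2 e.
have [lt|gt|eu] := ltngtP (bnum u) (bnum u').
- case/and5P: c2 => _ _ _ _ /hasPn/(_ u); rewrite mem_desc // lt => /(_ isT).
  by rewrite -eD G1.
- case/and5P: c1 => _ _ _ _ /hasPn/(_ u'); rewrite mem_desc // gt => /(_ isT).
  by rewrite eD G2.
have uu := bnum_inj eu; subst u'; congr (_, _).
by have := e1; rewrite eD e2 => -[].
Qed.

Lemma outL_sound S : S \in outL -> minimal_transversal E S.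
Proof.
case/mapP => -[w u]; rewrite mem_filter => /andP[c /memp m] ->; rewrite /= in c *.
have [g _ _] := cond_dec m c.
by case/and5P: c => _ _ _ aD _; rewrite -acc_min g.
Qed.

Lemma outL_complete S : minimal_transversal E S ->
  (exists2 u, u \in us & good (Eb E) n (GT S) u Q) -> S \in outL.
Proof.
move=> mS ex_u; have tS : Defs.transversal E S by case/minsetP: mS.
(* Only the least good order survives the duplicate test, so this is the one to exhibit. *)
pose P k := has (fun u => (bnum u == k) && good (Eb E) n (GT S) u Q) us.
have exP : exists k, P k.
  by case: ex_u => u uu g; exists (bnum u); apply/hasP; exists u; rewrite ?eqxx.
case: (ex_minnP exP) => k /hasP[u uu /andP[/eqP ku g]] mink.
pose e := eb (GT S) u.
have [agE bE nE] : [/\ e.1 = GT S, wcost e.2 <= B & None \notin e.1].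
  move: g; rewrite /good /runM.
  have [-> ->] := enc_ebits (Eb E) (GT S) (visits n u) (nseq n None) Q true.
  rewrite -/(eb (GT S) u) -/e size_nseq => /andP[/= c ne]; split=> //.
  apply: agree_nset ne; apply: (agree_ebits tS (agree_init S)).
  by apply/allP => v /visits_lt.
have re : r e.2 u = (GT S, [::], true).
  by rewrite /r /runM -[e.2]cats0 dec_ebits -/(eb (GT S) u) -/e agE.
apply/mapP; exists (e.2, u); last by rewrite /= re inset_GT.
rewrite mem_filter; apply/andP; split; last first.
  by apply: memp_in => //; apply/wsP; split=> //; apply: ebits_None.
rewrite [(_, _).1]/= [(_, _).2]/= /cond re /= GT_None acc_min mS /=.
apply/hasPn => v; rewrite mem_desc // => lt; apply/negP => gv.
have /mink : P (bnum v).
  apply/hasP; exists v; last by rewrite eqxx.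
  by move: uu; rewrite !usP => h; apply: leq_trans (ltnW lt) h.
by rewrite -ku leqNgt lt.
Qed.
End Out.

Lemma ebits_keep Es G vs D v a :
  nth None D v = Some a -> nth None (ebits Es G D vs).1 v = Some a.
Proof.
elim: vs D => [|x vs IH] D E //=.
case xn : (nth None D x); first by apply: IH.
have ne : v <> x by move=> e; rewrite -e E in xn.
have H b : nth None (set_nth None D x b) v = Some a by rewrite nth_set_nth /=; case: eqP.
by rewrite eqxx /=; case: (cont _ _); apply: IH.
Qed.

Lemma ebits_decided Es G vs D v : v \in vs -> nth None (ebits Es G D vs).1 v != None.
Proof.
elim: vs D => [|x vs IH] D //=; rewrite inE.
have [->|ne] := eqVneq v x; last first.
  by move=> /= vin; case: (nth None D x != None); [|case: (cont _ _)]; apply: IH.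
move=> _; case xn : (nth None D x) => [a|] /=.
  by rewrite (ebits_keep _ _ _ xn).
have H b : nth None (set_nth None D x (Some b)) x = Some b by rewrite nth_set_nth /= eqxx.
case: (cont _ _) => /=; first by rewrite (ebits_keep _ _ _ (H _)).
by case: (_ == aZ); rewrite (ebits_keep _ _ _ (H _)).
Qed.

(** * Cost of encoding a set along a given visit sequence *)

Section Cost.
Variables (n : nat) (E : {set {set 'I_n}}) (T : {set 'I_n}).
Hypothesis tT : Defs.transversal E T.
Variables (vs0 : seq nat) (g : pred 'I_n).
Hypothesis vs0n : all (fun v => v < n) vs0.
Hypothesis gP : forall v : 'I_n, v \in T -> g v -> exists2 e, e \in E &
  forall i : 'I_n, i \in e -> i != v -> i \notin T /\ index (i : nat) vs0 < index (v : nat) vs0.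

Definition cv (v : 'I_n) := if v \in T then (if g v then 0 else 5) else 4.

(** When a vertex of [T] marked by [g] comes up, the others in its hyperedge have been decided and,
    in agreement with [T], lie in O; so it is forced at no cost. Any other undecided vertex pays at
    most its [cv]. *)
Lemma ebits_cost vs2 : forall vs1 D, vs0 = vs1 ++ vs2 -> agree T D ->
  (forall w, w \in vs1 -> nth None D w != None) ->
  wcost (ebits (Eb E) (GT T) D vs2).2 <= \sum_(v < n | nth None D v == None) cv v.
Proof.
elim: vs2 => [|v vs2 IH] vs1 D evs aD dec //=.
have vn : v < n by move/allP: vs0n => /(_ v); rewrite evs mem_cat mem_head orbT; apply.
have evs' : vs0 = rcons vs1 v ++ vs2 by rewrite cat_rcons.
case vD : (nth None D v) => [a|] /=.
  apply: (IH (rcons vs1 v)) => // w; rewrite mem_rcons inE => /orP[/eqP ->|]; first by rewrite vD.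
  exact: dec.
have dec' x w : w \in rcons vs1 v -> nth None (set_nth None D v (Some x)) w != None.
  by rewrite nth_set_nth mem_rcons inE /=; case: eqP => //= _; apply: dec.
pose o := Ordinal vn.
have sumE x : \sum_(w < n | nth None D w == None) cv w =
    cv o + \sum_(w < n | nth None (set_nth None D v (Some x)) w == None) cv w.
  rewrite (bigD1 o) /=; last by apply/eqP.
  congr (_ + _); apply: eq_bigl => w; rewrite nth_set_nth /=.
  have -> : (w != o) = ((w : nat) != v) by [].
  by case: (eqVneq (w : nat) v) => _; rewrite ?andbF ?andbT.
case c : (cont _ _).
  rewrite (sumE false); apply: leq_trans (leq_addl _ _); apply: IH evs' _ _; last exact: dec'.
  by apply: (agree_set tT aD vn (agree_forced tT aD vn c)).
have GvE : nth None (GT T) v = if o \in T then aZ else aO by rewrite -[v]/(nat_of_ord o) nth_GT.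
have GvE' : nth aO (GT T) v = if o \in T then aZ else aO by rewrite -[v]/(nat_of_ord o) nth_GT.
have step : (if (if nth aO (GT T) v == aZ then aO else aZ) == aO then 5 else 4) <= cv o.
  rewrite GvE' /cv; case oT : (o \in T) => //=.
  case go : (g o) => //; exfalso.
  have [e eE He] := gP oT go.
  move/negP: (negbT c); apply; rewrite cont_Eb; last by rewrite size_set_nth; case: aD => -> _; lia.
  apply/exists_inP; exists e => //; apply/forall_inP => i ie.
  rewrite nth_set_nth /=; case: (eqVneq (i : nat) v) => // ne.
  have [iT lt] := He i ie ne.
  (* [index] refers to the first occurrence: being undecided, [v] has not been visited before. *)
  have vn1 : v \notin vs1 by apply/negP => /dec; rewrite vD.
  have idx : index v vs0 = size vs1 by rewrite evs index_cat (negbTE vn1) /= eqxx addn0.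
  have i1 : (i : nat) \in vs1.
    by move: lt; rewrite [index (o : nat) _]idx evs index_cat; case: ifP => // _; rewrite ltnNge leq_addr.
  have := dec _ i1; case: aD => _ /(_ i (ltn_ord i)) [->|->] // _.
  by rewrite nth_GT (negbTE iT).
rewrite /=; set x := if _ == aZ then aZ else aO.
have [b xb] : exists b, x = Some b by rewrite /x; case: ifP => _; [exists false | exists true].
rewrite (sumE b) -xb; apply: leq_add step _; apply: IH evs' _ _; last by rewrite xb; exact: dec'.
rewrite xb; apply: (agree_set tT) => //; rewrite -xb /x GvE' GvE; by case: (o \in T).
Qed.

(** Every vertex is charged 4, those of [T] one more, and the marked ones get their 5 back. *)
Lemma sum_cv : \sum_(v < n) cv v + 5 * #|[set v in T | g v]| = 4 * n + #|T|.
Proof.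
have -> : 4 * n = \sum_(v < n) 4 by rewrite sum_nat_const card_ord mulnC.
rewrite -!sum1_card big_distrr /= (big_mkcond (mem T)) (big_mkcond (mem [set v in T | g v])) -!big_split /=.
apply: eq_bigr => v _; rewrite /cv inE.
by case: (v \in T) => /=; [case: (g v)|].
Qed.

Lemma good_of B u : visits n u = vs0 -> (forall v, v < n -> v \in vs0) ->
  4 * n + #|T| <= B + 5 * #|[set v in T | g v]| ->
  good (Eb E) n (GT T) u (nseq B aO).
Proof.
move=> eu all_v le; rewrite /good /runM.
have [-> ->] := enc_ebits (Eb E) (GT T) (visits n u) (nseq n None) (nseq B aO) true.
rewrite eu size_nseq /=; apply/andP; split.
  have := @ebits_cost vs0 [::] (nseq n None) erefl (agree_init T).
  move=> /(_ (fun w h => ltac:(by []))) H; apply: leq_trans H _.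
  have := sum_cv; have -> : \sum_(v < n | nth None (nseq n None : seq a3) v == None) cv v = \sum_(v < n) cv v.
    by apply: eq_bigl => v; rewrite nth_nseq ltn_ord.
  by lia.
apply/negP => /(nthP None)[v].
have [sz _] := agree_ebits tT (agree_init T) vs0n.
rewrite sz => vn e; have := ebits_decided (Eb E) (GT T) (nseq n None) (all_v v vn).
by rewrite e.
Qed.
End Cost.

(** * Existence of a cheap order *)

Section Labels.
Variables (n m : nat).
Hypothesis m0 : 0 < m.
(** Residues are counted from the last vertex to match the reversal in [pat]. *)
Definition rho (v : nat) : 'I_m := Ordinal (ltn_pmod (n - v.+1) m0).
Variable f : {ffun 'I_m -> 'I_16}.
Definition lab (v : nat) : nat := f (rho v).
Definition chunk k : seq bool := [seq f r == k :> nat | r <- enum 'I_m].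
(** The bits are written in reverse because [chunks] collects them on a stack. *)
Definition code (ks : seq nat) : seq a3 :=
  flatten [seq map Some (rev (chunk k)) ++ [:: None] | k <- ks].

Lemma chunks_code C ks : chunks C (code ks) =
  if ks is k :: ks' then (map Some (chunk k) ++ C) :: [seq map Some (chunk i) | i <- ks'] else [::].
Proof.
elim: ks C => [|k ks IH] C //.
have H l C' u : chunks C' (map Some l ++ None :: u) = (catrev (map Some l) C') :: chunks [::] u.
  by elim: l C' => //= a l IHl C'; rewrite IHl.
rewrite /code /= -catA H -/(code ks) IH map_rev catrevE revK.
by case: (ks) => // k' ks'; rewrite cats0.
Qed.

Lemma nth_pat k v : v < n -> nth aZ (pat n (map Some (chunk k))) v = Some (lab v == k).
Proof.
have sc : size (map Some (chunk k) : seq a3) = m by rewrite size_map size_map size_enum_ord.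
move=> lt; rewrite /pat sc nth_rev; last by rewrite size_map size_iota.
rewrite size_map size_iota (nth_map 0); last by rewrite size_iota; lia.
rewrite nth_iota ?add0n; last lia.
rewrite (nth_map false); last by move: sc; rewrite size_map => ->; rewrite ltn_pmod.
rewrite (nth_map (rho v)) ?size_enum_ord ?ltn_pmod //.
by rewrite -[_ %% m]/(nat_of_ord (rho v)) nth_ord_enum.
Qed.

Definition rnds (ks : seq nat) := flatten [seq visf 0 (pat n (map Some (chunk k))) | k <- ks].

Lemma visits_code ks : visits n (code ks) = rnds ks.
Proof.
rewrite /visits chunks_code /rnds; case: ks => // k ks /=; rewrite cats0.
by rewrite -map_comp.
Qed.

Lemma mem_rnds ks v : (v \in rnds ks) = (v < n) && (lab v \in ks).
Proof.
apply/flattenP/andP => [[vs /mapP[k kk ->]]|[lt kk]].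
  rewrite mem_visf size_pat add0n => /and3P[_ lt]; rewrite subn0 nth_pat // => /eqP[/eqP ->].
  by [].
exists (visf 0 (pat n (map Some (chunk (lab v))))); first exact: map_f.
by rewrite mem_visf size_pat add0n lt subn0 nth_pat // eqxx.
Qed.

Lemma index_rnds i v : i < n -> v < n -> lab i < lab v ->
  index i (rnds (iota 0 16)) < index v (rnds (iota 0 16)).
Proof.
move=> iN vN lt; have l16 : lab v < 16 by rewrite /lab ltn_ord.
have -> : iota 0 16 = iota 0 (lab v) ++ iota (lab v) (16 - lab v) by rewrite -iotaD; congr iota; lia.
rewrite {1 2}/rnds map_cat flatten_cat -!/(rnds _) !index_cat !mem_rnds iN vN !mem_iota lt ltnn /=.
have : i \in rnds (iota 0 (lab v)) by rewrite mem_rnds iN mem_iota.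
rewrite -index_mem => h; apply: leq_trans h (leq_addr _ _).
Qed.

Lemma size_code ks : size (code ks) = size ks * m.+1.
Proof.
elim: ks => //= k ks IH; rewrite /code /= size_cat -/(code ks) IH size_cat size_map size_rev.
by rewrite size_map size_enum_ord addn1 mulSn.
Qed.
End Labels.

(** Given the label k of [r0], at least a proportion (k/16)^3 of the labellings of the other
    residues put all of [R] below k. The sum of k^3 over k < 16 is 120^2 = 64 * 225, while 16^4 = 64
    * 1024. *)
Lemma count_labels m (r0 : 'I_m) (R : {set 'I_m}) : r0 \notin R -> #|R| <= 3 ->
  225 * 16 ^ m <= 1024 * #|[set f : {ffun 'I_m -> 'I_16} | [forall r in R, f r < f r0]]|.
Proof.
move=> r0R cR; rewrite -(leq_pmul2l (isT : 0 < 64)) !mulnA.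
pose c (k : nat) (x : 'I_m) : nat := if x == r0 then 1 else if x \in R then k else 16.
pose F (k : 'I_16) (x : 'I_m) : pred 'I_16 :=
  fun j => if x == r0 then j == k else (x \in R) ==> (j < k).
have lt_card (k : 'I_16) : #|[pred j : 'I_16 | j < k]| = k.
  have -> : #|[pred j : 'I_16 | j < k]| = #|[set widen_ord (ltnW (ltn_ord k)) i | i in 'I_k]|.
    apply: eq_card => j; rewrite !inE; apply/idP/imsetP => [lt|[i _ ->]]; last by rewrite /= ltn_ord.
    by exists (Ordinal lt) => //; apply: val_inj.
  by rewrite card_imset ?card_ord // => i j /(congr1 val) /= /val_inj.
have cF k : #|family (F k)| = \prod_(x : 'I_m) c k x.
  rewrite card_family foldrE big_image /=; apply: eq_bigr => x _.
  rewrite /F /c; case: (x == r0); first exact: card1.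
  case: (x \in R) => /=; first exact: lt_card.
  by rewrite -[RHS](card_ord 16); apply: eq_card.
have cR' : #|[set x : 'I_m | (x != r0) && (x \notin R)]| + #|R|.+1 = m.
  have H := cardsC (r0 |: R); rewrite card_ord cardsU1 r0R in H.
  have <- : #|~: (r0 |: R)| = #|[set x : 'I_m | (x != r0) && (x \notin R)]|.
    by apply: eq_card => x; rewrite !inE negb_or.
  by rewrite addnC -[RHS]H.
have pc k : \prod_(x : 'I_m) c k x = k ^ #|R| * 16 ^ #|[set x : 'I_m | (x != r0) && (x \notin R)]|.
  rewrite (bigD1 r0) //= {1}/c eqxx mul1n (bigID (mem R)) /=; congr (_ * _).
    rewrite -prod_nat_const; apply: eq_big => x; last by rewrite /c => /andP[/negbTE -> ->].
    by case: eqP => // -> ; rewrite (negbTE r0R).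
  rewrite -prod_nat_const; apply: eq_big => x; first by rewrite inE.
  by rewrite /c => /andP[/negbTE -> /negbTE ->].
have lower k : k <= 16 -> k ^ 3 * 16 ^ m <= 64 * 1024 * \prod_(x : 'I_m) c k x.
  move=> k16; rewrite pc; move: cR'; set a := #|[set x | _]| => cR'.
  have -> : 16 ^ m = 16 ^ a * 16 ^ #|R|.+1 by rewrite -expnD cR'.
  have -> : k ^ 3 = k ^ #|R| * k ^ (3 - #|R|) by rewrite -expnD subnKC.
  have e16 : 64 * 1024 = 16 ^ #|R|.+1 * 16 ^ (3 - #|R|) by rewrite -expnD addSn subnKC.
  have h : k ^ (3 - #|R|) <= 16 ^ (3 - #|R|) by case: (3 - _) => // x; rewrite leq_exp2r.
  rewrite e16.
  have -> : k ^ #|R| * k ^ (3 - #|R|) * (16 ^ a * 16 ^ #|R|.+1) =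
    k ^ #|R| * 16 ^ a * 16 ^ #|R|.+1 * k ^ (3 - #|R|) by lia.
  have -> : 16 ^ #|R|.+1 * 16 ^ (3 - #|R|) * (k ^ #|R| * 16 ^ a) =
    k ^ #|R| * 16 ^ a * 16 ^ #|R|.+1 * 16 ^ (3 - #|R|) by lia.
  by rewrite leq_mul2l h orbT.
have -> : #|[set f : {ffun 'I_m -> 'I_16} | [forall r in R, f r < f r0]]| =
   \sum_(k < 16) #|family (F k)|.
  rewrite -sum1_card (partition_big (fun f : {ffun 'I_m -> 'I_16} => f r0) predT) //=.
  apply: eq_bigr => k _; rewrite sum1_card; apply: eq_card => f.
  rewrite [LHS]unfold_in /= inE; apply/andP/familyP => [[/forall_inP H /eqP e] x|H].
    rewrite unfold_in /F; case: eqP => [->|_]; first by rewrite e.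
    by apply/implyP => xR; rewrite -e; apply: H.
  have e : f r0 = k by apply/eqP; have := H r0; rewrite unfold_in /F eqxx.
  split; last by rewrite e.
  apply/forall_inP => r rR; have := H r; rewrite unfold_in /F rR e.
  by case: eqP => [re|_] //; move: rR; rewrite re (negbTE r0R).
rewrite big_distrr /=.
apply: leq_trans (_ : \sum_(k < 16) k ^ 3 * 16 ^ m <= _); last first.
  by apply: leq_sum => k _; rewrite cF lower // ltnW.
rewrite -big_distrl /=; suff -> : \sum_(k < 16) k ^ 3 = 64 * 225 by [].
by rewrite -(big_mkord predT (fun k => k ^ 3)) unlock.
Qed.

(** The quotients of [d] by its divisors are distinct, and those by divisors at least [M] lie
    between 1 and [n %/ M]. *)
Lemma count_divisors M d n : 0 < M -> 0 < d < n ->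
  count (fun m => m %| d) (iota M M) <= n %/ M.
Proof.
move=> M0 /andP[d0 dn]; rewrite -size_filter -(size_map (fun m => d %/ m)) -(size_iota 1 (n %/ M)).
apply: uniq_leq_size.
  rewrite map_inj_in_uniq ?filter_uniq ?iota_uniq // => a b; rewrite !mem_filter.
  case/andP=> da _ /andP[db _] e; have : d %/ a * a = d %/ b * b by rewrite !divnK.
  rewrite e => /eqP; rewrite eqn_mul2l => /orP[|/eqP //].
  by rewrite -e => /eqP h; move: d0; rewrite -(divnK da) h.
move=> x /mapP[m]; rewrite mem_filter mem_iota => /andP[dm /andP[Mm _]] ->.
have m0 : 0 < m by apply: leq_trans Mm.
rewrite mem_iota add1n ltnS divn_gt0 // dvdn_leq //=.
apply: leq_trans (leq_div2l d M0 Mm) _; exact: leq_div2r (ltnW dn).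
Qed.

(** One of the truncated differences is zero, so their sum is the distance of [i] and [v]. *)
Lemma residue_dvd n m i v : i < n -> v < n -> (n - i.+1) %% m = (n - v.+1) %% m -> m %| (i - v) + (v - i).
Proof.
move=> iN vN; wlog le : i v iN vN / i <= v.
  by move=> H; case/orP: (leq_total i v) => /H; [exact | rewrite addnC => h e; apply: h].
move=> /eqP; rewrite eqn_mod_dvd; last lia.
by have -> : n - i.+1 - (n - v.+1) = i - v + (v - i) by lia.
Qed.

Section Exists.
Variables (n : nat) (E : {set {set 'I_n}}) (T : {set 'I_n}).
Hypotheses (mT : minimal_transversal E T) (rk : rank_le E 4).

(** By minimality, [T :\ v] misses some hyperedge; [T] meets it, hence only in [v]. *)
Lemma private v : v \in T -> exists2 e, e \in E & (v \in e) && [forall i in e, (i != v) ==> (i \notin T)].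
Proof.
move=> vT; case/minsetP: mT => tT H.
have : ~~ Defs.transversal E (T :\ v).
  by apply/negP => /H/(_ (subD1set _ _))/setP/(_ v); rewrite !inE eqxx vT.
rewrite negb_forall_in => /exists_inP[e eE]; rewrite negbK => dj.
move/forall_inP: tT => /(_ e eE) ne; exists e => //.
have P i : i \in e -> i != v -> i \notin T.
  move=> ie iv; move: dj; rewrite disjoint_subset => /subsetP/(_ i ie).
  by rewrite !inE iv.
apply/andP; split; last first.
  by apply/forall_inP => i ie; apply/implyP; apply: P.
apply: contraNT ne => ve; rewrite disjoint_subset; apply/subsetP => i ie; rewrite inE.
by apply: P => //; apply: contraNneq ve => <-.
Qed.

Definition pe (v : 'I_n) : {set 'I_n} :=
  odflt set0 [pick e in E | (v \in e) && [forall i in e, (i != v) ==> (i \notin T)]].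

Lemma peP v : v \in T -> [/\ pe v \in E, v \in pe v, #|pe v :\ v| <= 3 &
  forall i, i \in pe v -> i != v -> i \notin T].
Proof.
move=> vT; rewrite /pe; case: pickP => [e /andP[eE /andP[ve /forall_inP H]]|H] /=; last first.
  by have [e eE He] := private vT; have := H e; rewrite /= eE He.
split=> //; last by move=> i /H/implyP.
by move/forall_inP: rk => /(_ e eE); rewrite (cardsD1 v e) ve add1n ltnS.
Qed.

Definition bad m (v : 'I_n) := [exists i in pe v, (i != v) && ((n - i.+1) %% m == (n - v.+1) %% m)].

(** Double counting: a vertex has at most three companions in its private hyperedge, each of which
    spoils at most [n %/ M] of the [M] periods. If every period were too bad, this would contradict
    [40 * (n %/ M) <= M]. *)
Lemma exists_m M : 0 < M -> 40 * n <= M * M ->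
  exists2 m, M <= m < M + M & 40 * #|[set v in T | bad m v]| <= 3 * #|T|.
Proof.
move=> M0 nM.
case: (boolP (has (fun m => 40 * #|[set v in T | bad m v]| <= 3 * #|T|) (iota M M))) => [/hasP[m]|/hasPn H].
  by rewrite mem_iota => ? ?; exists m.
have card_bad m : #|[set v in T | bad m v]| = \sum_(v in T) bad m v.
  rewrite -sum1_card big_mkcond [in RHS]big_mkcond; apply: eq_bigr => v _; rewrite inE.
  by case: (v \in T); case: (bad m v).
have S1 : \sum_(m <- iota M M) #|[set v in T | bad m v]| <= #|T| * (3 * (n %/ M)).
  under eq_bigr do rewrite card_bad.
  rewrite exchange_big -sum_nat_const; apply: leq_sum => v vT.
  have [_ _ c3 _] := peP vT.
  apply: leq_trans (_ : \sum_(m <- iota M M) \sum_(i in pe v :\ v) (m %| (i - v) + (v - i)) <= _).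
    apply: leq_sum => m _; case: (boolP (bad m v)) => // /exists_inP[i ie /andP[iv /eqP e]].
    rewrite (bigD1 i) /=; last by rewrite !inE iv.
    by rewrite (@residue_dvd n).
  rewrite exchange_big; apply: leq_trans (_ : \sum_(i in pe v :\ v) n %/ M <= _).
    apply: leq_sum => i; rewrite !inE => /andP[iv _].
    have -> : \sum_(m <- iota M M) (m %| (i - v) + (v - i)) = count (fun m => m %| (i - v) + (v - i)) (iota M M).
      by rewrite -sum1_count [RHS]big_mkcond; apply: eq_bigr => m _; case: (m %| _).
    apply: count_divisors => //; have := ltn_ord i; have := ltn_ord v.
    have : (i : nat) <> v by move=> h; move/eqP: iv; apply; apply: val_inj.
    lia.
  by rewrite sum_nat_const leq_mul2r c3 orbT.
have S2 : M * (3 * #|T|).+1 <= 40 * \sum_(m <- iota M M) #|[set v in T | bad m v]|.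
  rewrite big_distrr /= big_seq; apply: leq_trans (_ : \sum_(m <- iota M M | m \in iota M M) (3 * #|T|).+1 <= _).
    by rewrite -big_seq big_const_seq count_predT size_iota iter_addn_0 mulnC.
  by apply: leq_sum => m /H; rewrite ltnNge.
have := leq_divM n M; move: (n %/ M) S1 => d S1 dM.
have d40 : 40 * d <= M.
  by rewrite -(leq_pmul2r M0); lia.
have : 40 * (#|T| * (3 * d)) <= 3 * #|T| * M by rewrite (_ : 40 * _ = 3 * #|T| * (40 * d)) ?leq_mul2l ?d40 ?orbT //; lia.
lia.
Qed.

Definition gf m (m0 : 0 < m) (f : {ffun 'I_m -> 'I_16}) (v : 'I_n) :=
  [forall i in pe v, (i != v) ==> (lab n m0 f i < lab n m0 f v)].

(** Averaging over all labellings: for a vertex that is not [bad], the companions' residues differ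
    from its own, so [count_labels] applies. *)
Lemma exists_f m (m0 : 0 < m) :
  exists f, 225 * #|[set v in T | ~~ bad m v]| <= 1024 * #|[set v in T | gf m0 f v]|.
Proof.
case: (boolP [exists f : {ffun 'I_m -> 'I_16}, 225 * #|[set v in T | ~~ bad m v]| <= 1024 * #|[set v in T | gf m0 f v]|]).
  by case/existsP=> f Hf; exists f.
rewrite negb_exists => /forallP H.
have cF : #|{ffun 'I_m -> 'I_16}| = 16 ^ m by rewrite card_ffun !card_ord.
have card_g f : #|[set v in T | gf m0 f v]| = \sum_(v in T) gf m0 f v.
  rewrite -sum1_card big_mkcond [in RHS]big_mkcond; apply: eq_bigr => v _; rewrite inE.
  by case: (v \in T); case: (gf m0 f v).
have S1 : #|[set v in T | ~~ bad m v]| * (225 * 16 ^ m) <=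
    1024 * \sum_(f : {ffun 'I_m -> 'I_16}) #|[set v in T | gf m0 f v]|.
  under eq_bigr do rewrite card_g.
  rewrite exchange_big /= big_distrr /= -sum_nat_const [X in _ <= X](bigID (fun v => ~~ bad m v)) /=.
  apply: leq_trans (leq_addr _ _).
  rewrite (eq_bigl (fun v => (v \in T) && ~~ bad m v)); last by move=> v; rewrite inE.
  apply: leq_sum => v /andP[vT nb].
  have [_ ve c3 _] := peP vT.
  have := @count_labels m (rho n m0 v) [set rho n m0 (i : 'I_n) | i in pe v :\ v].
  move=> /(_ _ _)/leq_trans; apply.
  - apply/imsetP => -[i]; rewrite !inE => /andP[iv ie] /(congr1 val) /= e.
    by move/negP: nb; apply; apply/exists_inP; exists i => //; rewrite iv e eqxx.
  - exact: leq_trans (leq_imset_card _ _) c3.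
  rewrite leq_mul2l /= -sum1_card big_mkcond; apply: leq_sum => f _.
  rewrite inE; case: ifP => // /forall_inP Hf; rewrite lt0b.
  apply/forall_inP => i ie; apply/implyP => iv; rewrite /lab; apply: Hf.
  by apply: imset_f; rewrite !inE iv.
have S2 : \sum_(f : {ffun 'I_m -> 'I_16}) (1024 * #|[set v in T | gf m0 f v]|).+1 <=
   \sum_(f : {ffun 'I_m -> 'I_16}) 225 * #|[set v in T | ~~ bad m v]|.
  by apply: leq_sum => f _; rewrite ltnNge; apply: H.
move: S2; rewrite sum_nat_const cF.
under eq_bigr do rewrite -addn1.
rewrite big_split /= -big_distrr /= sum1_card cF.
have : 0 < 16 ^ m by rewrite expn_gt0.
move=> h1 h2; exfalso; move: S1 h1 h2; move: (bigop _ _ _) (16 ^ m) => X Y.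
move: #|[set v in T | ~~ bad m v]| => t; have -> : t * (225 * Y) = Y * (225 * t) by lia.
move: (Y * _); lia.
Qed.

Lemma exists_good q c0 : 0 < q -> 40 * (64 * q) ^ 2 <= c0 ->
  exists2 u, size u <= (n %/ q).+2 & good (Eb E) n (GT T) u (nseq (4 * n + c0) aO).
Proof.
move=> q0 hc; have tT : Defs.transversal E T by case/minsetP: mT.
have cT : #|T| <= n by rewrite -[X in _ <= X](card_ord n) max_card.
case: (leqP n c0) => nc.
  (* A single bit with period 1 visits all vertices in one round. Nothing is counted as forced: [c0]
     covers the excess |T| <= n. The length 2 of this string is the origin of the summand in
     [(n %/ q).+2]. *)
  exists [:: aO; None] => //.
  have eV : visits n [:: aO; None] = visf 0 (pat n [:: aO]) by rewrite /visits /= cats0.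
  have pO v : v < n -> nth aZ (pat n [:: aO]) v = aO.
    move=> lt; rewrite /pat nth_rev ?size_map ?size_iota // (nth_map 0) ?size_iota; last lia.
    by rewrite modn1.
  apply: (@good_of n E T tT (visf 0 (pat n [:: aO])) pred0) => //.
  - by apply/allP => v; rewrite mem_visf size_pat; lia.
  - by move=> v lt; rewrite mem_visf size_pat add0n lt subn0 pO.
  - lia.
(* The sixteen chunks, of at most 2M letters each with their separator, have total length at most
   32M <= n/q. As n exceeds [c0], M is at least n/(64q), whence M^2 >= 40n. *)
pose M := n %/ (32 * q).
have Mn : 64 * q * M >= n.
  have := ltn_pmod n (_ : 0 < 32 * q); have := divn_eq n (32 * q); rewrite -/M.
  have : 64 * q <= n by nia.
  nia.
have MM : 40 * n <= M * M by nia.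
have M0 : 0 < M by nia.
have [m /andP[mM mM2] hb] := exists_m M0 MM.
have m0 : 0 < m by apply: leq_trans mM.
have [f hf] := exists_f m0.
exists (code f (iota 0 16)).
  rewrite size_code size_iota.
  have : 32 * M <= n %/ q by rewrite leq_divRL // /M; have := leq_divM n (32 * q); nia.
  lia.
apply: (@good_of n E T tT (rnds n f (iota 0 16)) (gf m0 f)).
- by apply/allP => v; rewrite (mem_rnds _ m0) => /andP[].
- move=> v vT /forall_inP gv; have [eE _ _ pT] := peP vT.
  exists (pe v) => // i ie iv; split; first exact: pT.
  by apply: index_rnds => //; move: (gv i ie); rewrite iv.
- exact: visits_code.
- by move=> v lt; rewrite (mem_rnds _ m0) lt mem_iota /= ltn_ord.
have hs : #|[set v in T | bad m v]| + #|[set v in T | ~~ bad m v]| = #|T|.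
  rewrite -(cardsID [set v | bad m v] T); congr (_ + _); apply: eq_card => v; rewrite !inE //.
  by rewrite andbC.
(* A fifth of [T] is marked, since 225 * 37 * 5 = 41625 exceeds 1024 * 40 = 40960. *)
lia.
Qed.
End Exists.

(** * Time bound *)

(** The left-hand side is a term of the binomial expansion of the right-hand side. *)
Lemma succ_mul_exp p n : n.+1 * p ^ n <= p.+1 ^ n.+1.
Proof.
elim: n => [|n IH]; first by rewrite expn0 expn1; lia.
have : p ^ n.+1 <= p.+1 ^ n.+1 by rewrite leq_exp2r.
rewrite (expnS p n) (expnS p.+1 n.+1); move: (p ^ n) (p.+1 ^ n.+1) IH => x y; nia.
Qed.

(** One factor n + 1 is absorbed between the mean of [p] and [r] and [r] itself; doubling the bases
    keeps the mean integral. *)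
Lemma poly_exp d : forall p r, p < r -> exists C, forall n, n.+1 ^ d * p ^ n <= C * r ^ n.
Proof.
elim: d => [|d IH] p r pr.
  by exists 1 => n; rewrite !mul1n; case: n => // n; rewrite leq_exp2r // ltnW.
have [|C1 H1] := IH (2 * p) (p + r); first lia.
exists (C1 * (p + r).+1) => n.
have e2 : 0 < 2 ^ n by rewrite expn_gt0.
rewrite -(leq_pmul2l e2).
have h1 := H1 n; have h2 := succ_mul_exp (p + r) n.
have h3 : (p + r).+1 ^ n <= (2 * r) ^ n by case: (n) => // k; rewrite leq_exp2r //; lia.
rewrite expnMn in h1; rewrite expnMn in h3; rewrite expnS in h2; rewrite expnS.
move: (n.+1 ^ d) (2 ^ n) (p ^ n) (r ^ n) ((p + r) ^ n) ((p + r).+1 ^ n) h1 h2 h3 => a b c e f g h1 h2 h3.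
have -> : b * (n.+1 * a * c) = n.+1 * (a * (b * c)) by lia.
apply: leq_trans (_ : n.+1 * (C1 * f) <= _); first by rewrite leq_mul2l h1 orbT.
have -> : n.+1 * (C1 * f) = C1 * (n.+1 * f) by lia.
have -> : b * (C1 * (p + r).+1 * e) = C1 * ((p + r).+1 * (b * e)) by lia.
rewrite leq_mul2l; apply/orP; right; apply: leq_trans h2 _.
by rewrite leq_mul2l h3 orbT.
Qed.

(** Makes the q-th root of [s] at most (h+1)/h. With q = s * h the left-hand side is q * h^(q-1), so
    [succ_mul_exp] applies. *)
Lemma small_root s h : 0 < s -> 0 < h -> exists2 q, 0 < q & s * h ^ q <= h.+1 ^ q.
Proof.
move=> s0 h0; have [q e] : exists q, q.+1 = s * h by exists (s * h).-1; rewrite prednK // muln_gt0 s0.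
exists q.+1; first exact: ltn0Sn.
by rewrite expnS mulnA -e; apply: succ_mul_exp.
Qed.

Lemma root_exp s a b q n : 0 < q -> a <= b -> s * a ^ q <= b ^ q -> s ^ (n %/ q) * a ^ n <= b ^ n.
Proof.
move=> q0 ab H; have e x : x ^ n = (x ^ q) ^ (n %/ q) * x ^ (n %% q).
  by rewrite -expnM -expnD mulnC -divn_eq.
have mono x y k : x <= y -> x ^ k <= y ^ k by case: k => // k; rewrite leq_exp2r.
by rewrite (e a) (e b) mulnA -expnMn; apply: leq_mul; apply: mono.
Qed.

(** Every hyperedge comes from a 4-tuple padded with [None]; the input is therefore of polynomial
    length. *)
Lemma card_rank n (E : {set {set 'I_n}}) : rank_le E 4 -> #|E| <= n.+1 ^ 4.
Proof.
move/forall_inP => rk.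
pose f (t : 4.-tuple (option 'I_n)) : {set 'I_n} := [set i | Some i \in t].
have -> : n.+1 ^ 4 = #|{: 4.-tuple (option 'I_n)}| by rewrite card_tuple card_option card_ord.
apply: leq_trans (leq_imset_card f _); apply: subset_leq_card.
apply/subsetP => e /rk le.
have st : size (map Some (enum e) ++ nseq (4 - #|e|) None) == 4.
  by rewrite size_cat size_map size_nseq -cardE subnKC.
apply/imsetP; exists (Tuple st) => //; apply/setP => i; rewrite inE.
have -> : (Some i \in Tuple st) = (Some i \in map Some (enum e) ++ nseq (4 - #|e|) None) by [].
rewrite mem_cat mem_nseq andbF orbF mem_map ?mem_enum //.
by move=> x y [].
Qed.

Lemma enc_inp n (E : {set {set 'I_n}}) : enc_hypergraph E = map sy (inp n (Eb E)).
Proof.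
rewrite /inp map_cat map_nseq /=; congr (_ ++ _ :: _).
rewrite /enc_sets /encE /Eb -map_comp map_flatten -map_comp; congr flatten.
apply: eq_map => e /=; rewrite map_cat /= -map_comp /bl -map_comp; congr (_ ++ _).
Qed.

Lemma size_encE n Es : all (fun e => size e == n) Es -> size (encE Es) = size Es * n.+1.
Proof.
elim: Es => //= e Es IH /andP[/eqP se sE].
by rewrite /encE /= size_cat -/(encE Es) IH // size_cat size_map se addn1 mulSn.
Qed.

Lemma bnum_le_nseq u k : size u <= k -> bnum u <= bnum (nseq k aS).
Proof.
elim: u k => [|a u IH] [|k] //= /IH.
have : dig a <= 3 by case: a => [[]|].
lia.
Qed.

(** The sixth power of [A] gives [n.+1 ^ 30]; the fourth power of [V] gives [s ^ (n %/ q)], which by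
    the choice of [q] costs at most h1/h0 per vertex; the advice strings give (a/b)^4 per vertex.
    The target base is r/h0^2, with all denominators cleared. *)
Lemma time_bound_aux n q c0 K C0 N V A a b r s h0 h1 :
  0 < b -> 0 < h0 -> s = 3 ^ 4 -> 0 < q -> h0 <= h1 -> s * h0 ^ q <= h1 ^ q ->
  n.+1 ^ 30 * (a ^ 4 * h1 * h0 ^ 2) ^ n <= C0 * (r * (b ^ 4 * h0)) ^ n ->
  N * b ^ (4 * n + c0) <= 2 * a ^ (4 * n + c0) ->
  V <= 3 ^ (n %/ q).+3 -> A = n.+1 ^ 5 * (c0 + q + 10) ->
  N * (K * (A * A * A * (V * V)) ^ 2) * (h0 ^ 2) ^ n <=
  2 * a ^ c0 * K * (c0 + q + 10) ^ 6 * s ^ 3 * C0 * r ^ n.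
Proof.
move=> b0 h00 es q0 h01 hq HC HN HV eA; set c := c0 + q + 10 in eA *.
set Y := b ^ (4 * n) * h0 ^ n.
have Y0 : 0 < Y by rewrite /Y muln_gt0 !expn_gt0 b0 h00.
rewrite -(leq_pmul2r Y0).
have hV : (V * V) ^ 2 <= s ^ (n %/ q) * s ^ 3.
  rewrite -expnD es -expnM (_ : (V * V) ^ 2 = V ^ 4); last by rewrite -[V * V]/(V ^ 2) -expnM.
  by rewrite addn3 [4 * _]mulnC expnM leq_exp2r.
have hA : (A * A * A) ^ 2 = n.+1 ^ 30 * c ^ 6.
  have -> : A * A * A = A ^ 3 by rewrite !expnS expn0 muln1 mulnA.
  by rewrite -expnM eA expnMn -expnM.
have hR : s ^ (n %/ q) * h0 ^ n <= h1 ^ n by apply: root_exp.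
rewrite expnMn hA.
have leb : Y <= b ^ (4 * n + c0) * h0 ^ n.
  by rewrite /Y leq_mul2r expnD leq_pmulr ?orbT // expn_gt0 b0.
apply: leq_trans (_ : N * (K * (n.+1 ^ 30 * c ^ 6 * (V * V) ^ 2)) * (h0 ^ 2) ^ n * (b ^ (4 * n + c0) * h0 ^ n) <= _).
  by rewrite leq_mul2l leb orbT.
have ea : a ^ (4 * n + c0) = (a ^ 4) ^ n * a ^ c0 by rewrite expnD expnM.
rewrite ea in HN.
have eY : Y = (b ^ 4) ^ n * h0 ^ n by rewrite /Y expnM.
have e1 : (a ^ 4 * h1 * h0 ^ 2) ^ n = (a ^ 4) ^ n * h1 ^ n * (h0 ^ 2) ^ n.
  by rewrite expnMn (expnMn (a ^ 4)).
have e2 : (r * (b ^ 4 * h0)) ^ n = r ^ n * ((b ^ 4) ^ n * h0 ^ n) by rewrite expnMn (expnMn (b ^ 4)).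
rewrite eY; rewrite e1 e2 in HC.
have H1 : (V * V) ^ 2 * h0 ^ n <= s ^ 3 * h1 ^ n.
  apply: leq_trans (_ : s ^ (n %/ q) * s ^ 3 * h0 ^ n <= _); first by rewrite leq_mul2r hV orbT.
  by rewrite mulnAC [s ^ 3 * _]mulnC leq_mul2r hR orbT.
have H2 := leq_mul HN H1.
move: ((a ^ 4) ^ n) ((h0 ^ 2) ^ n) (r ^ n) ((b ^ 4) ^ n) (h1 ^ n) (h0 ^ n)
  (b ^ (4 * n + c0)) (a ^ c0) (n.+1 ^ 30) (c ^ 6) (s ^ 3) ((V * V) ^ 2) HC H2 =>
  an hn x d e f g h i j k v HC H2.
have -> : N * (K * (i * j * v)) * hn * (g * f) = N * g * (v * f) * (K * i * j * hn) by lia.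
apply: leq_trans (_ : 2 * (an * h) * (k * e) * (K * i * j * hn) <= _); first by rewrite leq_mul2r H2 orbT.
have -> : 2 * (an * h) * (k * e) * (K * i * j * hn) = 2 * h * K * j * k * (i * (an * e * hn)) by lia.
have -> : 2 * h * K * j * k * C0 * x * (d * f) = 2 * h * K * j * k * (C0 * (x * (d * f))) by lia.
by rewrite leq_mul2l HC orbT.
Qed.

(* There is an algorithm (a Turing machine M) and a constant C such that on
   every n-vertex hypergraph H of rank at most 4, M halts within
   C * 1.8863^n steps and outputs a duplicate-free list of exactly the
   minimal transversals of H. (1.8863^n written as 18863^n / 10000^n.) *)
Theorem theorem3 :
  exists (M : TM) (C : nat),
    forall (n : nat) (E : {set {set 'I_n}}),
      rank_le E 4 ->
      exists (T : nat) (L : seq {set 'I_n}),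
        T * 10000 ^ n <= C * 18863 ^ n /\
        uniq L /\
        (forall S : {set 'I_n}, S \in L = minimal_transversal E S) /\
        halts_with_output M (enc_hypergraph E) T (enc_sets L).
Proof.
(* The numerals are hidden behind equations so that no unary power is ever computed. *)
have [a ea] : exists a, a = 467 by exists 467.
have [b eb] : exists b, b = 400 by exists 400.
have [s es] : exists s, s = 3 ^ 4 by exists (3 ^ 4).
have [q q0 hq] : exists2 q, 0 < q & s * 100 ^ q <= 101 ^ q by apply: small_root; rewrite ?es.
have [c0 hc] : exists c0, 40 * (64 * q) ^ 2 <= c0 by eexists; apply: leqnn.
have [K HK] := @prog_runs c0 q q0.
have [r er] : exists r, r = 100 * 188 + 63 by exists (100 * 188 + 63).
(* That is (467/400)^4 * 101/100 < 1.8863: the factor 101/100 pays for the orders, the strictness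
   for the polynomial. *)
have pr : a ^ 4 * 101 * 100 ^ 2 < r * (b ^ 4 * 100).
  by rewrite ea eb er !expnS !expn0; lia.
have [C0 HC0] := poly_exp 30 pr.
exists (TM_of (prog c0 q)).
exists (2 * a ^ c0 * K * (c0 + q + 10) ^ 6 * s ^ 3 * C0) => n E rk.
pose B := 4 * n + c0; pose SB : seq a3 := nseq (n %/ q).+2 aS.
pose A := n.+1 ^ 5 * (c0 + q + 10).
have n5 : n.+1 <= n.+1 ^ 5 by rewrite -{1}[n.+1]expn1 leq_pexp2l.
have sE : size (encE (Eb E)) <= n.+1 ^ 5.
  rewrite (size_encE (size_Eb E)) size_map -cardE (expnSr _ 4) leq_mul2r.
  by rewrite card_rank.
have nq : n %/ q <= n by apply: leq_div.
have nA x : x <= n.+1 ^ 5 -> x <= A by rewrite /A; nia.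
have [||||||l [rr [b' [R e]]]] := HK (Eb E) n A (bnum SB) B _ _ _ (size_Eb E) _ _ _ (leqnn _) erefl.
- by apply: nA; lia.
- exact: nA.
- by rewrite /A; nia.
- by rewrite /A; nia.
- by rewrite /A; nia.
- by rewrite /A; nia.
rewrite out_enc in e; rewrite -enc_inp in R.
set T := _ * _ in R.
exists T, (outL E B SB); split; last split; last split.
- have -> : 10000 = 100 ^ 2 by [].
  have -> : 18863 = r by rewrite er.
  apply: (@time_bound_aux n q c0 K C0 _ _ A a b r s 100 101) => //.
  + by rewrite eb.
  + have h := size_enumW [::] (ltnSn B); rewrite -ea -eb mulSn in h.
    exact: leq_trans (leq_addl _ _) h.
  + have := bnum_le SB; rewrite size_nseq; apply: leq_trans.
    by move: (bnum SB) => v; clear; lia.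
- exact: outL_uniq.
- move=> S; apply/idP/idP; first exact: outL_sound.
  move=> mS; apply: outL_complete => //.
  have [u su gu] := exists_good mS rk q0 hc.
  by exists u => //; rewrite usP; apply: bnum_le_nseq.
- exact: TM_of_runs R e.
Qed.
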